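(* Suppose that $X\subset\mathbb{P}^2$ is an irreducible projective curve of degree greater than one. Then there exists an osculating self-dual curve $C\subset\mathbb{P}^3$ such that $C$ is birational to $X$ and $\deg C=\deg X+\deg X^*$, where $X^*\subset(\mathbb{P}^2)^*$ is the dual curve of $X$.
   Context: The base field is $\mathbb{C}$. The dual curve $X^*\subset(\mathbb{P}^2)^*$ is the closure of the set of tangent lines to $X$ at smooth points. For a projective curve $C\subset\mathbb{P}^3$ not contained in a plane and a general point $x\in C$, there is a unique plane $\operatorname{Osc}^2_xC$ osculating to $C$ at $x$ to order $2$, i.e. containing $x$ and such that the restriction of its local equation to $C$ lies in $\mathfrak{m}_x^3$, where $\mathfrak{m}_x\subset\mathcal{O}_{x,C}$ is the maximal ideal. The osculating dual $C^\vee\subset(\mathbb{P}^3)^*$ is the closure of the set of points corresponding to the planes $\operatorname{Osc}^2_xC$ for general $x\in C$. The curve $C$ is called osculating self-dual if there is a projective (linear) isomorphism $\mathbb{P}^3\to(\mathbb{P}^3)^*$ mapping $C$ onto $C^\vee$; in particular an osculating self-dual curve is by definition not contained in a plane. *)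

(* Defs.v *)
From mathcomp Require Import all_boot all_order all_algebra.
From mathcomp Require Import boolp classical_sets functions cardinality reals.
From mathcomp Require Import complex mpoly.

Set Implicit Arguments.
Unset Strict Implicit.
Unset Printing Implicit Defensive.

Import GRing.Theory.
Local Open Scope classical_set_scope.
Local Open Scope ring_scope.

(* Points are the lines through the origin of K^(n+1); the dual projective
   space is the same type, read in the dual homogeneous coordinates. *)
Definition projspace (K : fieldType) (n : nat) : Type :=
  {U : {vspace 'rV[K]_n.+1} | \dim U == 1%N}.

Definition coords (K : fieldType) (n : nat) (x : projspace K n) : 'rV[K]_n.+1 :=
  vpick (val x).

(* [None] exactly when v = 0 *)
Definition point (K : fieldType) (n : nat) (v : 'rV[K]_n.+1) :
  option (projspace K n) := insub <[v]>%VS.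

(* The value at the chosen homogeneous coordinates: only its vanishing, for a
   homogeneous F, and quotients of two forms of equal degree, are intrinsic. *)
Definition value (K : fieldType) (n : nat) (F : {mpoly K[n.+1]})
  (x : projspace K n) : K := F.@[fun i => coords x 0 i].

Definition pairing (K : fieldType) (n : nat) (h x : projspace K n) : K :=
  \sum_i coords h 0 i * coords x 0 i.

Definition hyperplane (K : fieldType) (n : nat) (h : projspace K n) :
  set (projspace K n) := [set x | pairing h x = 0].

Definition homogeneous (K : fieldType) (n : nat) (F : {mpoly K[n]}) : Prop :=
  exists d : nat, F \is d.-homog.

Definition zclosed (K : fieldType) (n : nat) (V : set (projspace K n)) : Prop :=
  exists S : set {mpoly K[n.+1]}, S `<=` @homogeneous K n.+1 /\
    V = [set x | forall F, S F -> value F x = 0].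

Definition zopen (K : fieldType) (n : nat) (U : set (projspace K n)) : Prop :=
  zclosed (~` U).

Definition zclosure (K : fieldType) (n : nat) (A : set (projspace K n)) :
  set (projspace K n) :=
  \bigcap_(V in [set V | zclosed V /\ A `<=` V]) V.

Definition irreducible_closed (K : fieldType) (n : nat)
  (V : set (projspace K n)) : Prop :=
  [/\ zclosed V, V !=set0 & forall A B, zclosed A -> zclosed B ->
    V `<=` A `|` B -> V `<=` A \/ V `<=` B].

Definition has_chain (K : fieldType) (n : nat) (V : set (projspace K n))
  (d : nat) : Prop :=
  exists Z : nat -> set (projspace K n),
    (forall i, (i <= d)%N -> irreducible_closed (Z i) /\ Z i `<=` V) /\
    (forall i, (i < d)%N -> Z i `<` Z i.+1).

Definition has_dim (K : fieldType) (n : nat) (V : set (projspace K n))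
  (d : nat) : Prop := has_chain V d /\ ~ has_chain V d.+1.

Definition irreducible_curve (K : fieldType) (n : nat)
  (V : set (projspace K n)) : Prop := irreducible_closed V /\ has_dim V 1.

(* For a curve: the number of points of a general hyperplane section. The
   value 0 stands for the case in which there is no such number. *)
Definition degree (K : fieldType) (n : nat) (V : set (projspace K n)) : nat :=
  xget 0%N [set d | exists U : set (projspace K n), [/\ zopen U, U !=set0 &
    forall h, U h -> (V `&` hyperplane h #= `I_d)%card]].

(* Rational maps given by forms of one and the same degree, undefined where
   all of these forms vanish. *)
Definition formmap (K : fieldType) (n m : nat) (F : 'I_m.+1 -> {mpoly K[n.+1]})
  (x : projspace K n) : option (projspace K m) :=
  point (\row_j value (F j) x).

Definition rational_map (K : fieldType) (n m : nat) (X : set (projspace K n))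
  (Y : set (projspace K m)) (f : projspace K n -> option (projspace K m)) :
  Prop :=
  [/\ exists (d : nat) (F : 'I_m.+1 -> {mpoly K[n.+1]}),
        (forall j, F j \is d.-homog) /\ (forall x, X x -> f x = formmap F x),
      exists x y, X x /\ f x = Some y
    & forall x y, X x -> f x = Some y -> Y y].

Definition rational_retraction (K : fieldType) (n m : nat)
  (X : set (projspace K n)) (f : projspace K n -> option (projspace K m))
  (g : projspace K m -> option (projspace K n)) : Prop :=
  (exists x x', X x /\ obind g (f x) = Some x') /\
  (forall x x', X x -> obind g (f x) = Some x' -> x' = x).

Definition birational (K : fieldType) (n m : nat) (X : set (projspace K n))
  (Y : set (projspace K m)) : Prop :=
  exists (f : projspace K n -> option (projspace K m))
         (g : projspace K m -> option (projspace K n)),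
    [/\ rational_map X Y f, rational_map Y X g,
        rational_retraction X f g & rational_retraction Y g f].

Definition tangent_space (K : fieldType) (n : nat) (V : set (projspace K n))
  (x : projspace K n) : set (projspace K n) :=
  [set y | forall F : {mpoly K[n.+1]}, homogeneous F ->
     (forall z, V z -> value F z = 0) ->
     \sum_i value (mderiv i F) x * coords y 0 i = 0].

(* Smoothness of a curve at x: the tangent space is a projective line. *)
Definition smooth_point (K : fieldType) (n : nat) (V : set (projspace K n))
  (x : projspace K n) : Prop :=
  V x /\ exists W : {vspace 'rV[K]_n.+1}, \dim W = 2%N /\
    tangent_space V x = [set y | (val y <= W)%VS].

Definition dual_curve (K : fieldType) (X : set (projspace K 2)) :
  set (projspace K 2) :=
  zclosure [set l | exists2 x, smooth_point X x &
                               tangent_space X x = hyperplane l].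

(* f represents an element of the local ring of V at x; it is only relevant
   on some neighbourhood of x in V, which may be taken of the form G != 0. *)
Definition regular_at (K : fieldType) (n : nat) (V : set (projspace K n))
  (x : projspace K n) (f : projspace K n -> K) : Prop :=
  exists (d : nat) (F G : {mpoly K[n.+1]}),
    [/\ F \is d.-homog, G \is d.-homog, value G x != 0 &
        forall y, V y -> value G y != 0 -> f y = value F y / value G y].

Definition in_maximal_ideal (K : fieldType) (n : nat) (V : set (projspace K n))
  (x : projspace K n) (f : projspace K n -> K) : Prop :=
  regular_at V x f /\ f x = 0.

(* The germ of f belongs to the k-th power of the maximal ideal: it is a finite
   sum of products of k elements of that ideal. *)
Definition in_maximal_ideal_pow (K : fieldType) (n : nat)
  (V : set (projspace K n)) (x : projspace K n) (k : nat)
  (f : projspace K n -> K) : Prop :=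
  exists (r : nat) (a : 'I_r -> 'I_k -> projspace K n -> K),
    (forall i j, in_maximal_ideal V x (a i j)) /\
    exists U : set (projspace K n), [/\ zopen U, U x &
      forall y, V y -> U y -> f y = \sum_(i < r) \prod_(j < k) a i j y].

(* Near x the hyperplane h has the local equation h / g, for any linear form g
   with g(x) != 0. *)
Definition osculates (K : fieldType) (C : set (projspace K 3))
  (x h : projspace K 3) : Prop :=
  hyperplane h x /\ exists2 g : projspace K 3, pairing g x != 0 &
    in_maximal_ideal_pow C x 3 (fun y => pairing h y / pairing g y).

Definition is_Osc2 (K : fieldType) (C : set (projspace K 3))
  (x h : projspace K 3) : Prop :=
  osculates C x h /\ forall h', osculates C x h' -> h' = h.

(* "General x": the closures of the sets of planes Osc^2_x C, for x in a dense
   open subset U of C, do not depend on U once U is small enough, and C^\vee is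
   their common value, that is, the intersection over all U. *)
Definition osculating_dual (K : fieldType) (C : set (projspace K 3)) :
  set (projspace K 3) :=
  \bigcap_(U in [set U | zopen U /\ C `&` U !=set0])
    zclosure [set h | exists2 x, (C `&` U) x & is_Osc2 C x h].

Definition linear_image (K : fieldType) (n : nat) (M : 'M[K]_n.+1)
  (C : set (projspace K n)) : set (projspace K n) :=
  [set y | exists2 x, C x & point (coords x *m M) = Some y].

Definition osculating_self_dual (K : fieldType) (C : set (projspace K 3)) :
  Prop :=
  [/\ irreducible_curve C, forall h, ~ C `<=` hyperplane h &
      exists2 M : 'M[K]_4, M \in unitmx &
        linear_image M C = osculating_dual C].

(* Main.v *)
(* Let X be given by f (x, y) = 0, put p = dy/dx = - f_x / f_y, and let C be the closure of the
   set of points W = (1 : x : p : 2 y - x p). This is the Legendrian lift of X: for the symplectic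
   form w (u, v) = u0 v3 - u3 v0 + u1 v2 - u2 v1 one has w (W, W') = 0, and then w (W, W'') = 0 by
   differentiation, so the osculating plane at W is w (W, .) = 0 and the linear isomorphism
   attached to w maps C onto its osculating dual. Moreover (x, y) is rational in W.
   For the degrees, W = (f_y, x f_y, - f_x, 2 y f_y + x f_x), and the tangent line has coordinates
   (- x f_x - y f_y, f_x, f_y). Modulo f both systems generate over K[x] the same module,
   spanned by f_x, f_y and y f_y, so the norms to K[x] of their linear combinations have the same
   common factor D. If the line at infinity meets X in d distinct points, d = deg X, these norms
   have degree d^2 and d (d - 1) in general, so deg C = d^2 - deg D and
   deg X* = d (d - 1) - deg D, whose difference is d. *)

Require Import Defs.
From mathcomp Require Import all_boot all_order all_algebra.
From mathcomp Require Import boolp classical_sets functions cardinality reals.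
From mathcomp Require Import complex mpoly.
From mathcomp Require Import separable ring zify.

Set Implicit Arguments.
Unset Strict Implicit.
Unset Printing Implicit Defensive.

Import GRing.Theory.
Local Open Scope classical_set_scope.
Local Open Scope ring_scope.

(** * Points of projective space *)

Section ProjectivePoints.
Variables (K : fieldType) (n : nat).
Implicit Types (v w : 'rV[K]_n.+1) (x : projspace K n) (F : {mpoly K[n.+1]}).

(** A degree is the number of points of a set in a general hyperplane section, so a norm of degree N
    yields a degree only with three more facts. The norm divided by D has simple roots for a general
    member of the family: a Bertini argument on one pencil, in characteristic 0, spread to general
    members by a Sylvester determinant. Distinct points have distinct images: for W because x and y
    are rational in W, for tangent lines by biduality, the Gauss map being inverted by the gradient
    of an equation of least degree of the dual curve. Closing the image adds only finitely many
    points, which a general hyperplane avoids; this rests on algebraic relations found by counting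
    dimensions. No function field is formed: statements are made at the points of f = 0 outside the
    zeros of one polynomial q in x, and pass to closures because they are expressed by forms. The
    osculating plane is unique where W, W', W'' are independent. This fails identically only if y is
    a polynomial of degree at most 2 in x, which deg X > 1 and the choice of coordinates, with (0 :
    0 : 1) off X, exclude. *)

Definition mev F v : K := F.@[fun i => v 0 i].

Lemma base_point_subproof :
  \dim <[(delta_mx 0 0 : 'rV[K]_n.+1)%R]>%VS == 1%N.
Proof.
rewrite dim_vline; suff -> : (delta_mx 0 0 : 'rV[K]_n.+1) != 0 by [].
by apply/eqP => /matrixP /(_ 0 0); rewrite !mxE !eqxx; apply/eqP/oner_neq0.
Qed.

Definition base_point : projspace K n := exist (fun U : {vspace 'rV[K]_n.+1} => \dim U == 1%N) _ base_point_subproof.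

(* [pt 0] is the junk value [base_point] *)
Definition pt v : projspace K n := odflt base_point (Defs.point v).

Lemma pointN v : v != 0 -> exists2 x, Defs.point v = Some x & val x = <[v]>%VS.
Proof.
move=> v0; have h : \dim <[v]>%VS == 1%N by rewrite dim_vline v0.
exists (exist (fun U : {vspace 'rV[K]_n.+1} => \dim U == 1%N) _ h) => //.
exact: (insubT (fun U : {vspace 'rV[K]_n.+1} => \dim U == 1%N) h).
Qed.

Lemma point_pt v : v != 0 -> Defs.point v = Some (pt v).
Proof. by rewrite /pt => /pointN [x -> _]. Qed.

Lemma point0 v : v = 0 -> Defs.point v = None.
Proof.
move=> ->; have h : (\dim <[0 : 'rV[K]_n.+1]>%VS == 1%N) = false.
  by rewrite dim_vline eqxx.
exact: (insubF {U : {vspace 'rV[K]_n.+1} | \dim U == 1%N} h).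
Qed.

Lemma point_Some v x : Defs.point v = Some x -> v != 0 /\ x = pt v.
Proof.
have [->|v0] := eqVneq v 0; first by rewrite point0.
by rewrite point_pt // => -[].
Qed.

Lemma val_pt v : v != 0 -> val (pt v) = <[v]>%VS.
Proof. by rewrite /pt => /pointN [x -> ]. Qed.

Lemma coords_neq0 x : coords x != 0.
Proof. by rewrite /coords vpick0 -dimv_eq0 (eqP (valP x)). Qed.

Lemma val_coords x : val x = <[coords x]>%VS.
Proof.
apply/esym/eqP; rewrite eqEdim dim_vline coords_neq0 (eqP (valP x)) leqnn andbT.
by rewrite -memvE memv_pick.
Qed.

Lemma pt_coords x : pt (coords x) = x.
Proof. by apply: val_inj; rewrite val_pt ?coords_neq0 // -val_coords. Qed.

Lemma coords_pt v : v != 0 -> exists2 c, c != 0 & coords (pt v) = c *: v.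
Proof.
move=> v0; have : coords (pt v) \in <[v]>%VS by rewrite -val_pt // memv_pick.
case/vlineP => c E; exists c => //; apply: contra (coords_neq0 (pt v)).
by move=> /eqP c0; rewrite E c0 scale0r.
Qed.

Lemma ptZ c v : c != 0 -> pt (c *: v) = pt v.
Proof.
move=> c0; have [->|v0] := eqVneq v 0; first by rewrite scaler0.
apply: val_inj; rewrite !val_pt ?scaler_eq0 ?negb_or ?c0 //.
apply/eqP; rewrite eqEsubv; apply/andP; split; rewrite -memvE.
  by rewrite memvZ ?memv_line.
by rewrite -[v in v \in _](scalerK c0) memvZ ?memv_line.
Qed.

Lemma pt_eqP v w : v != 0 -> w != 0 -> pt v = pt w -> exists2 c, c != 0 & v = c *: w.
Proof.
move=> v0 w0 E; have [c c0 Ec] := coords_pt v0; have [d d0 Ed] := coords_pt w0.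
exists (c^-1 * d); first by rewrite mulf_neq0 ?invr_eq0.
by rewrite -scalerA -Ed -E Ec scalerA mulVf // scale1r.
Qed.

Lemma rv_neq0P v : reflect (exists i, v 0 i != 0) (v != 0).
Proof.
apply: (iffP idP) => [v0|]; last by case=> i; apply: contraNneq => ->; rewrite mxE.
apply/existsP; apply: contraNT v0; rewrite negb_exists => /forallP h.
by apply/eqP/rowP => i; rewrite mxE; apply/eqP; have := h i; rewrite negbK.
Qed.

(** The minors in the hypothesis are forms, so equality of points can be carried from a dense subset
    to its closure. *)
Lemma pt_cross v w : v != 0 -> w != 0 ->
  (forall i j, v 0 i * w 0 j = v 0 j * w 0 i) -> pt v = pt w.
Proof.
move=> v0 w0 h; case/rv_neq0P: (w0) => i wi.
have E : v = (v 0 i / w 0 i) *: w.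
  by apply/rowP => j; rewrite mxE mulrAC h mulfK.
rewrite E ptZ //; apply: contraNneq v0 => c0.
by rewrite E c0 scale0r.
Qed.

Lemma mevZ d F c v : F \is d.-homog -> mev F (c *: v) = c ^+ d * mev F v.
Proof.
move=> /dhomogP hF; rewrite /mev !mevalE mulr_sumr big_seq [RHS]big_seq.
apply: eq_bigr => m /hF /= <-; rewrite mulrCA; congr (_ * _).
rewrite mdegE -prodrXr -big_split /=; apply: eq_bigr => i _.
by rewrite mxE exprMn.
Qed.

Lemma value_pt d F v : F \is d.-homog -> v != 0 ->
  exists2 c, c != 0 & value F (pt v) = c ^+ d * mev F v.
Proof.
by move=> hF /coords_pt [c c0 E]; exists c => //; rewrite /value -/(mev F _) E (mevZ _ _ hF).
Qed.

Lemma value_pt_eq0 F v : homogeneous F -> v != 0 ->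
  (value F (pt v) == 0) = (mev F v == 0).
Proof.
case=> d hF v0; have [c c0 ->] := value_pt hF v0.
by rewrite mulf_eq0 expf_eq0 (negPf c0) andbF.
Qed.

Lemma value_coords F x : value F x = mev F (coords x).
Proof. by []. Qed.

Definition dotp v w : K := \sum_i v 0 i * w 0 i.

Lemma dotpZl c v w : dotp (c *: v) w = c * dotp v w.
Proof. by rewrite /dotp mulr_sumr; apply: eq_bigr => i _; rewrite mxE mulrA. Qed.

Lemma dotpZr c v w : dotp v (c *: w) = c * dotp v w.
Proof. by rewrite /dotp mulr_sumr; apply: eq_bigr => i _; rewrite mxE mulrCA. Qed.

Lemma dotpDl v w u : dotp (v + w) u = dotp v u + dotp w u.
Proof. by rewrite /dotp -big_split; apply: eq_bigr => i _; rewrite mxE mulrDl. Qed.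

Lemma dotpC v w : dotp v w = dotp w v.
Proof. by apply: eq_bigr => i _; rewrite mulrC. Qed.

Lemma pairing_pt v w : v != 0 -> w != 0 ->
  (pairing (pt v) (pt w) == 0) = (dotp v w == 0).
Proof.
move=> /coords_pt [c c0 Ec] /coords_pt [d d0 Ed].
rewrite /pairing -/(dotp (coords (pt v)) (coords (pt w))) Ec Ed dotpZl dotpZr.
by rewrite !mulf_eq0 (negPf c0) (negPf d0).
Qed.

End ProjectivePoints.

(** * Polynomial functions over an infinite field *)

Section PolynomialFunctions.
Variables (K : numClosedFieldType).

Lemma poly_nonroot (q : {poly K}) : q != 0 -> exists t, q.[t] != 0.
Proof.
move=> q0; apply/not_existsP => h.
have /(max_poly_roots q0) : all (root q) [seq (i%:R : K) | i <- iota 0 (size q)].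
  by apply/allP => a _; rewrite /root; apply/negPn/negP/h.
rewrite map_inj_uniq ?iota_uniq ?size_map ?size_iota ?ltnn => [/(_ isT)//|].
by move=> i j /eqP; rewrite Num.Theory.eqr_nat => /eqP.
Qed.

Lemma poly_fun0 (q : {poly K}) : (forall t, q.[t] = 0) -> q = 0.
Proof.
by move=> h; apply/eqP/negPn/negP => /poly_nonroot [t]; rewrite h eqxx.
Qed.

Lemma poly_fun_inj (p q : {poly K}) (r : {poly K}) : r != 0 ->
  (forall t, r.[t] != 0 -> p.[t] = q.[t]) -> p = q.
Proof.
move=> r0 h; apply/eqP; rewrite -subr_eq0.
suff : r * (p - q) == 0 by rewrite mulf_eq0 (negPf r0).
apply/eqP/poly_fun0 => t; rewrite hornerM; have [->|/h e] := eqVneq r.[t] 0.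
  by rewrite mul0r.
by rewrite !hornerE e subrr mulr0.
Qed.

Lemma root_finite (q : {poly K}) : q != 0 -> finite_set [set a | q.[a] = 0].
Proof.
move=> q0; have [s Es] := closed_field_poly_normal q.
apply: (@sub_finite_set _ _ [set a | a \in s]); last exact: finite_seq.
move=> a /= /eqP; rewrite -/(root q a) Es rootZ ?lead_coef_eq0 //.
by rewrite root_prod_XsubC.
Qed.

Variable n : nat.
Implicit Types (phi psi : 'rV[K]_n -> K).

(** Only the existence of a polynomial is recorded: genericity conditions are assembled from sums,
    products and determinants and never need their polynomial in explicit form. *)
Definition polyfun phi := exists p : {mpoly K[n]}, forall v, phi v = p.@[fun i => v 0 i].

Lemma polyfun_const c : polyfun (fun _ => c).
Proof. by exists c%:MP => v; rewrite mevalC. Qed.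

Lemma polyfun_coord i : polyfun (fun v => v 0 i).
Proof. by exists 'X_i => v; rewrite mevalXU. Qed.

Lemma polyfunD phi psi : polyfun phi -> polyfun psi -> polyfun (fun v => phi v + psi v).
Proof. by move=> [p hp] [q hq]; exists (p + q) => v; rewrite hp hq mevalD. Qed.

Lemma polyfunM phi psi : polyfun phi -> polyfun psi -> polyfun (fun v => phi v * psi v).
Proof. by move=> [p hp] [q hq]; exists (p * q) => v; rewrite hp hq mevalM. Qed.

Lemma polyfunN phi : polyfun phi -> polyfun (fun v => - phi v).
Proof. by move=> [p hp]; exists (- p) => v; rewrite hp mevalN. Qed.

Lemma polyfun_ext phi psi : phi =1 psi -> polyfun phi -> polyfun psi.
Proof. by move=> e [p hp]; exists p => v; rewrite -e. Qed.

Lemma polyfun_sum (I : Type) (r : seq I) (P : pred I) (F : I -> 'rV[K]_n -> K) :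
  (forall i, P i -> polyfun (F i)) -> polyfun (fun v => \sum_(i <- r | P i) F i v).
Proof.
move=> h; elim: r => [|i r IH].
  by apply: polyfun_ext (polyfun_const 0) => v; rewrite big_nil.
have [Pi|nPi] := boolP (P i).
  by apply: polyfun_ext (polyfunD (h i Pi) IH) => v; rewrite big_cons Pi.
by apply: polyfun_ext IH => v; rewrite big_cons (negPf nPi).
Qed.

Lemma polyfun_prod (I : Type) (r : seq I) (P : pred I) (F : I -> 'rV[K]_n -> K) :
  (forall i, P i -> polyfun (F i)) -> polyfun (fun v => \prod_(i <- r | P i) F i v).
Proof.
move=> h; elim: r => [|i r IH].
  by apply: polyfun_ext (polyfun_const 1) => v; rewrite big_nil.
have [Pi|nPi] := boolP (P i).
  by apply: polyfun_ext (polyfunM (h i Pi) IH) => v; rewrite big_cons Pi.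
by apply: polyfun_ext IH => v; rewrite big_cons (negPf nPi).
Qed.

Lemma polyfun_det m (A : 'rV[K]_n -> 'M[K]_m) :
  (forall i j, polyfun (fun v => A v i j)) -> polyfun (fun v => \det (A v)).
Proof.
move=> h; apply: polyfun_sum => s _; apply: polyfunM; first exact: polyfun_const.
by apply: polyfun_prod => i _; apply: h.
Qed.

Lemma polyfun_line phi (u v : 'rV[K]_n) : polyfun phi ->
  exists q : {poly K}, forall t, phi (u + t *: v) = q.[t].
Proof.
move=> [p hp]; exists (mmap polyC (fun i => (u 0 i)%:P + v 0 i *: 'X) p) => t.
rewrite hp /meval /mmap horner_sum; apply: eq_bigr => m _.
rewrite hornerM hornerC; congr (_ * _); rewrite /mmap1 horner_prod.
by apply: eq_bigr => i _; rewrite horner_exp !mxE !hornerE mulrC.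
Qed.

(** On the line through u and v both functions are polynomials in t, one nonzero at t = 0 and the
    other at t = 1, so their product has a nonroot. *)
Lemma polyfun_mul_neq0 phi psi u v : polyfun phi -> polyfun psi ->
  phi u != 0 -> psi v != 0 ->
  exists t, phi (u + t *: (v - u)) != 0 /\ psi (u + t *: (v - u)) != 0.
Proof.
move=> /(@polyfun_line _ u (v - u)) [p hp] /(@polyfun_line _ u (v - u)) [q hq] hu hv.
have p0 : p != 0.
  apply: contraNneq hu => p0.
  by have := hp 0; rewrite scale0r addr0 p0 horner0 => ->.
have q0 : q != 0.
  apply: contraNneq hv => q0.
  by have := hq 1; rewrite scale1r addrC subrK q0 horner0 => ->.
have /poly_nonroot [t] : p * q != 0 by rewrite mulf_neq0.
rewrite hornerM mulf_eq0 negb_or -hp -hq => /andP[h1 h2].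
by exists t.
Qed.

Lemma polyfun_avoid (I : eqType) (s : seq I) (F : I -> 'rV[K]_n -> K) :
  (forall i, i \in s -> polyfun (F i)) -> (forall i, i \in s -> exists v, F i v != 0) ->
  exists v, forall i, i \in s -> F i v != 0.
Proof.
move=> hF h0; suff [v hv] : exists v, \prod_(i <- s) F i v != 0.
  exists v => i si; apply: contraNneq hv => e.
  by rewrite (big_rem i) //= e mul0r.
elim: s hF h0 => [|i s IH] hF h0.
  by exists 0; rewrite big_nil oner_neq0.
have [v hv] : exists v, \prod_(i <- s) F i v != 0.
  by apply: IH => j js; [apply: hF|apply: h0]; rewrite inE js orbT.
have [u hu] := h0 i (mem_head _ _).
have pi : polyfun (F i) by apply: hF; rewrite mem_head.
have ps : polyfun (fun v => \prod_(i <- s) F i v).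
  have : forall j, j \in s -> polyfun (F j) by move=> j js; apply: hF; rewrite inE js orbT.
  elim: (s) => [|j r IHr] hr.
    by apply: polyfun_ext (polyfun_const 1) => w; rewrite big_nil.
  apply: (polyfun_ext (phi := fun v => F j v * \prod_(k <- r) F k v)).
    by move=> w; rewrite big_cons.
  apply: polyfunM; first by apply: hr; rewrite mem_head.
  by apply: IHr => k kr; apply: hr; rewrite inE kr orbT.
have [t [h1 h2]] := polyfun_mul_neq0 pi ps hu hv.
by eexists; rewrite big_cons mulf_neq0 //; [exact: h1|exact: h2].
Qed.

End PolynomialFunctions.

(** * Zariski closed sets *)

Lemma properP T (A B : set T) : A `<` B <-> A <> B /\ A `<=` B.
Proof. by rewrite properEneq; split=> -[/eqP ? ?]; split=> //; apply/eqP. Qed.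

Section ZariskiTopology.
Variables (K : fieldType) (n : nat).
Implicit Types (A B V : set (projspace K n)) (F G : {mpoly K[n.+1]}).

Lemma homogeneousM F G : homogeneous F -> homogeneous G -> homogeneous (F * G).
Proof. by case=> d hF [e hG]; exists (d + e)%N; apply: dhomogM. Qed.

Lemma homogeneousX (i : 'I_n.+1) : ('X_i : {mpoly K[n.+1]}) \is 1.-homog.
Proof. by rewrite dhomogX; apply/eqP; rewrite /= mdeg1. Qed.

Lemma valueM F G (x : projspace K n) : value (F * G) x = value F x * value G x.
Proof. by rewrite /value mevalM. Qed.

Definition linform (v : 'rV[K]_n.+1) : {mpoly K[n.+1]} := \sum_i v 0 i *: 'X_i.

Lemma linform_homog v : linform v \is 1.-homog.
Proof. by apply: rpred_sum => i _; apply: rpredZ; apply: homogeneousX. Qed.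

Lemma mev_linform v w : mev (linform v) w = dotp v w.
Proof.
rewrite /mev /linform /dotp rmorph_sum /=; apply: eq_bigr => i _.
by rewrite mevalZ mevalXU.
Qed.

Lemma zclosed_form F : homogeneous F -> zclosed [set x : projspace K n | value F x = 0].
Proof.
move=> hF; exists [set F]; split; first by move=> G ->.
by apply/seteqP; split=> x /= h => [G ->//|]; exact: h.
Qed.

Lemma zclosureP A x : zclosure A x <->
  forall F, homogeneous F -> (forall a, A a -> value F a = 0) -> value F x = 0.
Proof.
split=> [h F hF FA|h V [[S [hS ->]] AV]].
  by apply: (h [set y | value F y = 0]); split; [apply: zclosed_form|].
by move=> F SF; apply: h; [exact: hS|move=> a /AV; apply].
Qed.

Lemma sub_zclosure A : A `<=` zclosure A.
Proof. by move=> x Ax V [_]; apply. Qed.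

Lemma zclosure_min A V : zclosed V -> A `<=` V -> zclosure A `<=` V.
Proof. by move=> cV AV x; apply; split. Qed.

Lemma zclosureS A B : A `<=` B -> zclosure A `<=` zclosure B.
Proof. by move=> AB x h V [cV BV]; apply: h; split=> //; apply: subset_trans BV. Qed.

Lemma zclosure_closed A : zclosed (zclosure A).
Proof.
exists [set F | homogeneous F /\ forall a, A a -> value F a = 0]; split.
  by move=> F [].
apply/seteqP; split=> x /=; first by move/zclosureP => h F [hF FA]; apply: h.
by move=> h; apply/zclosureP => F hF FA; apply: h.
Qed.

Lemma zclosedU A B : zclosed A -> zclosed B -> zclosed (A `|` B).
Proof.
move=> [S [hS ->]] [T [hT ->]].
exists [set FG | exists F G, [/\ S F, T G & FG = F * G]]; split.
  by move=> _ [F [G [SF TG ->]]]; apply: homogeneousM; [exact: hS|exact: hT].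
apply/seteqP; split=> x /=.
  case=> h _ [F [G [SF TG ->]]]; rewrite valueM.
    by rewrite (h F SF) mul0r.
  by rewrite (h G TG) mulr0.
move=> h; have [?|] := pselect (forall F, S F -> value F x = 0); first by left.
move=> /existsNP [F] /not_implyP [SF /eqP F0]; right=> G TG.
have /eqP : value (F * G) x = 0 by apply: h; exists F, G.
by rewrite valueM mulf_eq0 (negPf F0) => /eqP.
Qed.

Lemma zclosed1 (u : projspace K n) : zclosed [set u].
Proof.
pose L i j := coords u 0 j *: 'X_i - coords u 0 i *: ('X_j : {mpoly K[n.+1]}).
exists [set F | exists i j, F = L i j]; split.
  by move=> _ [i [j ->]]; exists 1%N; apply: rpredB; apply: rpredZ; apply: homogeneousX.
apply/seteqP; split=> x /=.
  move=> -> _ [i [j ->]]; rewrite /value mevalB !mevalZ !mevalXU.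
  by rewrite mulrC subrr.
move=> h; rewrite -(pt_coords x) -(pt_coords u); apply: pt_cross; rewrite ?coords_neq0 //.
move=> i j; have : value (L i j) x = 0 by apply: h; exists i, j.
by rewrite /value mevalB !mevalZ !mevalXU => /subr0_eq; rewrite mulrC => ->; rewrite mulrC.
Qed.

Lemma zclosed0 : zclosed (set0 : set (projspace K n)).
Proof.
exists [set 1]; split; first by move=> F ->; exists 0%N; apply: dhomog1.
apply/seteqP; split=> x //= /(_ 1 erefl) /eqP.
by rewrite /value meval1 oner_eq0.
Qed.

Lemma finite_zclosed A : finite_set A -> zclosed A.
Proof.
move/(@finite_seqP {U : {vspace 'rV[K]_n.+1} | \dim U == 1%N}) => [s ->].
elim: s => [|u s IH].
  by rewrite (_ : mkset _ = set0); [apply: zclosed0|apply/seteqP; split].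
rewrite (_ : mkset _ = [set u] `|` [set x | x \in s]).
  by apply: zclosedU => //; apply: zclosed1.
apply/seteqP; split=> x /=; rewrite inE; first by case/orP => [/eqP|]; [left|right].
by case=> [->|->]; rewrite ?eqxx ?orbT.
Qed.

(** Lets the finitely many points where a condition fails be split off before a closure is
    studied. *)
Lemma zclosureU_finite A E : finite_set E -> zclosure (A `|` E) `<=` zclosure A `|` E.
Proof.
move=> fE; apply: zclosure_min.
  by apply: zclosedU; [apply: zclosure_closed|apply: finite_zclosed].
by move=> x [Ax|]; [left; apply: sub_zclosure|right].
Qed.

Lemma irreducible_finite V : irreducible_closed V -> finite_set V -> exists u, V = [set u].
Proof.
move=> [_ [u Vu] irr] fV; exists u; apply/seteqP; split; last by move=> _ ->.
have cov : V `<=` [set u] `|` (V `\ u).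
  by move=> x Vx; have [->|xu] := pselect (x = u); [left|right; split].
have [//|h] := irr [set u] (V `\ u) (zclosed1 u) (finite_zclosed (finite_setD _ fV)) cov.
by have [_ []] := h u Vu.
Qed.

Lemma irreducible1 (u : projspace K n) : irreducible_closed [set u].
Proof.
split; [exact: zclosed1|by exists u|move=> A B _ _ h].
by have [Au|Bu] := h u erefl; [left|right] => _ ->.
Qed.

Lemma irreducible_forms V F G : irreducible_closed V -> homogeneous F -> homogeneous G ->
  (forall x, V x -> value F x * value G x = 0) ->
  (forall x, V x -> value F x = 0) \/ (forall x, V x -> value G x = 0).
Proof.
move=> [_ _ irr] hF hG h; apply: irr; try exact: zclosed_form.
by move=> x /h /eqP; rewrite mulf_eq0 => /orP[/eqP|/eqP]; [left|right].
Qed.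

(** A finite irreducible set is a single point and contains no smaller irreducible set, so the
    second term of a chain is infinite. *)
Lemma has_chain_infinite V d : has_chain V d.+1 -> infinite_set V.
Proof.
move=> [Z [irrZ ltZ]] fV.
have [irr0 Z0V] := irrZ 0%N (leq0n _); have [irr1 Z1V] := irrZ 1%N (ltn0Sn _).
have /irreducible_finite-/(_ (sub_finite_set Z1V fV)) [u E] := irr1.
have /properP [neq sub] := ltZ 0%N (ltn0Sn _).
case: irr0 => _ [z Zz] _; apply: neq; apply/seteqP; split=> // x; rewrite E => ->.
by have := sub z Zz; rewrite E => <-.
Qed.

Lemma curve_infinite V : irreducible_curve V -> infinite_set V.
Proof. by move=> [_ []] /has_chain_infinite. Qed.

(** The last hypothesis makes proper closed subsets finite. An infinite set is not a union of two
    finite ones, whence irreducibility; the middle term of a chain of length two would be finite,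
    hence a point, with nothing below it. *)
Lemma irreducible_curveI V : zclosed V -> infinite_set V ->
  (forall F, homogeneous F -> (forall x, V x -> value F x = 0) \/
     finite_set [set x | V x /\ value F x = 0]) ->
  irreducible_curve V.
Proof.
move=> cV iV cof.
have closed_cof A : zclosed A -> V `<=` A \/ finite_set (V `&` A).
  move=> [S [hS ->]]; have [?|/existsNP [x /not_implyP [Vx]]] :=
    pselect (V `<=` [set x | forall F, S F -> value F x = 0]); first by left.
  move=> /existsNP [F /not_implyP [SF Fx]]; right.
  have [/(_ x Vx)//|] := cof F (hS _ SF); apply: sub_finite_set => y [Vy h].
  by split=> //; apply: h.
have V0 : V !=set0 by apply: infinite_setN0.
have irrV : irreducible_closed V.
  split=> // A B /closed_cof cA /closed_cof cB VAB.
  have [|fA] := cA; first by left.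
  have [|fB] := cB; first by right.
  case: iV; apply: (@sub_finite_set _ _ ((V `&` A) `|` (V `&` B))).
    by move=> x Vx; have [] := VAB x Vx; [left|right].
  by rewrite finite_setU.
split=> //; split.
  have [u Vu] := V0; exists (fun i => if i is 0%N then [set u] else V); split.
    case=> [|i] _; last by split.
    by split=> [|_ ->//]; apply: irreducible1.
  case=> // _; apply/properP; split; last by move=> _ ->.
  by move=> E; apply: iV; rewrite -E; apply: finite_set1.
move=> [Z [irrZ ltZ]].
have [irr0 Z0V] := irrZ 0%N (leq0n _); have [irr1 Z1V] := irrZ 1%N isT.
have [irr2 Z2V] := irrZ 2%N isT.
have /properP [ne12 s12] := ltZ 1%N isT.
have /properP [ne01 s01] := ltZ 0%N isT.
have f1 : finite_set (Z 1%N).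
  have [|] := closed_cof _ (let: And3 c _ _ := irr1 in c).
    by move=> V1; case: ne12; apply/seteqP; split=> // x /Z2V /V1.
  by apply: sub_finite_set => x h; split=> //; apply: Z1V.
have [u E] := irreducible_finite irr1 f1.
case: irr0 => _ [z Zz] _; apply: ne01; apply/seteqP; split=> // x; rewrite E => ->.
by have := s01 z Zz; rewrite E => <-.
Qed.

Lemma hyperplane_inj (h k : projspace K n) : hyperplane h = hyperplane k -> h = k.
Proof.
move=> E; rewrite -(pt_coords h) -(pt_coords k); apply: pt_cross; rewrite ?coords_neq0 // => i j.
have [->//|ij] := eqVneq i j.
(* A vector of the hyperplane h supported in the coordinates i and j; its pairing with k is a minor
   of h and k. *)
pose u : 'rV[K]_n.+1 := coords h 0 i *: delta_mx 0 j - coords h 0 j *: delta_mx 0 i.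
have dotu v : dotp v u = coords h 0 i * v 0 j - coords h 0 j * v 0 i.
  have dd (l : 'I_n.+1) : \sum_k v 0 k * (delta_mx 0 l : 'rV[K]_n.+1) 0 k = v 0 l.
    rewrite (bigD1 l) //= mxE !eqxx mulr1 big1 ?addr0 // => k' kl.
    by rewrite mxE (negPf kl) andbF mulr0.
  rewrite /dotp /u -[in RHS](dd i) -[in RHS](dd j) !mulr_sumr -sumrB.
  by apply: eq_bigr => k' _; rewrite !mxE; ring.
have [u0|u0] := eqVneq u 0.
  have ui := dotu (coords k); rewrite u0 in ui.
  have {}ui : 0 = coords h 0 i * coords k 0 j - coords h 0 j * coords k 0 i.
    by rewrite -ui /dotp big1 // => l _; rewrite mxE mulr0.
  by apply/subr0_eq.
have : hyperplane h (pt u).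
  by apply/eqP; rewrite -(pt_coords h) pairing_pt ?coords_neq0 // dotu; apply/eqP; ring.
rewrite E => /eqP; rewrite -{1}(pt_coords k) pairing_pt ?coords_neq0 // dotu => /eqP.
by move/subr0_eq.
Qed.

End ZariskiTopology.

(** * Nonempty open sets and the degree *)

Section ZariskiDense.
Variables (K : numClosedFieldType) (n : nat).
Implicit Types (A B U V : set (projspace K n)).

Lemma polyfun_mev (F : {mpoly K[n.+1]}) : polyfun (mev F).
Proof. by exists F. Qed.

Lemma zopen_nonzero U : zopen U -> U !=set0 ->
  exists2 F : {mpoly K[n.+1]}, homogeneous F &
    (exists v, mev F v != 0) /\ forall v : 'rV[K]_n.+1, v != 0 -> mev F v != 0 -> U (pt v).
Proof.
move=> [S [hS E]] [u Uu].
have /existsNP [F /not_implyP [SF /eqP Fu]] : ~ [set x | forall F, S F -> value F x = 0] u.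
  by rewrite -E => /(_ Uu).
exists F; first exact: hS.
split; first by exists (coords u).
move=> v v0 Fv; apply: contrapT => nU.
have : (~` U) (pt v) by [].
by rewrite E => /(_ F SF) /eqP; rewrite value_pt_eq0 ?(negPf Fv) //; apply: hS.
Qed.

Lemma zopen_meet U V : zopen U -> U !=set0 -> zopen V -> V !=set0 -> (U `&` V) !=set0.
Proof.
move=> /zopen_nonzero oU /oU [F hF [[u Fu] hU]] /zopen_nonzero oV /oV [G hG [[v Gv] hV]].
(* The coordinate function makes the common point w a nonzero vector. *)
pose L := [:: mev F; mev G; fun w : 'rV[K]_n.+1 => w 0 0].
have [w hw] : exists w, forall i, i \in iota 0 3 -> nth (fun=> 0) L i w != 0.
  apply: polyfun_avoid => i; rewrite mem_iota.
    by case: i => [|[|[|//]]] _ /=; try exact: polyfun_mev; apply: polyfun_coord.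
  case: i => [|[|[|//]]] _ /=; [by exists u|by exists v|].
  by exists (const_mx 1); rewrite mxE oner_neq0.
have w0 : w != 0 by apply/rv_neq0P; exists 0; apply: (hw 2%N).
by exists (pt w); split; [apply: hU => //; apply: (hw 0%N)|apply: hV => //; apply: (hw 1%N)].
Qed.

(** Justifies [xget]: two nonempty open sets of hyperplanes meet, so the number of points is
    unique. *)
Lemma degree_eq V d U : zopen U -> U !=set0 ->
  (forall h, U h -> (V `&` hyperplane h #= `I_d)%card) -> degree V = d.
Proof.
move=> oU nU hU; apply: xget_unique; first by exists U.
move=> e [W [oW nW hW]].
have [h [Uh Wh]] := zopen_meet oU nU oW nW.
apply/esym/card_eq_II; apply: card_eq_trans (hW _ Wh).
by rewrite card_eq_sym; apply: hU.
Qed.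

(** [D] need not be homogeneous, so its nonvanishing is not a condition on points. The open set is
    where some homogeneous component is nonzero; there D is nonzero at some multiple of the
    coordinates. *)
Lemma zopen_polyfun (D : 'rV[K]_n.+1 -> K) v : polyfun D -> D v != 0 ->
  exists U, [/\ zopen U, U !=set0 &
    forall h, U h -> exists c, D (c *: coords h) != 0 /\ c != 0].
Proof.
move=> [p hp] Dv; pose N := msize p.
have pE w : D w = \sum_(k < N) mev (pihomog mdeg k p) w.
  by rewrite hp {1}(pihomog_partitionE (leqnn N)) /mev rmorph_sum.
have hom k : homogeneous (pihomog mdeg k p) by exists k; apply: pihomogP.
pose S := [set F | exists k, F = pihomog mdeg k p].
have cS : zclosed [set x : projspace K n | forall F, S F -> value F x = 0].
  by exists S; split=> // _ [k ->].
exists (~` [set x | forall F, S F -> value F x = 0]); split.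
- by rewrite /zopen setCK.
- have [t [/= h1 h2]] : exists t, D (v + t *: (const_mx 1 - v)) != 0 /\
       (v + t *: (const_mx 1 - v)) 0 0 != 0.
    apply: (@polyfun_mul_neq0 K _ D (fun v => v 0 0)) => //.
    + by exists p.
    + exact: polyfun_coord.
    + by rewrite mxE oner_neq0.
  set w := v + _ in h1 h2.
  have w0 : w != 0 by apply/rv_neq0P; exists 0.
  exists (pt w) => h; move: h1; rewrite pE big1 ?eqxx // => k _; apply/eqP.
  by rewrite -value_pt_eq0 //; apply/eqP/h; exists k.
move=> h /existsNP [F /not_implyP [[k ->] /eqP hk]].
(* Q(c) is the value of [D] at c times the coordinates of h. *)
pose Q := \poly_(i < N) mev (pihomog mdeg i p) (coords h).
have kN : (k < N)%N.
  rewrite ltnNge; apply: contra hk => Nk; rewrite /value (_ : pihomog _ _ _ = 0) ?meval0 //.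
  rewrite pihomogE big_seq_cond big1 // => m /andP[mp /eqP mk].
  have : (mdeg m < N)%N by apply: msize_mdeg_lt.
  by rewrite mk ltnNge Nk.
(* The factor ['X] keeps the scaling c away from 0. *)
have Q0 : 'X * Q != 0.
  rewrite mulf_neq0 ?polyX_eq0 //; apply: contraNneq hk => Q0.
  by have := coef_poly N (fun i => mev (pihomog mdeg i p) (coords h)) k; rewrite -/Q Q0 coef0 kN value_coords => e; rewrite -e.
have [c] := poly_nonroot Q0; rewrite hornerM hornerX mulf_eq0 negb_or => /andP[c0 Qc].
exists c; split=> //; move: Qc; rewrite horner_poly pE.
rewrite (eq_bigr (fun k : 'I_N => mev (pihomog mdeg k p) (c *: coords h))) // => i _.
by rewrite (mevZ _ _ (pihomogP _ _ _)) mulrC.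
Qed.

End ZariskiDense.

Section ProjectivePlane.
Variable K : numClosedFieldType.

(* A point, a line and the plane form a chain of length two. *)
Lemma plane_not_curve (X : set (projspace K 2)) : irreducible_curve X -> X <> setT.
Proof.
move=> [_ [_]] + XT; apply; rewrite XT.
pose Z i := [set x : projspace K 2 | forall j : 'I_3, (i < j)%N -> coords x 0 j = 0].
have ZP i v : v != 0 -> Z i (pt v) <-> forall j : 'I_3, (i < j)%N -> v 0 j = 0.
  move=> /coords_pt [c c0 E]; split=> h j /h; rewrite E mxE; last by move=> ->; rewrite mulr0.
  by move/eqP; rewrite mulf_eq0 (negPf c0) => /eqP.
exists Z; split=> i; last first.
  move=> i2; apply/properP; split; last by move=> x h j ij; apply: h; apply: ltnW.
  have d0 : (delta_mx 0 (inord i.+1) : 'rV[K]_3) != 0.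
    by apply/rv_neq0P; exists (inord i.+1); rewrite mxE !eqxx oner_neq0.
  move=> /seteqP [_ /(_ (pt (delta_mx 0 (inord i.+1))))]; rewrite !ZP //.
  move=> h; have /h/(_ (inord i.+1)) : forall j : 'I_3, (i.+1 < j)%N -> (delta_mx 0 (inord i.+1) : 'rV[K]_3) 0 j = 0.
    move=> j ij; rewrite mxE andTb; case: eqP => // e; move: ij; rewrite e inordK ?ltnn //.
  by rewrite inordK // ltnSn mxE !eqxx => /(_ isT) /eqP; rewrite oner_eq0.
move=> i2; split=> //; split.
- exists [set F | exists2 j : 'I_3, (i < j)%N & F = 'X_j]; split.
    by move=> _ [j _ ->]; exists 1%N; apply: homogeneousX.
  apply/seteqP; split=> x h.
    by move=> _ [j ij ->]; rewrite /value mevalXU; apply: h.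
  by move=> j ij; have := h 'X_j; rewrite /value mevalXU; apply; exists j.
- exists (pt (delta_mx 0 0)); apply/ZP.
    by apply/rv_neq0P; exists 0; rewrite mxE !eqxx oner_neq0.
  by move=> j ij; rewrite mxE andTb; case: eqP => // e; rewrite e in ij.
(* Irreducibility of a linear subspace: on the line joining u and v, the forms F and G are both
   nonzero at some w, which still lies in the subspace. *)
move=> _ _ [S [hS ->]] [T [hT ->]] sub; apply: contrapT => /not_orP [].
move=> /existsNP [u /not_implyP [Zu /existsNP [F /not_implyP [SF /eqP Fu]]]].
move=> /existsNP [v /not_implyP [Zv /existsNP [G /not_implyP [TG /eqP Gv]]]].
have [t [h1 h2]] := polyfun_mul_neq0 (polyfun_mev F) (polyfun_mev G) Fu Gv.
set w := _ + _ in h1 h2.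
(* A form that is nonzero at the zero vector is constant; for [G] this contradicts its zero at u. *)
have [w0|w0] := eqVneq w 0.
  have wF c : mev F (c *: w) != 0 by rewrite w0 scaler0 -w0.
  have hF0 : mev F (coords u) * mev G (coords u) = 0 by case: (sub u Zu) => /(_ _ _) h;
    [rewrite [mev F _](h F SF) mul0r|rewrite [mev G _](h G TG) mulr0].
  have hG0 : mev G (coords u) = 0.
    by move/eqP: hF0; rewrite mulf_eq0 (negPf Fu) => /eqP.
  have [d hd] := hT _ TG.
  have := mevZ 0 w hd; rewrite scale0r -w0; case: d hd => [|d] hd; last first.
    by rewrite exprS !mul0r => /eqP; rewrite (negPf h2).
  have := mevZ 0 (coords u) hd; rewrite expr0 mul1r scale0r hG0 -w0 => /eqP.
  by rewrite (negPf h2).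
have Zw : Z i (pt w).
  apply/ZP => // j ij; rewrite !mxE (Zu j ij) (Zv j ij); ring.
have [/(_ F SF)|/(_ G TG)] := sub _ Zw => /eqP; rewrite value_pt_eq0 ?(negPf h1) ?(negPf h2) //.
- exact: hS.
- exact: hT.
Qed.

End ProjectivePlane.

(** * Bivariate polynomials *)

Section Bivariate.
Variable K : numClosedFieldType.
Local Notation BB := {poly {poly K}}.
Implicit Types (A B f : BB) (a b : K).

(* The outer variable of [{poly {poly K}}] plays the role of y, the inner one of x. *)
Definition ev2 A a b : K := A.[b%:P].[a].
Definition xx : BB := 'X%:P.
Definition yy : BB := 'X.
Definition cc (c : K) : BB := c%:P%:P.

Lemma ev2_0 a b : ev2 0 a b = 0. Proof. by rewrite /ev2 !horner0. Qed.
Lemma ev2_1 a b : ev2 1 a b = 1. Proof. by rewrite /ev2 !hornerC. Qed.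
Lemma ev2D A B a b : ev2 (A + B) a b = ev2 A a b + ev2 B a b.
Proof. by rewrite /ev2 !hornerD. Qed.
Lemma ev2N A a b : ev2 (- A) a b = - ev2 A a b.
Proof. by rewrite /ev2 !hornerN. Qed.
Lemma ev2B A B a b : ev2 (A - B) a b = ev2 A a b - ev2 B a b.
Proof. by rewrite ev2D ev2N. Qed.
Lemma ev2M A B a b : ev2 (A * B) a b = ev2 A a b * ev2 B a b.
Proof. by rewrite /ev2 !hornerM. Qed.
Lemma ev2_exp A k a b : ev2 (A ^+ k) a b = ev2 A a b ^+ k.
Proof. by rewrite /ev2 !horner_exp. Qed.
Lemma ev2x a b : ev2 xx a b = a. Proof. by rewrite /ev2 hornerC hornerX. Qed.
Lemma ev2y a b : ev2 yy a b = b. Proof. by rewrite /ev2 hornerX hornerC. Qed.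
Lemma ev2c c a b : ev2 (cc c) a b = c. Proof. by rewrite /ev2 !hornerC. Qed.
Lemma ev2C (r : {poly K}) a b : ev2 r%:P a b = r.[a]. Proof. by rewrite /ev2 hornerC. Qed.
Lemma ev2_sum I (s : seq I) (P : pred I) (F : I -> BB) a b :
  ev2 (\sum_(i <- s | P i) F i) a b = \sum_(i <- s | P i) ev2 (F i) a b.
Proof. by rewrite /ev2 !horner_sum. Qed.
Lemma ev2_prod I (s : seq I) (P : pred I) (F : I -> BB) a b :
  ev2 (\prod_(i <- s | P i) F i) a b = \prod_(i <- s | P i) ev2 (F i) a b.
Proof. by rewrite /ev2 !horner_prod. Qed.
Definition ev2E := (ev2D, ev2B, ev2N, ev2M, ev2_exp, ev2_0, ev2_1, ev2x, ev2y, ev2c).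

Definition fiber A a : {poly K} := map_poly (horner_eval a) A.

Lemma fiberE A a b : (fiber A a).[b] = ev2 A a b.
Proof. by have := horner_map (horner_eval a) A b%:P; rewrite /= /horner_eval hornerC. Qed.

Lemma coef_fiber A a i : (fiber A a)`_i = (A`_i).[a].
Proof. by rewrite coef_map. Qed.

Definition dx A : BB := map_poly deriv A.
Definition dy A : BB := A^`().

Lemma coef_dx A i : (dx A)`_i = (A`_i)^`().
Proof. by rewrite coef_map_id0 ?deriv0. Qed.

Lemma dxD A B : dx (A + B) = dx A + dx B.
Proof. by apply/polyP => i; rewrite coefD !coef_dx coefD derivD. Qed.

Lemma dxM A B : dx (A * B) = dx A * B + A * dx B.
Proof.
apply/polyP => i; rewrite coefD coef_dx !coefM linear_sum -big_split /=.
by apply: eq_bigr => j _; rewrite derivM !coef_dx.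
Qed.

Lemma dxC (r : {poly K}) : dx r%:P = r^`()%:P.
Proof. by apply/polyP => i; rewrite coef_dx !coefC; case: eqP; rewrite ?deriv0. Qed.

Lemma dxy : dx yy = 0.
Proof. by apply/polyP => i; rewrite coef_dx coefX coef0; case: eqP => _; rewrite -polyC1 ?derivC // deriv0. Qed.

Lemma dyC (r : {poly K}) : dy r%:P = 0.
Proof. exact: derivC. Qed.

(* locked so that rewriting does not unfold iterated derivatives *)
Definition delta f A : BB := locked (dy f * dx A - dx f * dy A).

Lemma delta_def f A : delta f A = dy f * dx A - dx f * dy A.
Proof. by rewrite /delta -lock. Qed.

Lemma deltaD f A B : delta f (A + B) = delta f A + delta f B.
Proof. by rewrite !delta_def dxD /dy derivD; ring. Qed.

Lemma deltaM f A B : delta f (A * B) = delta f A * B + A * delta f B.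
Proof. by rewrite !delta_def dxM /dy derivM; ring. Qed.

Lemma delta_c f c : delta f (cc c) = 0.
Proof. by rewrite !delta_def /cc dxC /dy !derivC; ring. Qed.

Lemma deltaC f (r : {poly K}) : delta f r%:P = dy f * r^`()%:P.
Proof. by rewrite !delta_def dxC dyC; ring. Qed.

Lemma delta_x f : delta f xx = dy f.
Proof. by rewrite /xx deltaC derivX mulr1. Qed.

Lemma delta_y f : delta f yy = - dx f.
Proof. by rewrite !delta_def dxy /dy derivX; ring. Qed.

(** So the derivation f_y d/dx - f_x d/dy acts on functions on the curve, where it is f_y times
    d/dx; unlike d/dx along the curve, it keeps polynomials polynomial. *)
Lemma delta_id f : delta f f = 0.
Proof. by rewrite delta_def; ring. Qed.

Lemma delta0 f : delta f 0 = 0.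
Proof. by rewrite -(polyC0 {poly K}) -polyC0 -/(cc 0) delta_c. Qed.

Lemma deltaN f A : delta f (- A) = - delta f A.
Proof. by apply/eqP; rewrite -addr_eq0 -deltaD addNr delta0. Qed.

Lemma deltaB f A B : delta f (A - B) = delta f A - delta f B.
Proof. by rewrite deltaD deltaN. Qed.

Definition deltaE := (deltaD, deltaB, deltaN, deltaM, delta_c, delta_x, delta_y).

Definition tdeg (N : nat) A := forall i j, A`_j`_i != 0 -> (i + j <= N)%N.

Lemma tdeg_leq M N A : (M <= N)%N -> tdeg M A -> tdeg N A.
Proof. by move=> MN h i j /h /leq_trans; apply. Qed.

Lemma tdegD N A B : tdeg N A -> tdeg N B -> tdeg N (A + B).
Proof.
move=> hA hB i j; have [e|/hA//] := eqVneq A`_j`_i 0.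
by rewrite !coefD e add0r => /hB.
Qed.

Lemma tdeg0 N : tdeg N 0.
Proof. by move=> i j; rewrite !coef0 eqxx. Qed.

Lemma tdeg_sum N I (s : seq I) (P : pred I) (F : I -> BB) :
  (forall i, P i -> tdeg N (F i)) -> tdeg N (\sum_(i <- s | P i) F i).
Proof. by move=> h; apply: big_rec => [|i A Pi hA]; [apply: tdeg0|apply: tdegD; [apply: h|]]. Qed.

Lemma tdegM M N A B : tdeg M A -> tdeg N B -> tdeg (M + N) (A * B).
Proof.
move=> hA hB i j; rewrite coefM coef_sum.
case: (boolP [exists k : 'I_j.+1, (A`_k * B`_(j - k))`_i != 0]); last first.
  rewrite negb_exists => /forallP h; rewrite big1 ?eqxx // => k _.
  by apply/eqP; have := h k; rewrite negbK.
move=> /existsP [k]; rewrite coefM.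
case: (boolP [exists l : 'I_i.+1, A`_k`_l * B`_(j - k)`_(i - l) != 0]); last first.
  rewrite negb_exists => /forallP h; rewrite big1 ?eqxx // => l _.
  by apply/eqP; have := h l; rewrite negbK.
move=> /existsP [l]; rewrite mulf_eq0 negb_or => /andP[/hA h1 /hB h2] _ _.
have := leq_add h1 h2; have hk := ltn_ord k; have hl := ltn_ord l.
lia.
Qed.

Lemma tdeg_c c : tdeg 0 (cc c).
Proof. by move=> i j; rewrite coefC; case: j => [|j]; rewrite ?coef0 ?eqxx // coefC; case: i => [|i] //; rewrite eqxx. Qed.

Lemma tdeg_x : tdeg 1 xx.
Proof.
by move=> i j; rewrite coefC; case: j => [|j]; rewrite ?coef0 ?eqxx // coefX; case: i => [|[|i]]; rewrite ?eqxx.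
Qed.

Lemma tdeg_y : tdeg 1 yy.
Proof.
by move=> i j; rewrite coefX; case: j => [|[|j]]; rewrite ?coef0 ?eqxx // coefC; case: i => [|i]; rewrite ?eqxx.
Qed.

Lemma tdeg1 : tdeg 0 1.
Proof. by have := @tdeg_c 1; rewrite /cc !polyC1. Qed.

Lemma tdeg_prod I (s : seq I) (F : I -> BB) (N : I -> nat) :
  (forall i, tdeg (N i) (F i)) -> tdeg (\sum_(i <- s) N i) (\prod_(i <- s) F i).
Proof.
move=> h; elim: s => [|i s IH]; first by rewrite !big_nil; apply: tdeg1.
by rewrite !big_cons; apply: tdegM.
Qed.

Lemma tdeg_exp N k A : tdeg N A -> tdeg (N * k) (A ^+ k).
Proof.
move=> h; elim: k => [|k IH]; first by rewrite muln0; apply: tdeg1.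
by rewrite exprS mulnS; apply: tdegM.
Qed.

Lemma tdeg_dx N A : tdeg N A -> tdeg N.-1 (dx A).
Proof.
move=> h i j; rewrite coef_dx coef_deriv => h0.
have /h : A`_j`_i.+1 != 0 by apply: contraNneq h0 => ->; rewrite mul0rn.
by rewrite addSn; case: (N).
Qed.

Lemma tdeg_dy N A : tdeg N A -> tdeg N.-1 (dy A).
Proof.
move=> h i j; rewrite coef_deriv coefMn => h0.
have /h : A`_j.+1`_i != 0 by apply: contraNneq h0 => ->; rewrite mul0rn.
by rewrite addnS; case: (N).
Qed.

Lemma tdeg_ex A : exists N, tdeg N A.
Proof.
elim/poly_ind: A => [|A c [N hN]]; first by exists 0%N; apply: tdeg0.
exists (N + 1 + size c)%N; apply: tdegD.
  by apply: (@tdeg_leq (N + 1)); [apply: leq_addr|apply: tdegM (tdeg_y)].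
move=> i j; rewrite coefC; case: j => [|j]; rewrite ?coef0 ?eqxx // addn0 => h.
apply: leq_trans (leq_addl _ _); rewrite leqNgt; apply: contra h => /ltnW si.
by rewrite nth_default.
Qed.

Lemma tdeg_size N A : tdeg N A -> (size A <= N.+1)%N.
Proof.
move=> h; apply/leq_sizeP => j Nj; apply/eqP; apply: contraT => Aj.
have /h : A`_j`_(size A`_j).-1 != 0 by rewrite -lead_coefE lead_coef_eq0.
by move=> /(leq_trans (leq_addl _ _)); rewrite leqNgt Nj.
Qed.

Lemma ev2_expand N A a b : tdeg N A ->
  ev2 A a b = \sum_(j < N.+1) \sum_(i < N.+1) A`_j`_i * a ^+ i * b ^+ j.
Proof.
move=> h; rewrite /ev2 (horner_coef_wide _ (tdeg_size h)) horner_sum.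
apply: eq_bigr => j _; rewrite hornerM horner_exp hornerC.
rewrite (@horner_coef_wide _ N.+1) ?mulr_suml //.
apply/leq_sizeP => i Ni; apply/eqP; apply: contraT => /h.
by move=> /(leq_trans (leq_addr _ _)); rewrite leqNgt Ni.
Qed.

(** * Homogenization of bivariate polynomials *)

Section Homogenization.
Variables (m : nat) (l0 l1 l2 : {mpoly K[m]}).

(* N-homogenization of A, with l1/l0 and l2/l0 substituted for x and y *)
Definition hom (N : nat) A : {mpoly K[m]} :=
  \sum_(j < N.+1) \sum_(i < N.+1 | (i + j <= N)%N)
    A`_j`_i *: (l0 ^+ (N - i - j) * l1 ^+ i * l2 ^+ j).

Lemma hom_homog k N A : l0 \is k.-homog -> l1 \is k.-homog -> l2 \is k.-homog ->
  hom N A \is (k * N).-homog.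
Proof.
move=> h0 h1 h2; apply: rpred_sum => j _; apply: rpred_sum => i ij; apply: rpredZ.
have -> : (k * N = k * (N - i - j) + k * i + k * j)%N.
  by rewrite -!mulnDr -subnDA -addnA subnK.
by apply: dhomogM; [apply: dhomogM|]; apply: dhomogMn.
Qed.

(** Unlike the quotient formula, this sum also covers the points with l0 = 0, where only the terms
    of total degree N survive. *)
Lemma meval_hom_sum N A v : (hom N A).@[v] = \sum_(j < N.+1) \sum_(i < N.+1 | (i + j <= N)%N)
    A`_j`_i * (l0.@[v] ^+ (N - i - j) * l1.@[v] ^+ i * l2.@[v] ^+ j).
Proof.
rewrite rmorph_sum /=; apply: eq_bigr => j _; rewrite rmorph_sum /=.
by apply: eq_bigr => i _; rewrite mevalZ !mevalM !rmorphXn.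
Qed.

Lemma meval_hom N A v : tdeg N A -> l0.@[v] != 0 ->
  (hom N A).@[v] = l0.@[v] ^+ N * ev2 A (l1.@[v] / l0.@[v]) (l2.@[v] / l0.@[v]).
Proof.
move=> h v0; rewrite meval_hom_sum (ev2_expand _ _ h) mulr_sumr; apply: eq_bigr => j _.
rewrite mulr_sumr [RHS](bigID (fun i : 'I_N.+1 => (i + j <= N)%N)) /=.
rewrite [X in _ + X]big1 ?addr0 => [|i]; last first.
  by move=> nij; have [->|/h ij] := eqVneq A`_j`_i 0; [rewrite !mul0r mulr0|rewrite ij in nij].
apply: eq_bigr => i ij; rewrite !expr_div_n.
have -> : l0.@[v] ^+ N = l0.@[v] ^+ (N - i - j) * l0.@[v] ^+ i * l0.@[v] ^+ j.
  by rewrite -!exprD -subnDA -addnA subnK.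
by field; rewrite !expf_neq0.
Qed.

End Homogenization.

(** * Substitution of bivariate polynomials into forms *)

Section Substitution.
Variables (m : nat) (g : 'I_m -> BB).

Definition sub2 (F : {mpoly K[m]}) : BB := mmap (polyC \o polyC) g F.

Lemma sub2D F G : sub2 (F + G) = sub2 F + sub2 G. Proof. exact: mmapD. Qed.
Lemma sub2M F G : sub2 (F * G) = sub2 F * sub2 G. Proof. exact: rmorphM. Qed.
Lemma sub2Z c F : sub2 (c *: F) = cc c * sub2 F. Proof. exact: mmapZ. Qed.
Lemma sub2X i : sub2 'X_i = g i. Proof. by rewrite /sub2 mmapX mmap1U. Qed.
Lemma sub2_0 : sub2 0 = 0. Proof. exact: mmap0. Qed.
Lemma sub2_1 : sub2 1 = 1. Proof. exact: rmorph1. Qed.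

Lemma ev2_sub2 F a b : ev2 (sub2 F) a b = F.@[fun i => ev2 (g i) a b].
Proof.
rewrite /sub2 /meval /mmap ev2_sum; apply: eq_bigr => mm _.
rewrite ev2M ev2c; congr (_ * _); rewrite /mmap1 ev2_prod.
by apply: eq_bigr => i _; rewrite ev2_exp.
Qed.

Lemma mpoly_induction (P : {mpoly K[m]} -> Prop) :
  P 1 -> (forall i F, P F -> P ('X_i * F)) -> (forall F G, P F -> P G -> P (F + G)) ->
  (forall c F, P F -> P (c *: F)) -> forall F, P F.
Proof.
move=> h1 hX hD hZ F; elim/mpolyind: F => [|c mm F _ _ hF].
  by rewrite -(scale0r 1); apply: hZ.
apply: hD => //; apply: hZ; rewrite mpolyXE_id; elim: (index_enum _) => [|i s IH].
  by rewrite big_nil.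
rewrite big_cons; elim: (mm i) => [|k IHk]; first by rewrite expr0 mul1r.
by rewrite exprS -mulrA; apply: hX.
Qed.

(** Stated for any derivation trivial on constants: it is applied to the derivatives in x and in y
    and to [delta f]. *)
Lemma chain_rule (D : BB -> BB) : {morph D : A B / A + B} ->
  (forall A B, D (A * B) = D A * B + A * D B) -> (forall c, D (cc c) = 0) ->
  forall F, D (sub2 F) = \sum_i sub2 (mderiv i F) * D (g i).
Proof.
move=> hD hM hC; apply: mpoly_induction => [|i F IH|F G IF IG|c F IF].
- rewrite sub2_1 (hC 1) big1 // => i _.
  by rewrite (_ : mderiv i 1 = 0) ?sub2_0 ?mul0r // -mpolyC1 mderivC.
- rewrite sub2M hM sub2X IH [g i * _]mulr_sumr.
  rewrite [RHS](eq_bigr (fun j => (j == i)%:R * (sub2 F * D (g j)) + g i * (sub2 (mderiv j F) * D (g j)))).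
    rewrite big_split /= [X in _ = X + _](bigD1 i) //= eqxx mul1r [X in _ + X + _]big1.
      by rewrite addr0 mulrC.
    by move=> j /negPf ->; rewrite mul0r.
  move=> j _; rewrite mderivM sub2D !sub2M sub2X mderivX mnm1E eq_sym.
  case: eqP => [->|_]; last by rewrite scale0r sub2_0 /= mulr0n; ring.
  by rewrite scale1r (_ : 'X_[_] = 1) ?sub2_1 /= ?mulr1n; [ring|rewrite -mpolyX0; congr 'X_[_]; apply/mnmP => k; rewrite mnmBE subnn mnm0E].
- rewrite sub2D hD IF IG -big_split; apply: eq_bigr => i _.
  by rewrite mderivD sub2D mulrDl.
- rewrite sub2Z hM hC mul0r add0r IF mulr_sumr; apply: eq_bigr => i _.
  by rewrite mderivZ sub2Z mulrA.
Qed.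

Lemma tdeg_sub2 N d (F : {mpoly K[m]}) : F \is d.-homog -> (forall i, tdeg N (g i)) ->
  tdeg (N * d) (sub2 F).
Proof.
move=> /dhomogP hF hg; rewrite /sub2 /mmap big_seq_cond.
apply: tdeg_sum => mm /andP[/hF <- _]; rewrite -[(N * _)%N]add0n; apply: tdegM.
  exact: tdeg_c.
rewrite /= mdegE big_distrr /=; apply: tdeg_prod => i; exact: tdeg_exp.
Qed.

End Substitution.

Definition gv (m : nat) (g : 'I_m -> BB) a b : 'rV[K]_m := \row_i ev2 (g i) a b.

Lemma ev2_sub2_mev m (g : 'I_m.+1 -> BB) F a b : ev2 (sub2 g F) a b = mev F (gv g a b).
Proof. by rewrite ev2_sub2; apply: meval_eq => i; rewrite mxE. Qed.

End Bivariate.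

(** * Norms and plane curves *)

Section MatrixNorm.
Variable K : numClosedFieldType.

Lemma char_poly_horner n (C : 'M[K]_n) z : (char_poly C).[z] = \det (z%:M - C).
Proof.
rewrite /char_poly -[LHS]/(horner_eval z _) -det_map_mx; congr (\det _).
apply/matrixP => i j; rewrite !mxE /= /horner_eval.
by rewrite hornerD hornerN hornerMn hornerX hornerC.
Qed.

(** The product over eigenvalues without triangularization: p is split into linear factors, and each
    det (C - z) is a value of the characteristic polynomial up to sign. *)
Lemma det_horner_mx n (C : 'M[K]_n.+1) (bs : seq K) (p : {poly K}) :
  char_poly C = \prod_(b <- bs) ('X - b%:P) ->
  \det (horner_mx C p) = \prod_(b <- bs) p.[b].
Proof.
move=> hC; have sz : size bs = n.+1.
  by have := size_char_poly C; rewrite hC size_prod_XsubC => -[].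
have [s ->] := closed_field_poly_normal p.
set c := lead_coef p; rewrite linearZ /= detZ rmorph_prod /=.
under [RHS]eq_bigr do rewrite hornerZ horner_prod.
rewrite big_split /= big_const_seq count_predT sz iter_mulr_1; congr (_ * _).
rewrite (big_morph _ (@det_mulmx K n.+1) (det1 K n.+1)) exchange_big /=.
apply: eq_bigr => z _; rewrite rmorphB /= horner_mx_X horner_mx_C.
rewrite -opprB -scaleN1r detZ -char_poly_horner hC horner_prod -sz.
have -> : (-1) ^+ size bs = \prod_(b <- bs) (-1 : K).
  by rewrite big_const_seq count_predT iter_mulr_1.
rewrite -big_split; apply: eq_bigr => b _ /=; rewrite !hornerE; ring.
Qed.

End MatrixNorm.

Section Norm.
Variable K : numClosedFieldType.
Local Notation BB := {poly {poly K}}.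
Implicit Types (A B f : BB) (a b : K).

(** The companion matrix, with a size that is visibly a successor, as [horner_mx] demands. *)
Definition cmx (R : nzRingType) (p : {poly R}) : 'M[R]_((size p).-2.+1) :=
  \matrix_(i, j) if i == (size p).-2 :> nat then - p`_j else (i.+1 == j :> nat)%:R.

Lemma cmxK (R : comNzRingType) (p : {poly R}) : p \is monic -> (1 < size p)%N ->
  char_poly (cmx p) = p.
Proof.
move=> mp sp; have e : (size p).-1 = (size p).-2.+1 by case: (size p) sp => [|[|]].
rewrite -[RHS](companionmxK mp); have -> : cmx p = castmx (e, e) (companionmx p).
  by apply/matrixP => i j; rewrite castmxE !mxE.
by case: _ / e.
Qed.

(* the norm of K[x][y]/(f) over K[x], for f monic in y *)
Definition Nm f A : {poly K} := \det (horner_mx (cmx f) A).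

Definition fiber_roots f a (bs : seq K) := fiber f a = \prod_(b <- bs) ('X - b%:P).

Lemma Nm_fiber f A a bs : f \is monic -> (1 < size f)%N -> fiber_roots f a bs ->
  (Nm f A).[a] = \prod_(b <- bs) ev2 A a b.
Proof.
move=> mf sf hbs; rewrite /Nm -[LHS]/(horner_eval a _) -det_map_mx map_horner_mx.
rewrite (@det_horner_mx _ _ _ bs); last first.
  by rewrite -map_char_poly cmxK.
by apply: eq_bigr => b _; rewrite fiberE.
Qed.

Lemma fiber_rootsP f a bs b : fiber_roots f a bs -> (b \in bs) = (ev2 f a b == 0).
Proof. by move=> h; rewrite -fiberE -[_ == 0]/(root _ b) h root_prod_XsubC. Qed.

Lemma fiber_ex f a d : f \is monic -> size f = d.+1 ->
  exists2 bs, size bs = d & fiber_roots f a bs.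
Proof.
move=> mf sf; have mfa : fiber f a \is monic by apply: monic_map.
have [bs E] := closed_field_poly_normal (fiber f a).
rewrite (eqP mfa) scale1r in E; exists bs => //.
have : size (fiber f a) = d.+1 by rewrite size_map_poly_id0 // (eqP mf) rmorph1 oner_neq0.
by rewrite E size_prod_XsubC => -[].
Qed.

Lemma horner_mx_eigen (n : nat) (C : 'M[K]_n.+1) (v : 'cV[K]_n.+1) b (p : {poly K}) :
  C *m v = b *: v -> horner_mx C p *m v = p.[b] *: v.
Proof.
move=> h; elim/poly_ind: p => [|p c IH]; first by rewrite rmorph0 mul0mx horner0 scale0r.
rewrite rmorphD rmorphM /= horner_mx_X horner_mx_C mulmxDl -mulmxE -mulmxA h.
by rewrite -scalemxAr IH mul_scalar_mx scalerA -scalerDl !hornerE mulrC.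
Qed.

Lemma companion_eigen f a b : f \is monic -> ev2 f a b = 0 -> (1 < size f)%N ->
  map_mx (horner_eval a) (cmx f) *m (\col_i b ^+ i) = b *: (\col_i b ^+ i).
Proof.
move=> mf fab sf; apply/matrixP => i j; rewrite !mxE.
set n := (size f).-2; have sf2 : size f = n.+2 by rewrite /n; case: (size f) sf => [|[|]].
have E : \sum_(j < n.+1) (f`_j).[a] * b ^+ j = - b ^+ n.+1.
  apply/eqP; rewrite -addr_eq0; apply/eqP; rewrite -[RHS]fab -fiberE.
  rewrite (@horner_coef_wide _ n.+2); last by rewrite -sf2 size_poly.
  rewrite [RHS]big_ord_recr /= coef_fiber.
  have -> : f`_n.+1 = 1 by have := eqP mf; rewrite lead_coefE sf2.
  rewrite hornerC mul1r; congr (_ + _).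
  by apply: eq_bigr => k _; rewrite coef_fiber.
have [e|ne] := eqVneq (i : nat) n.
  rewrite -exprS e -[RHS]opprK -E -sumrN; apply: eq_bigr => k _.
  by rewrite !mxE e eqxx /= /horner_eval hornerN mulNr.
have iS : (i.+1 < n.+1)%N by rewrite ltnS ltn_neqAle ne -ltnS ltn_ord.
rewrite (bigD1 (Ordinal iS)) //= !mxE (negPf ne) /= eqxx /horner_eval hornerC mul1r exprS.
rewrite big1 ?addr0 // => k; rewrite -val_eqE /= => ki; rewrite !mxE (negPf ne) eq_sym (negPf ki) /=.
by rewrite /horner_eval horner0 mul0r.
Qed.

(* Two zeros of A over the same a give two independent vectors in the kernel of the matrix at a. *)
Lemma Nm_double_zero f A a b1 b2 : f \is monic -> b1 != b2 ->
  ev2 f a b1 = 0 -> ev2 f a b2 = 0 -> ev2 A a b1 = 0 -> ev2 A a b2 = 0 ->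
  ('X - a%:P) ^+ 2 %| Nm f A.
Proof.
move=> mf b12 f1 f2 A1 A2.
have sf : (2 < size f)%N.
  have s0 : size f = (size f).-1.+1 by rewrite prednK // lt0n size_poly_eq0 monic_neq0.
  have [bs sbs hbs] := fiber_ex a mf s0.
  have : (size [:: b1; b2] <= size bs)%N.
    apply: uniq_leq_size; first by rewrite /= inE b12.
    by move=> b; rewrite !inE (fiber_rootsP _ hbs) => /orP[]/eqP->; apply/eqP.
  by rewrite sbs /=; lia.
have sf1 : (1 < size f)%N by apply: ltnW.
set Y := horner_mx (cmx f) A.
(* The identity with its first two columns replaced by the powers of b1 and the differences of the
   powers of b2 and b1: triangular of determinant b2 - b1. At a, both columns are killed by [Y]. *)
pose S : 'M[{poly K}]_((size f).-2.+1) := \matrix_(i, j) 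
  (if j == 0%N :> nat then b1 ^+ i else if j == 1%N :> nat then b2 ^+ i - b1 ^+ i else (i == j)%:R)%:P.
have Y0 b : ev2 f a b = 0 -> ev2 A a b = 0 ->
    forall i, \sum_j (Y i j).[a] * b ^+ j = 0.
  move=> fb Ab i; have := companion_eigen mf fb sf1 => /(horner_mx_eigen (fiber A a)).
  rewrite fiberE Ab scale0r -[fiber A a]/(map_poly (horner_eval a) A) -map_horner_mx.
  move=> /matrixP /(_ i 0); rewrite !mxE => h0; rewrite -[RHS]h0.
  by apply: eq_bigr => j _; rewrite !mxE.
have YS i (j : 'I_((size f).-2.+1)) : (j < 2)%N -> 'X - a%:P %| (Y *m S) i j.
  move=> j2; rewrite dvdp_XsubCl /root mxE horner_sum; apply/eqP.
  case: (j =P 0%N :> nat) => [j0|j0].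
    rewrite -[RHS](Y0 b1 f1 A1 i); apply: eq_bigr => k _.
    by rewrite mxE j0 eqxx hornerM hornerC.
  have j1 : j = 1%N :> nat by lia.
  transitivity (\sum_k (Y i k).[a] * b2 ^+ k - \sum_k (Y i k).[a] * b1 ^+ k).
    by rewrite -sumrB; apply: eq_bigr => k _; rewrite mxE j1 /= hornerM hornerC; ring.
  by rewrite !Y0 // subrr.
have dS : \det S != 0.
  rewrite det_trig; last first.
    apply/is_trig_mxP => i j ij; rewrite mxE; case: eqP => [j0|j0]; first by rewrite j0 in ij.
    case: eqP => [j1|j1]; last by rewrite -val_eqE (ltn_eqF ij).
    have -> : nat_of_ord i = 0%N by lia.
    by rewrite !expr0 subrr.
  apply/prodf_neq0 => i _; rewrite mxE polyC_eq0.
  have [->|_] := eqVneq (i : nat) 0%N; first by rewrite expr0 oner_neq0.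
  have [->|_] := eqVneq (i : nat) 1%N; first by rewrite !expr1 subr_eq0 eq_sym.
  by rewrite eqxx oner_neq0.
(* Two columns of [Y *m S] are divisible by X - a, so the square of X - a comes out of the
   determinant. *)
pose W := \matrix_(i, j) (if (j < 2)%N then (Y *m S) i j %/ ('X - a%:P) else (Y *m S) i j).
have E : Y *m S = W *m diag_mx (\row_j (if (j < 2)%N then 'X - a%:P else 1)).
  apply/matrixP => i j; rewrite mul_mx_diag !mxE; case: ifP => j2; last by rewrite mulr1.
  by rewrite divpK //; have := YS i j j2; rewrite mxE.
have : ('X - a%:P) ^+ 2 %| \det Y * \det S.
  rewrite -det_mulmx E det_mulmx det_diag; apply: dvdp_mull.
  have l0 : (0 < (size f).-2.+1)%N by lia.
  have l1 : (1 < (size f).-2.+1)%N by lia.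
  rewrite (bigD1 (Ordinal l0)) // (bigD1 (Ordinal l1)) //= !mxE /= mulrA -expr2.
  exact: dvdp_mulr (dvdpp _).
have dSE : \det S = ((\det S)`_0)%:P.
  apply: size1_polyC; rewrite det_trig; last first.
    apply/is_trig_mxP => i j ij; rewrite mxE; case: eqP => [j0|j0]; first by rewrite j0 in ij.
    case: eqP => [j1|j1]; last by rewrite -val_eqE (ltn_eqF ij).
    have -> : nat_of_ord i = 0%N by lia.
    by rewrite !expr0 subrr.
  rewrite (eq_bigr (fun i => ((fun i => (S i i)`_0) i)%:P)) => [|i _].
    by rewrite -rmorph_prod size_polyC_leq1.
  by rewrite !mxE coefC.
rewrite dSE mulrC mul_polyC dvdpZr //.
by apply: contraNneq dS => e; rewrite dSE e.
Qed.

End Norm.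

Section PlaneCurve.
Variable K : numClosedFieldType.
Local Notation BB := {poly {poly K}}.
Implicit Types (A B f : BB) (a b : K).

(** [pc_irr] is irreducibility over K(x) with denominators cleared: every [A] is a multiple of f or
    invertible modulo f up to a nonzero polynomial in x, whose roots then bound the common zeros. *)
Record plane_curve f d : Prop := PlaneCurve {
  pc_monic : f \is monic;
  pc_size : size f = d.+1;
  pc_tdeg : tdeg d f;
  pc_gt0 : (0 < d)%N;
  pc_irr : forall A, (exists q, A = q * f) \/
     exists U V r, r != 0 /\ U * A + V * f = r%:P }.

Definition van f A := forall a b, ev2 f a b = 0 -> ev2 A a b = 0.

Variables (f : BB) (d : nat).
Hypothesis hf : plane_curve f d.

Lemma pc_size1 : (1 < size f)%N.
Proof. by rewrite (pc_size hf) ltnS (pc_gt0 hf). Qed.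

Lemma pc_point a : exists b, ev2 f a b = 0.
Proof.
have [bs sbs hbs] := fiber_ex a (pc_monic hf) (pc_size hf).
case: bs sbs hbs => [|b bs] sbs hbs; first by have := pc_gt0 hf; rewrite -sbs.
by exists b; apply/eqP; rewrite -(fiber_rootsP _ hbs) mem_head.
Qed.

Lemma van_dvd A : van f A <-> exists q, A = q * f.
Proof.
split=> [h|[q ->] a b fab]; last by rewrite ev2M fab mulr0.
have [//|[U [V [r [r0 E]]]]] := pc_irr hf A.
have [a ra] := poly_nonroot r0; have [b fab] := pc_point a.
have := congr1 (fun B => ev2 B a b) E; rewrite !ev2E ev2C fab h // !mulr0 addr0 => e.
by rewrite -e eqxx in ra.
Qed.

Lemma pc_cof A : ~ van f A ->
  exists2 r : {poly K}, r != 0 & forall a b, ev2 f a b = 0 -> ev2 A a b = 0 -> r.[a] = 0.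
Proof.
move=> nA; have [/van_dvd //|[U [V [r [r0 E]]]]] := pc_irr hf A.
exists r => // a b fab Aab.
by have := congr1 (fun B => ev2 B a b) E; rewrite !ev2E ev2C fab Aab !mulr0 addr0.
Qed.

(** If [A] did not vanish on the curve, its zeros would lie over the roots of some nonzero s, but it
    vanishes over any a with (r s)(a) nonzero. *)
Lemma van_cof A (r : {poly K}) : r != 0 ->
  (forall a b, ev2 f a b = 0 -> r.[a] != 0 -> ev2 A a b = 0) -> van f A.
Proof.
move=> r0 h; apply: contrapT => /pc_cof [s s0 hs].
have [a] : exists a, (r * s).[a] != 0 by apply: poly_nonroot; rewrite mulf_neq0.
rewrite hornerM mulf_eq0 negb_or => /andP[ra sa].
have [b fab] := pc_point a; have := hs a b fab (h a b fab ra).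
by move/eqP: sa.
Qed.

Lemma van_mul A B : van f (A * B) -> van f A \/ van f B.
Proof.
move=> h; have [?|/pc_cof [r r0 hr]] := pselect (van f A); first by left.
right; apply: (van_cof r0) => a b fab ra.
have := h a b fab; rewrite ev2M => /eqP; rewrite mulf_eq0 => /orP[/eqP/(hr a b fab)/eqP|/eqP//].
by rewrite (negPf ra).
Qed.

Lemma van_delta A : van f A -> van f (delta f A).
Proof.
move=> /van_dvd [q ->] a b fab.
by rewrite deltaM delta_id !ev2E fab !mulr0 addr0.
Qed.

Lemma van_size A : van f A -> (size A < d.+1)%N -> A = 0.
Proof.
move=> /van_dvd [q ->]; have [->|q0] := eqVneq q 0; first by rewrite mul0r.
rewrite size_Mmonic ?(pc_monic hf) // (pc_size hf).
by case: (size q) (size_poly_eq0 q) => [|m]; [move/esym; rewrite (negPf q0)|lia].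
Qed.

Lemma nvan_C (r : {poly K}) : r != 0 -> ~ van f r%:P.
Proof.
move=> /poly_nonroot [a ra] h; have [b fab] := pc_point a.
by have := h a b fab; rewrite ev2C => /eqP; rewrite (negPf ra).
Qed.

(** The leading coefficient of f_y is d, nonzero in characteristic 0, and f_y is too short to be a
    multiple of f. *)
Lemma nvan_dy : ~ van f (dy f).
Proof.
move=> /van_size h; have : dy f = 0.
  by apply: h; rewrite -(pc_size hf); apply: lt_size_deriv; apply/monic_neq0/(pc_monic hf).
move/(congr1 (fun p : BB => p`_d.-1)); rewrite coef_deriv coef0 prednK ?(pc_gt0 hf) //.
have -> : f`_d = 1 by have := eqP (pc_monic hf); rewrite lead_coefE (pc_size hf).
move/(congr1 (horner^~ 0)); rewrite hornerMn hornerC horner0 => /eqP.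
by rewrite Num.Theory.pnatr_eq0 => /eqP d0; have := pc_gt0 hf; rewrite d0.
Qed.

Lemma Nm_eq0 A : Nm f A = 0 <-> van f A.
Proof.
split=> [h|h]; last first.
  apply: poly_fun0 => a; have [bs sbs hbs] := fiber_ex a (pc_monic hf) (pc_size hf).
  rewrite (Nm_fiber _ (pc_monic hf) pc_size1 hbs); case: bs sbs hbs => [|b bs] sbs hbs.
    by have := pc_gt0 hf; rewrite -sbs.
  by rewrite big_cons h ?mul0r //; apply/eqP; rewrite -(fiber_rootsP _ hbs) mem_head.
apply: contrapT => /pc_cof [r r0 hr].
have [a ra] := poly_nonroot r0; have [bs sbs hbs] := fiber_ex a (pc_monic hf) (pc_size hf).
have /eqP := congr1 (fun p => p.[a]) h; rewrite (Nm_fiber _ (pc_monic hf) pc_size1 hbs) horner0.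
rewrite prodf_seq_eq0 => /hasP [b bbs /= /eqP Ab].
have /eqP fb : ev2 f a b == 0 by rewrite -(fiber_rootsP _ hbs).
by move: ra; rewrite (hr a b fb Ab) eqxx.
Qed.

Lemma Nm_root A a : (Nm f A).[a] = 0 <-> exists b, ev2 f a b = 0 /\ ev2 A a b = 0.
Proof.
have [bs sbs hbs] := fiber_ex a (pc_monic hf) (pc_size hf).
rewrite (Nm_fiber _ (pc_monic hf) pc_size1 hbs); split=> [/eqP|[b [fb Ab]]].
  rewrite prodf_seq_eq0 => /hasP [b bbs /= /eqP Ab]; exists b; split=> //.
  by apply/eqP; rewrite -(fiber_rootsP _ hbs).
by apply/eqP; rewrite prodf_seq_eq0; apply/hasP; exists b => /=; [rewrite (fiber_rootsP _ hbs)|]; apply/eqP.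
Qed.

(** A Bezout relation between f and f_y specializes to every fibre outside the roots of r. *)
Lemma pc_separable : exists2 r : {poly K}, r != 0 & forall a bs, r.[a] != 0 ->
  fiber_roots f a bs -> uniq bs.
Proof.
have [/van_dvd/nvan_dy //|[U [V [r [r0 E]]]]] := pc_irr hf (dy f).
exists r => // a bs ra hbs; rewrite -separable_prod_XsubC -hbs separable_poly.unlock coprimep_sym.
apply/Bezout_coprimepP; exists (fiber U a, fiber V a) => /=.
have -> : (fiber f a)^`() = fiber (dy f) a by rewrite /fiber -deriv_map.
by rewrite /fiber -!rmorphM -rmorphD E /= map_polyC /= polyC_eqp1.
Qed.

End PlaneCurve.

(** * Behaviour at infinity *)

Section Infinity.
Variable K : numClosedFieldType.
Local Notation BB := {poly {poly K}}.
Implicit Types (A B f : BB) (a b c s : K).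

(* the chart at infinity: s^e * A (1/s, y/s), for A of total degree at most e *)
Definition revp (e : nat) A : BB :=
  \poly_(j < e.+1) \sum_(i < e.+1 | (i + j <= e)%N) A`_j`_i *: 'X^(e - i - j).

Definition topev e A c : K := ev2 (revp e A) 0 c.

Lemma ev2_revp_sum e A s c : ev2 (revp e A) s c =
  \sum_(j < e.+1) \sum_(i < e.+1 | (i + j <= e)%N) A`_j`_i * (s ^+ (e - i - j) * c ^+ j).
Proof.
rewrite /ev2 horner_poly horner_sum; apply: eq_bigr => j _.
rewrite hornerM horner_exp hornerC horner_sum mulr_suml; apply: eq_bigr => i _.
by rewrite hornerZ hornerXn mulrA.
Qed.

Lemma ev2_revp e A s c : tdeg e A -> s != 0 ->
  ev2 (revp e A) s c = s ^+ e * ev2 A s^-1 (c / s).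
Proof.
move=> h s0; pose v := fun _ : 'I_0 => (0 : K).
have := @meval_hom K 0 (s%:MP) 1 (c%:MP) e A v h.
rewrite !mevalC ?meval1 div1r => <- //; rewrite meval_hom_sum ev2_revp_sum.
apply: eq_bigr => j _; apply: eq_bigr => i _.
by rewrite !mevalC ?meval1 expr1n mulr1.
Qed.

(** The route to identities at infinity: for s nonzero [revp] is a change of variables, and
    polynomials that agree there agree at s = 0. *)
Lemma revp_ext A B : (forall s c, s != 0 -> ev2 A s c = ev2 B s c) ->
  forall c, ev2 A 0 c = ev2 B 0 c.
Proof.
move=> h c; rewrite /ev2; congr (_.[0]).
by apply: (@poly_fun_inj _ _ _ 'X); rewrite ?polyX_eq0 // => t; rewrite hornerX => /(h t c).
Qed.

Lemma topevM e e' A B c : tdeg e A -> tdeg e' B ->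
  topev (e + e') (A * B) c = topev e A c * topev e' B c.
Proof.
move=> hA hB; rewrite /topev -ev2M; apply: revp_ext => s {}c s0.
rewrite ev2M !ev2_revp //; last exact: tdegM.
by rewrite ev2M exprD; ring.
Qed.

Lemma topev_x c : topev 1 (xx K) c = 1.
Proof.
transitivity (ev2 (1 : BB) 0 c); last by rewrite ev2_1.
apply: revp_ext => s {}c s0.
by rewrite ev2_revp ?ev2x ?ev2_1 ?expr1 ?mulfV //; apply: tdeg_x.
Qed.

Lemma fiber_dy A a : fiber (dy A) a = (fiber A a)^`().
Proof. by rewrite /fiber deriv_map. Qed.

(** In the chart y = c / s, differentiating in c brings out 1 / s and lowers the nominal degree from
    e + 1 to e. *)
Lemma revp_dy e A : tdeg e.+1 A -> forall c, topev e (dy A) c = (fiber (revp e.+1 A) 0)^`().[c].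
Proof.
move=> hA c; rewrite -fiber_dy fiberE; apply: revp_ext => s {}c s0.
rewrite ev2_revp //; last exact: (tdeg_dy hA).
rewrite -!fiberE !fiber_dy.
have -> : fiber (revp e.+1 A) s = s ^+ e.+1 *: (fiber A s^-1 \Po (s^-1 *: 'X)).
  apply: (@poly_fun_inj _ _ _ 1); rewrite ?oner_neq0 // => t _.
  by rewrite fiberE ev2_revp // hornerZ horner_comp fiberE !hornerE [s^-1 * t]mulrC.
rewrite derivZ deriv_comp derivZ derivX alg_polyC hornerZ hornerM horner_comp !hornerE /=.
by rewrite exprS [s^-1 * c]mulrC; field.
Qed.

(** If the degree N of [A] exceeded k, reversing [A] at N would give X^(N - k) B, whose value at 0
    is both 0 and the leading coefficient of [A]. *)
Lemma rev_reflect (A B : {poly K}) k : (forall s, s != 0 -> B.[s] = s ^+ k * A.[s^-1]) ->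
  (size A <= k.+1)%N /\ A`_k = B.[0].
Proof.
move=> h; pose C N := \sum_(i < N.+1) A`_i *: 'X^(N - i) : {poly K}.
have CE N s : (size A <= N.+1)%N -> s != 0 -> (C N).[s] = s ^+ N * A.[s^-1].
  move=> sA s0; rewrite horner_sum (horner_coef_wide _ sA) mulr_sumr; apply: eq_bigr => i _.
  rewrite hornerZ hornerXn exprVn.
  have -> : s ^+ N = s ^+ (N - i) * s ^+ i by rewrite -exprD subnK // -ltnS.
  by field; rewrite expf_neq0.
have C0 N : (C N).[0] = A`_N.
  rewrite horner_sum big_ord_recr /= hornerZ subnn hornerXn expr0 mulr1.
  rewrite big1 ?add0r // => i _; rewrite hornerZ hornerXn.
  by have := ltn_ord i; rewrite -subn_gt0; case: (N - i)%N => // m _; rewrite exprS mul0r mulr0.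
have [sA|sA] := leqP (size A) k.+1.
  split=> //; rewrite -C0; congr (_.[0]); apply: (@poly_fun_inj _ _ _ 'X).
    by rewrite polyX_eq0.
  by move=> s; rewrite hornerX => s0; rewrite CE // h.
have szA : size A = (size A).-1.+1 by case: (size A) sA.
have kA : (k <= (size A).-1)%N by lia.
suff E : C (size A).-1 = 'X^((size A).-1 - k) * B.
  have := C0 (size A).-1; rewrite E hornerM hornerXn.
  have : (0 < (size A).-1 - k)%N by lia.
  case: (_ - _)%N => // m _; rewrite exprS !mul0r -lead_coefE => /esym/eqP.
  by rewrite lead_coef_eq0 => /eqP A0; rewrite A0 size_poly0 in sA.
apply: (@poly_fun_inj _ _ _ 'X); first by rewrite polyX_eq0.
move=> s; rewrite hornerX => s0; rewrite hornerM hornerXn CE -?szA // h // mulrA -exprD.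
by rewrite subnK.
Qed.

Lemma revp_monic f d : f \is monic -> size f = d.+1 -> tdeg d f ->
  revp d f \is monic /\ size (revp d f) = d.+1.
Proof.
move=> mf sf _.
have fd : f`_d = 1 by have := eqP mf; rewrite lead_coefE sf.
have E : (revp d f)`_d = 1.
  rewrite coef_poly ltnSn (bigD1 ord0) ?add0n ?leqnn //= fd -polyC1 coefC /= scale1r subn0 subnn expr0.
  by rewrite big1 ?addr0 ?polyC1 // => i /andP[i0]; rewrite -val_eqE /=; move: i0; lia.
have sz : size (revp d f) = d.+1.
  apply/eqP; rewrite eqn_leq size_poly ltnNge; apply/negP => /(nth_default 0).
  by rewrite E => /eqP; rewrite oner_eq0.
by split=> //; rewrite monicE lead_coefE sz E.
Qed.

(** The roots of [revp d f] over s are s times those of f over 1 / s, so the norm in the chart at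
    infinity is s^(d e) times the norm at 1 / s. *)
Lemma Nm_infinity f d cs e A : plane_curve f d -> fiber_roots (revp d f) 0 cs -> tdeg e A ->
  (size (Nm f A) <= (d * e).+1)%N /\ (Nm f A)`_(d * e) = \prod_(c <- cs) topev e A c.
Proof.
move=> hf hcs hA; have [mr sr] := revp_monic (pc_monic hf) (pc_size hf) (pc_tdeg hf).
have sr1 : (1 < size (revp d f))%N by rewrite sr ltnS (pc_gt0 hf).
rewrite -(Nm_fiber _ mr sr1 hcs); apply: rev_reflect => s s0.
have [bs sbs hbs] := fiber_ex s^-1 (pc_monic hf) (pc_size hf).
rewrite (Nm_fiber _ (pc_monic hf) (pc_size1 hf) hbs).
rewrite (@Nm_fiber _ _ _ s [seq s * b | b <- bs] mr sr1).
  rewrite big_map; transitivity (\prod_(b <- bs) (s ^+ e * ev2 A s^-1 b)).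
    by apply: eq_bigr => b _; rewrite ev2_revp // mulrAC mulfV // mul1r.
  by rewrite big_split /= big_const_seq count_predT iter_mulr_1 sbs -exprM mulnC.
rewrite /fiber_roots; apply: (@poly_fun_inj _ _ _ 1); rewrite ?oner_neq0 // => t _.
rewrite fiberE (ev2_revp _ (pc_tdeg hf) s0) -fiberE hbs !horner_prod big_map.
have -> : s ^+ d = \prod_(b <- bs) s by rewrite big_const_seq count_predT iter_mulr_1 sbs.
by rewrite -big_split; apply: eq_bigr => b _ /=; rewrite !hornerE; field.
Qed.

End Infinity.

(** * Simple roots as a polynomial condition on coefficients *)

Section Sylvester.
Variable K : numClosedFieldType.
Implicit Types p : {poly K}.

(* Sylvester determinant of p and its derivative for the nominal degree N of p *)
Definition syl N p : K :=
  \det (col_mx (\matrix_(i < N.-1, k < N.-1 + N) ('X^i * p)`_k)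
               (\matrix_(j < N, k < N.-1 + N) ('X^j * p^`())`_k)).

(** The powers of a common root a form a kernel vector of the Sylvester matrix. *)
Lemma syl_noroot N p a : (size p <= N.+1)%N -> p`_N != 0 -> syl N p != 0 ->
  p.[a] = 0 -> p^`().[a] = 0 -> False.
Proof.
move=> sp pN hs pa p'a; case: N sp pN hs => [|N] sp pN hs.
  move: pa pN; rewrite (size1_polyC sp) hornerC coefC /= => ->.
  by rewrite eqxx.
rewrite /syl /= in hs; set S := (X in \det X) in hs; pose w : 'cV[K]_(N + N.+1) := \col_k a ^+ k.
have : S *m w = 0.
  rewrite /S mul_col_mx; apply/matrixP => i j; rewrite !mxE.
  have E (q : {poly K}) : (size q <= N + N.+1)%N -> \sum_(k < N + N.+1) q`_k * (w k j) = q.[a] :> K.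
    by move=> sq; rewrite (horner_coef_wide _ sq); apply: eq_bigr => k _; rewrite mxE.
  have sp' : (size p^`() <= N.+1)%N.
    have [->|p0] := eqVneq p 0; first by rewrite deriv0 size_poly0.
    by have := lt_size_deriv p0; lia.
  case: splitP => k _; rewrite !mxE.
    rewrite -[RHS](_ : ('X^k * p).[a] = 0); last by rewrite hornerM pa mulr0.
    rewrite -E; first by apply: eq_bigr => l _; rewrite mxE.
    apply: leq_trans (size_polyMleq _ _) _; rewrite size_polyXn; by have := leq_add (ltn_ord k) sp; rewrite /= addSn !addnS ltnS.
  rewrite -[RHS](_ : ('X^k * p^`()).[a] = 0); last by rewrite hornerM p'a mulr0.
  rewrite -E; first by apply: eq_bigr => l _; rewrite mxE.
  apply: leq_trans (size_polyMleq _ _) _; rewrite size_polyXn /=.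
  by apply: leq_add sp'; rewrite -ltnS ltn_ord.
move=> Sw; have uS : S \in unitmx by rewrite unitmxE unitfE.
have w0 : w = 0 by rewrite -[w](mulKmx uS) Sw mulmx0.
have lt0 : (0 < N + N.+1)%N by rewrite addnS.
have /matrixP /(_ (Ordinal lt0) 0) := w0; rewrite !mxE /= expr0 => /eqP.
by rewrite oner_eq0.
Qed.

(** A row kernel vector is a relation u p + w p' = 0 with deg w < deg p; since p and p' are coprime,
    p divides w, so w = 0 and then u = 0. *)
Lemma syl_neq0 N p : size p = N.+1 -> (forall a, p.[a] = 0 -> p^`().[a] = 0 -> False) ->
  syl N p != 0.
Proof.
move=> sp h; apply/negP => /det0P [v v0 hv].
have p0 : p != 0 by rewrite -size_poly_eq0 sp.
have cop : coprimep p p^`().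
  rewrite /coprimep; apply/negPn/negP => /closed_rootP [a].
  by rewrite root_gcd => /andP[/eqP pa /eqP p'a]; apply: (h a).
pose u := rVpoly (lsubmx v); pose w := rVpoly (rsubmx v).
have sw : (size w <= N)%N by apply: size_poly.
have su : (size u <= N.-1)%N by apply: size_poly.
have sumE (n : nat) (x : 'rV[K]_n) q k : (rVpoly x * q)`_k = \sum_i x 0 i * ('X^i * q)`_k.
  have -> : rVpoly x = \sum_i x 0 i *: 'X^i.
    by rewrite /rVpoly poly_def; apply: eq_bigr => i _; rewrite valK.
  by rewrite mulr_suml coef_sum; apply: eq_bigr => i _; rewrite -scalerAl coefZ.
have E : u * p + w * p^`() = 0.
  apply/polyP => k; rewrite coef0; have [kN|Nk] := ltnP k (N.-1 + N).
    have := congr1 (fun M : 'rV_(N.-1 + N) => M 0 (Ordinal kN)) hv.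
    rewrite -[v]hsubmxK mul_row_col !mxE => e; rewrite coefD !sumE -[RHS]e.
    by congr (_ + _); apply: eq_bigr => i _; rewrite !mxE.
  apply: nth_default; apply: leq_trans Nk; apply: leq_trans (size_polyD _ _) _.
  rewrite geq_max; apply/andP; split; apply: leq_trans (size_polyMleq _ _) _.
    have l1 m : (m <= N.-1 -> (m + N.+1).-1 <= N.-1 + N)%N by lia.
    by rewrite sp; apply: l1.
  have l2 m k' : (m <= N -> k' < N.+1 -> (m + k').-1 <= N.-1 + N)%N by lia.
  by have := lt_size_deriv p0; rewrite sp; apply: l2.
have : p %| w * p^`().
  by have := dvdp_addr (w * p^`()) (dvdp_mulIr u p); rewrite E dvdp0 => <-.
rewrite Gauss_dvdpl // => pw.
have w0 : w = 0.
  by apply/eqP; apply: contraTT pw => w0; apply/negP => /(dvdp_leq w0); rewrite sp ltnNge sw.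
move: E; rewrite w0 mul0r addr0 => /eqP; rewrite mulf_eq0 (negPf p0) orbF => /eqP u0.
move: v0; rewrite -[v]hsubmxK -[lsubmx v]rVpolyK -[rsubmx v]rVpolyK -/u -/w u0 w0.
by rewrite !linear0 row_mx0 eqxx.
Qed.

End Sylvester.

(** * Polynomials whose coefficients are polynomial functions of a parameter *)

Section PolynomialFamilies.
Variables (K : numClosedFieldType) (n : nat).
Implicit Types (phi psi : 'rV[K]_n -> {poly K}).

Definition polyfunP phi := forall i, polyfun (fun v => (phi v)`_i).

Lemma polyfunP_ext phi psi : phi =1 psi -> polyfunP phi -> polyfunP psi.
Proof. by move=> e h i; apply: polyfun_ext (h i) => v; rewrite e. Qed.

Lemma polyfunP_const (p : {poly K}) : polyfunP (fun _ => p).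
Proof. by move=> i; apply: polyfun_const. Qed.

Lemma polyfunPM phi psi : polyfunP phi -> polyfunP psi -> polyfunP (fun v => phi v * psi v).
Proof.
move=> h1 h2 i; pose F v := \sum_(j < i.+1) (phi v)`_j * (psi v)`_(i - j).
apply: (@polyfun_ext K n F) => [v|]; first by rewrite coefM.
by apply: polyfun_sum => j _; apply: polyfunM.
Qed.

Lemma polyfunP_scalar (c : 'rV[K]_n -> K) (p : {poly K}) :
  polyfun c -> polyfunP (fun v => c v *: p).
Proof.
move=> h i; apply: (@polyfun_ext K n (fun v => c v * p`_i)) => [v|].
  by rewrite coefZ.
by apply: polyfunM => //; apply: polyfun_const.
Qed.

Lemma polyfunP_sum I (r : seq I) (P : pred I) (F : I -> 'rV[K]_n -> {poly K}) :
  (forall i, P i -> polyfunP (F i)) -> polyfunP (fun v => \sum_(i <- r | P i) F i v).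
Proof.
move=> h k; apply: (@polyfun_ext K n (fun v => \sum_(i <- r | P i) (F i v)`_k)) => [v|].
  by rewrite coef_sum.
by apply: polyfun_sum => i Pi; apply: h.
Qed.

Lemma polyfunP_prod I (r : seq I) (F : I -> 'rV[K]_n -> {poly K}) :
  (forall i, polyfunP (F i)) -> polyfunP (fun v => \prod_(i <- r) F i v).
Proof.
move=> h; elim: r => [|i r IH].
  by apply: polyfunP_ext (polyfunP_const 1) => v; rewrite big_nil.
by apply: polyfunP_ext (polyfunPM (h i) IH) => v; rewrite big_cons.
Qed.

Lemma polyfunP_det m (A : 'rV[K]_n -> 'M[{poly K}]_m) :
  (forall i j, polyfunP (fun v => A v i j)) -> polyfunP (fun v => \det (A v)).
Proof.
move=> h; apply: polyfunP_sum => s _; apply: polyfunPM; first exact: polyfunP_const.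
by apply: polyfunP_prod => i; apply: h.
Qed.

Lemma polyfunP_horner phi N a : polyfunP phi -> (forall v, (size (phi v) <= N)%N) ->
  polyfun (fun v => (phi v).[a]).
Proof.
move=> h hN; apply: (@polyfun_ext K n (fun v => \sum_(i < N) (phi v)`_i * a ^+ i)) => [v|].
  by rewrite (horner_coef_wide _ (hN v)).
by apply: polyfun_sum => i _; apply: polyfunM => //; apply: polyfun_const.
Qed.

(** The quotient by a fixed [D] is linear; the uniform size bound makes it a finite combination of
    quotients of monomials. *)
Lemma polyfunP_divp phi N (D : {poly K}) : polyfunP phi -> (forall v, (size (phi v) <= N)%N) ->
  polyfunP (fun v => phi v %/ D).
Proof.
move=> h hN; apply: (@polyfunP_ext (fun v => \sum_(i < N) (phi v)`_i *: ('X^i %/ D))) => [v|].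
  have E : phi v = \sum_(i < N) (phi v)`_i *: 'X^i.
    rewrite -(poly_def N (fun i => (phi v)`_i)); apply/polyP => k; rewrite coef_poly.
    by case: ltnP => // Nk; rewrite nth_default // (leq_trans (hN v)).
  rewrite [in RHS]E (big_morph (fun p => p %/ D) (fun p q => divpD D p q) (div0p D)).
  by apply: eq_bigr => i _; rewrite divpZl.
by apply: polyfunP_sum => i _; apply: polyfunP_scalar.
Qed.

Lemma polyfun_syl phi N : polyfunP phi -> polyfun (fun v => syl N (phi v)).
Proof.
move=> h; apply: polyfun_det => i j.
have [k e|k e] := @split_ordP N.-1 N i.
  apply: (@polyfun_ext K n (fun v => if (j < k)%N then 0 else (phi v)`_(j - k))) => [v|].
    by rewrite e col_mxEu mxE coefXnM.
  by case: (j < k)%N; [apply: polyfun_const|apply: h].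
apply: (@polyfun_ext K n (fun v => if (j < k)%N then 0 else (phi v)`_(j - k).+1 * (j - k).+1%:R)) => [v|].
  by rewrite e col_mxEd mxE coefXnM coef_deriv mulr_natr.
case: (j < k)%N; first exact: polyfun_const.
by apply: polyfunM; [apply: h|apply: polyfun_const].
Qed.

End PolynomialFamilies.

(** * Pencils *)

Section Wronskian.
Variable K : numClosedFieldType.
Implicit Types (u l p q : {poly K}).

Lemma coefM_top p q m n : (size p <= m.+1)%N -> (size q <= n.+1)%N ->
  (p * q)`_(m + n) = p`_m * q`_n.
Proof.
move=> sp sq; have mn : (m < (m + n).+1)%N by rewrite ltnS leq_addr.
rewrite coefM (bigD1 (Ordinal mn)) //= addKn big1 ?addr0 // => i.
rewrite -val_eqE /= => im; have [mi|mi] := ltnP m i.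
  by rewrite nth_default ?mul0r // (leq_trans sp).
rewrite [X in _ * X]nth_default ?mulr0 // (leq_trans sq) //.
by have := ltn_ord i; lia.
Qed.

(** The top coefficients of x u' l and u x l' differ by the factors deg u and deg l, which must
    agree in characteristic 0. *)
Lemma wronskian_size u l : u != 0 -> l != 0 -> u^`() * l = u * l^`() -> size u = size l.
Proof.
move=> u0 l0 e.
have cX p i : ('X * p^`())`_i = p`_i *+ i.
  by rewrite coefXM; case: i => [|i]; rewrite ?mulr0n // coef_deriv.
have sX p m : (size p <= m.+1)%N -> (size ('X * p^`())%R <= m.+1)%N.
  move=> sp; apply/leq_sizeP => j mj; rewrite cX nth_default ?mul0rn //.
  exact: leq_trans mj.
have su : size u = (size u).-1.+1 by rewrite prednK // lt0n size_poly_eq0.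
have sl : size l = (size l).-1.+1 by rewrite prednK // lt0n size_poly_eq0.
have {}e : 'X * u^`() * l = u * ('X * l^`()) by rewrite -mulrA e; ring.
have := congr1 (fun p => p`_((size u).-1 + (size l).-1)) e.
rewrite !coefM_top ?sX -?su -?sl // !cX -!lead_coefE.
rewrite mulrnAl mulrnAr => /eqP; rewrite -subr_eq0 -[_ *+ (size u).-1]mulr_natr -[_ *+ (size l).-1]mulr_natr.
rewrite -mulrBr !mulf_eq0 !lead_coef_eq0 (negPf u0) (negPf l0) /= subr_eq0 Num.Theory.eqr_nat => /eqP e'.
by rewrite su sl e'.
Qed.

(** Subtracting the multiple of l with the same leading term gives a solution of smaller degree,
    which [wronskian_size] allows only if it is zero. *)
Lemma wronskian0 u l : l != 0 -> u^`() * l = u * l^`() -> exists c, u = c *: l.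
Proof.
move=> l0 e; have [->|u0] := eqVneq u 0; first by exists 0; rewrite scale0r.
exists (lead_coef u / lead_coef l); apply/eqP; rewrite -subr_eq0; apply: contraT => w0.
set w := u - _ in w0.
have ew : w^`() * l = w * l^`() by rewrite /w derivB derivZ !mulrBl e -!scalerAl [l^`() * l]mulrC.
have := wronskian_size w0 l0 ew; have := wronskian_size u0 l0 e => sul swl.
have : (size w < size l)%N.
  rewrite -[X in (_ < X)%N](prednK (_ : 0 < size l)%N) ?lt0n ?size_poly_eq0 // ltnS.
  apply/leq_sizeP => j; rewrite leq_eqVlt => /predU1P[<-|jl].
    by rewrite /w coefB coefZ -!lead_coefE -sul -lead_coefE divfK ?subrr // lead_coef_eq0.
  by rewrite /w coefB coefZ !nth_default ?mulr0 ?subrr ?sul //; move: jl; case: (size l).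
by rewrite swl ltnn.
Qed.

End Wronskian.

Section Pencil.
Variable K : numClosedFieldType.
Local Notation BB := {poly {poly K}}.
Implicit Types (Q m n : BB).

Lemma horner_dx Q (c : K) : (dx Q).[c%:P] = (Q.[c%:P])^`().
Proof.
elim/poly_ind: Q => [|Q p IH]; first by rewrite /dx map_poly0 !horner0 deriv0.
by rewrite dxD dxM dxy dxC mulr0 addr0 !hornerE derivD derivM IH derivC mulr0 addr0.
Qed.

(* If m divides its derivative with respect to the coefficients, its coefficients are proportional to constants. *)
Lemma dx_dvd_root m : m != 0 -> (1 < size m)%N -> m %| dx m -> exists c, m.[c%:P] = 0.
Proof.
move=> m0 sm hm; set l := lead_coef m; have l0 : l != 0 by rewrite lead_coef_eq0.
have E i : (m`_i)^`() * l = m`_i * l^`().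
  have [d0|d0] := eqVneq (dx m) 0.
    have h j : (m`_j)^`() = 0 by rewrite -coef_dx d0 coef0.
    by rewrite h mul0r /l lead_coefE h mulr0.
  have : size m == size (dx m).
    rewrite eqn_leq dvdp_leq // size_poly //.
  rewrite dvdp_size_eqp // => /eqpP [[c1 c2] /= /andP[c10 c20] e].
  have ei j : c1 * m`_j = c2 * (m`_j)^`() by rewrite -coef_dx -!coefZ e.
  apply: (mulfI c20); rewrite mulrA -ei -mulrA mulrC -mulrA [l * _]mulrC [RHS]mulrCA.
  by congr (_ * _); rewrite -ei mulrC.
have /choice [cs hcs] : forall i, exists c, m`_i = c *: l by move=> i; apply: wronskian0.
pose m0' := \poly_(i < size m) cs i.
have Em : m = l *: map_poly polyC m0'.
  apply/polyP => i; rewrite coefZ coef_map_id0 ?polyC0 // coef_poly; case: ltnP => si.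
    by rewrite hcs mulrC mul_polyC.
  by rewrite nth_default // polyC0 mulr0.
have sm0 : size m0' = size m by rewrite Em size_scale // size_map_polyC.
have /closed_rootP [c /eqP rc] : size m0' != 1%N by rewrite sm0; case: (size m) sm => [|[|]].
by exists c; rewrite Em hornerZ horner_map /= rc polyC0 mulr0.
Qed.

Lemma resultant_coprimep (R : idomainType) (p q : {poly R}) : p != 0 ->
  (resultant p q != 0) = coprimep p q.
Proof.
move=> p0; rewrite resultant_eq0 coprimep_def -leqNgt eqn_leq.
by rewrite lt0n size_poly_eq0 gcdp_eq0 (negPf p0) andbT.
Qed.

(** One fibre of full degree with simple roots suffices: the resultant of Q and its derivative
    specializes to that of the fibre. *)
Lemma pencil_separable Q a0 ts c : c != 0 -> uniq ts -> (0 < size ts)%N ->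
  size Q = (size ts).+1 -> fiber Q a0 = c *: \prod_(t <- ts) ('X - t%:P) -> coprimep Q (dy Q).
Proof.
move=> c0 uts ts0 sQ fQ; have Q0 : Q != 0 by rewrite -size_poly_eq0 sQ.
have lQ : (lead_coef Q).[a0] = c.
  rewrite lead_coefE sQ -coef_fiber fQ coefZ.
  have /eqP := monic_prod_XsubC ts xpredT id; rewrite lead_coefE size_prod_XsubC /= => ->.
  by rewrite mulr1.
have [k ek] : exists k, size ts = k.+1 by case: (size ts) ts0 => // k; exists k.
have cd : ((dy Q)`_k).[a0] = c *+ k.+1.
  by rewrite coef_deriv hornerMn -lQ lead_coefE sQ ek.
have cd0 : ((dy Q)`_k).[a0] != 0 by rewrite cd Num.Theory.mulrn_eq0.
have sd : size (dy Q) = k.+1.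
  apply/eqP; rewrite eqn_leq -ltnS -ek -sQ lt_size_deriv //= ek ltnNge.
  by apply: contra cd0 => sd; rewrite nth_default ?horner0.
rewrite -resultant_coprimep //; suff h : (resultant Q (dy Q)).[a0] != 0.
  by apply: contraNneq h => ->; rewrite horner0.
have E1 : horner_eval a0 (lead_coef Q) != 0 by rewrite /horner_eval lQ.
have E2 : horner_eval a0 (lead_coef (dy Q)) != 0.
  by rewrite /horner_eval [lead_coef (dy Q)]lead_coefE sd.
have -> : (resultant Q (dy Q)).[a0] = resultant (fiber Q a0) (fiber (dy Q) a0).
  exact: (map_resultant E1 E2).
rewrite fiber_dy fQ resultant_coprimep; last first.
  by rewrite scaler_eq0 (negPf c0) /= monic_neq0 // monic_prod_XsubC.
rewrite derivZ coprimepZl // coprimepZr //.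
by have := separable_prod_XsubC ts; rewrite uts separable_poly.unlock.
Qed.

(** The Bertini step, with the pencil parameter as outer variable. A common factor m of Q and dQ/dx
    is prime to its cofactor, hence divides dm/dx; then m has a constant root c, so Q(c) = 0. *)
Lemma pencil_bezout Q : Q != 0 -> coprimep Q (dy Q) -> (forall c, Q.[c%:P] != 0) ->
  exists U V R, R != 0 /\ U * Q + V * dx Q = R%:P.
Proof.
move=> Q0 sep nroot; suff /Pdiv.Idomain.Bezout_coprimepP [[U V] /=] : coprimep Q (dx Q).
  rewrite -size_poly_eq1 => /eqP s1; exists U, V, (U * Q + V * dx Q)`_0.
  have E : U * Q + V * dx Q = ((U * Q + V * dx Q)`_0)%:P by apply: size1_polyC; rewrite s1.
  split=> //; apply: contra_eq_neq s1 => e; rewrite E e polyC0 size_poly0.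
  by [].
apply/coprimepP => m mQ mdx; rewrite -size_poly_eq1; apply: contraT => sm1.
have m0 : m != 0 by apply: contraTneq mQ => ->; rewrite dvd0p.
have sm : (1 < size m)%N by move: sm1 (size_poly_eq0 m); case: (size m) => [|[|]] //; rewrite (negPf m0).
have /Pdiv.Idomain.dvdpP [[k n] /= k0 E] := mQ.
have cop : coprimep m n.
  apply/coprimepP => e em en.
  have eQ : e %| Q by apply: dvdp_trans mQ.
  have edy : e %| dy Q.
    rewrite -(dvdpZr _ _ k0) /dy -derivZ E derivM.
    by apply: dvdp_add; [apply: dvdp_mull|apply: dvdp_mulr].
  by move/coprimepP: sep; apply.
have : m %| dx m * n.
  have -> : dx m * n = dx (k *: Q) - m * dx n by rewrite E dxM; ring.
  apply: dvdp_sub; last by apply: dvdp_mulr.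
  by rewrite -mul_polyC dxM dxC; apply: dvdp_add; apply: dvdp_mull.
rewrite Gauss_dvdpl // => /(dx_dvd_root m0 sm) [c mc].
have := congr1 (fun p : BB => p.[c%:P]) E; rewrite hornerZ hornerM mc mulr0 => /eqP.
by rewrite mulf_eq0 (negPf k0) (negPf (nroot c)).
Qed.

End Pencil.

(** * Degree of the image of a family *)

Section NonzeroPolynomialFunctions.
Variables (K : numClosedFieldType) (n : nat).
Implicit Types phi psi : 'rV[K]_n -> K.

Definition pfn phi := polyfun phi /\ exists v, phi v != 0.

Lemma pfnM phi psi : pfn phi -> pfn psi -> pfn (fun v => phi v * psi v).
Proof.
move=> [p1 [u pu]] [p2 [v pv]]; split; first exact: polyfunM.
have [t [h1 h2]] := polyfun_mul_neq0 p1 p2 pu pv.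
by eexists; rewrite mulf_neq0; [|exact: h1|exact: h2].
Qed.

Lemma pfn1 : pfn (fun _ => 1).
Proof. by split; [apply: polyfun_const|exists 0; rewrite oner_neq0]. Qed.

Lemma pfn_ext phi psi : phi =1 psi -> pfn phi -> pfn psi.
Proof. by move=> e [p [v pv]]; split; [apply: polyfun_ext e p|exists v; rewrite -e]. Qed.

Lemma pfn_prod (I : eqType) (s : seq I) (F : I -> 'rV[K]_n -> K) :
  (forall i, i \in s -> pfn (F i)) -> pfn (fun v => \prod_(i <- s) F i v).
Proof.
elim: s => [|i s IH] h; first by apply: pfn_ext pfn1 => v; rewrite big_nil.
apply: (@pfn_ext (fun v => F i v * \prod_(j <- s) F j v)) => [v|]; first by rewrite big_cons.
apply: pfnM; first by apply: h; rewrite mem_head.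
by apply: IH => j js; apply: h; rewrite inE js orbT.
Qed.

Lemma pfn_nz phi : pfn phi -> exists v, phi v != 0.
Proof. by case. Qed.

Lemma prod_seq_neq0 (I : eqType) (s : seq I) (F : I -> K) :
  \prod_(i <- s) F i != 0 -> forall i, i \in s -> F i != 0.
Proof.
by rewrite prodf_seq_neq0 => /allP h i /h.
Qed.

End NonzeroPolynomialFunctions.

Section Family.
Variable K : numClosedFieldType.
Local Notation BB := {poly {poly K}}.
Variables (f : BB) (d : nat).
Hypothesis hf : plane_curve f d.
Let mf := pc_monic hf.
Let sf := pc_size1 hf.
Variables (n : nat) (g : 'I_n.+1 -> BB).
Implicit Types (h k : 'rV[K]_n.+1) (a b c : K).

Definition comb h : BB := \sum_i cc (h 0 i) * g i.

Lemma ev2_comb h a b : ev2 (comb h) a b = dotp h (gv g a b).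
Proof. by rewrite ev2_sum; apply: eq_bigr => i _; rewrite ev2M ev2c mxE. Qed.

Lemma comb_line h k c : comb (h - c *: k) = comb h - cc c * comb k.
Proof.
rewrite /comb mulr_sumr -sumrB; apply: eq_bigr => i _.
by rewrite !mxE /cc !rmorphB !rmorphM /=; ring.
Qed.

Lemma Nm_cc c A : Nm f (cc c * A) = c ^+ d *: Nm f A.
Proof.
apply: (@poly_fun_inj _ _ _ 1); rewrite ?oner_neq0 // => a _; rewrite hornerZ.
have [bs sbs hbs] := fiber_ex a mf (pc_size hf); rewrite !(Nm_fiber _ mf sf hbs).
under eq_bigr do rewrite ev2M ev2c.
by rewrite big_split /= big_const_seq count_predT iter_mulr_1 sbs.
Qed.

Lemma combZ c h : comb (c *: h) = cc c * comb h.
Proof.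
by rewrite /comb mulr_sumr; apply: eq_bigr => i _; rewrite mxE /cc !rmorphM /= mulrA.
Qed.

Lemma polyfunP_Nm : polyfunP (fun h => Nm f (comb h)).
Proof.
apply: polyfunP_det => i j.
apply: (@polyfunP_ext _ _ (fun h => \sum_k h 0 k *: (horner_mx (cmx f) (g k) i j))) => [h|].
  rewrite /comb rmorph_sum summxE; apply: eq_bigr => k _.
  by rewrite rmorphM /= horner_mx_C -mulmxE mul_scalar_mx mxE mul_polyC.
by apply: polyfunP_sum => k _; apply: polyfunP_scalar; apply: polyfun_coord.
Qed.

(** Once reduced modulo [D], the polynomial takes at constants values that are multiples of [D] of
    smaller degree, hence zero; as K is infinite, it is the zero polynomial. *)
Lemma dvd_horner_span (Phi : BB) (D : {poly K}) : D != 0 ->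
  (forall c, D %| Phi.[c%:P]) -> forall q, D %| Phi.[q].
Proof.
move=> D0 h q; pose Psi := map_poly (fun p => p %% D) Phi.
have cPsi i : Psi`_i = Phi`_i %% D by rewrite coef_map_id0 ?mod0p.
have key w : D %| Phi.[w] - Psi.[w].
  rewrite -hornerN -hornerD horner_coef.
  apply: (big_rec (fun x => D %| x)) => [|i x _ hx]; first exact: dvdp0.
  apply: dvdp_add => //; apply: dvdp_mulr; rewrite coefD coefN cPsi.
  by rewrite {1}(divp_eq (Phi`_i) D) addrK dvdp_mulIr.
have Psi0 c : Psi.[c%:P] = 0.
  have dv : D %| Psi.[c%:P] by have := dvdp_sub (h c) (key c%:P); rewrite opprB addrC subrK.
  apply/eqP; apply: contraTT dv => nz; apply/negP => /(dvdp_leq nz); apply/negP.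
  rewrite -ltnNge horner_coef; apply: (@leq_ltn_trans (size D).-1); last first.
    by rewrite prednK // lt0n size_poly_eq0.
  apply: (big_ind (fun p : {poly K} => (size p <= (size D).-1)%N)).
  - by rewrite size_poly0.
  - by move=> x y hx hy; rewrite (leq_trans (size_polyD _ _)) // geq_max hx.
  move=> i _; rewrite -rmorphXn /= mulrC mul_polyC (leq_trans (size_scale_leq _ _)) // cPsi.
  by rewrite -ltnS prednK ?ltn_modp // lt0n size_poly_eq0.
have -> : Phi.[q] = Phi.[q] - Psi.[q]; last exact: key.
suff -> : Psi = 0 by rewrite horner0 subr0.
apply/polyP => i; apply/polyP => j; rewrite !coef0 -coef_swapXY.
suff -> : (swapXY Psi)`_j = 0 by rewrite coef0.
apply: poly_fun0 => c; rewrite -[LHS]/(horner_eval c _) -coef_map -horner_polyC.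
by rewrite Psi0 coef0.
Qed.

(** Passing from combinations over K to combinations over K[x] makes the common factor of the norms
    depend only on the module spanned by g. *)
Lemma Nm_span (D : {poly K}) : D != 0 -> (forall h, D %| Nm f (comb h)) ->
  forall q : 'I_n.+1 -> {poly K}, D %| Nm f (\sum_i (q i)%:P * g i).
Proof.
move=> D0 h q.
(* The coefficients q i are taken in a second variable: constants give members of the family, and
   the value x gives the wanted combination. *)
pose Phi : BB := \det (\sum_i (map_poly polyC (q i)) *: map_mx polyC (horner_mx (cmx f) (g i))).
have PhiE w : Phi.[w] = Nm f (\sum_i ((map_poly polyC (q i)).[w])%:P * g i).
  rewrite /Phi /Nm -[LHS]/(horner_eval w _) -det_map_mx; congr (\det _).
  apply/matrixP => i j; rewrite mxE summxE [in RHS]rmorph_sum summxE /= /horner_eval horner_sum.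
  apply: eq_bigr => k _; rewrite !mxE hornerM hornerC rmorphM /= horner_mx_C.
  by rewrite -mulmxE mul_scalar_mx mxE.
have -> : \sum_i (q i)%:P * g i = \sum_i ((map_poly polyC (q i)).['X])%:P * g i.
  by apply: eq_bigr => i _; rewrite -/('X \Po (q i)) -[in LHS](comp_polyXr (q i)).
rewrite -PhiE; apply: dvd_horner_span => // c; rewrite PhiE.
rewrite (_ : \sum_i _ = comb (\row_i (q i).[c])) //.
by apply: eq_bigr => i _; rewrite horner_map mxE.
Qed.

(** The greatest common divisor of an infinite family, as a common divisor of largest degree: a
    common root a of the quotients would make D (X - a) another one. *)
Lemma Nm_content : (exists h, ~ van f (comb h)) ->
  exists D, [/\ D != 0, forall h, D %| Nm f (comb h) &
    forall a, exists h, (Nm f (comb h) %/ D).[a] != 0].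
Proof.
move=> [h0 nv]; have N0 : Nm f (comb h0) != 0 by apply/eqP => /(Nm_eq0 hf).
pose P m := `[< exists D : {poly K}, size D = m /\ forall h, D %| Nm f (comb h) >].
have exP : exists m, P m by exists (size (1 : {poly K})); apply/asboolP; exists 1; split => [|h]; [reflexivity|exact: dvd1p].
have ubP m : P m -> (m <= size (Nm f (comb h0)))%N.
  by move=> /asboolP [D [<- hD]]; apply: dvdp_leq.
case: (ex_maxnP exP ubP) => m /asboolP [D [sD hD]] mmax.
have D0 : D != 0 by apply: contraTneq (hD h0) => ->; rewrite dvd0p.
exists D; split=> // a; apply: contrapT => /forallNP h.
have : P m.+1.
  apply/asboolP; exists (D * ('X - a%:P)); split; first by rewrite size_Mmonic ?monicXsubC // size_XsubC sD addn2.
  move=> k; rewrite -(divpK (hD k)) mulrC dvdp_mul // dvdp_XsubCl.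
  by rewrite /root; apply/negPn/negP; apply: h.
by move/mmax; rewrite ltnn.
Qed.

Lemma finite_fiber (s : {poly K}) : s != 0 ->
  finite_set [set p : K * K | ev2 f p.1 p.2 = 0 /\ s.[p.1] = 0].
Proof.
move=> s0; have [zs Ezs] := closed_field_poly_normal s.
have /choice [bs hbs] : forall a, exists bs, fiber_roots f a bs.
  by move=> a; have [bs _ hbs] := fiber_ex a mf (pc_size hf); exists bs.
apply: (@sub_finite_set _ _ [set p | p \in [seq (a, b) | a <- zs, b <- bs a]]).
  move=> [a b] /= [fab sa]; apply/allpairsPdep; exists a, b; split=> //.
    have /eqP : s.[a] == 0 by apply/eqP.
    by move/eqP; rewrite -[_ == 0]/(root s a) Ezs rootZ ?lead_coef_eq0 // root_prod_XsubC.
  by rewrite (fiber_rootsP _ (hbs a)) fab.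
exact: finite_seq.
Qed.

Lemma size_prod_le2 (I : Type) (s : seq I) (F : I -> {poly K}) :
  (forall i, (size (F i) <= 2)%N) -> (size (\prod_(i <- s) F i)%R <= (size s).+1)%N.
Proof.
move=> h; elim: s => [|i s IH]; first by rewrite big_nil size_poly1.
rewrite big_cons (leq_trans (size_polyMleq _ _)) //.
by have := leq_add (h i) IH; case: (_ + _)%N.
Qed.

Section Degree.
Variables (D : {poly K}) (N : nat).
Hypotheses (D0 : D != 0) (hD : forall h, D %| Nm f (comb h)).
Definition redN h := Nm f (comb h) %/ D.
Hypothesis noroot : forall a, exists h, (redN h).[a] != 0.
Hypothesis sizeN : forall h, (size (redN h) <= N.+1)%N.
Hypothesis topN : exists h, (redN h)`_N != 0.

Let redNE h : Nm f (comb h) = redN h * D.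
Proof. by rewrite /redN divpK. Qed.

Let polyfunP_redN : polyfunP redN.
Proof.
apply: (@polyfunP_divp _ _ _ (N.+1 + size D)) => [|h]; first exact: polyfunP_Nm.
rewrite redNE (leq_trans (size_polyMleq _ _)) // (leq_trans (leq_pred _)) //.
by rewrite leq_add2r.
Qed.

Let pfn_root a : pfn (fun h => (redN h).[a]).
Proof. by split; [apply: polyfunP_horner sizeN|apply: noroot]. Qed.

Let pfn_top : pfn (fun h => (redN h)`_N).
Proof. by split; [apply: polyfunP_redN|apply: topN]. Qed.

Lemma pfn_dotp (v : 'rV[K]_n.+1) : v != 0 -> pfn (fun h => dotp h v).
Proof.
move=> /rv_neq0P [i vi]; split.
  by apply: polyfun_sum => j _; apply: polyfunM; [apply: polyfun_coord|apply: polyfun_const].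
exists (delta_mx 0 i); rewrite /dotp (bigD1 i) //= mxE !eqxx mul1r big1 ?addr0 // => j ji.
by rewrite mxE (negPf ji) mul0r.
Qed.

Lemma pfn_cross (v w k : 'rV[K]_n.+1) : v != 0 -> w != 0 -> pt v <> pt w -> dotp k v != 0 ->
  pfn (fun h => dotp h v * dotp k w - dotp h w * dotp k v).
Proof.
move=> v0 w0 vw kv.
have nz : dotp k w *: v - dotp k v *: w != 0.
  apply: contra_notN vw; rewrite subr_eq0 => /eqP e.
  have := congr1 (fun u => (dotp k v)^-1 *: u) e; rewrite scalerA [RHS]scalerA mulVf // scale1r.
  have [c0|c0] := eqVneq ((dotp k v)^-1 * dotp k w) 0.
    by rewrite c0 scale0r => e'; rewrite -e' eqxx in w0.
  by move=> <-; rewrite ptZ.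
apply: pfn_ext (pfn_dotp nz) => h.
by rewrite ![dotp h _]dotpC dotpDl dotpZl -scaleNr dotpZl; ring.
Qed.

Variable r : {poly K}.
Hypothesis r0 : r != 0.
Hypothesis gv0 : forall a b, ev2 f a b = 0 -> r.[a] != 0 -> gv g a b != 0.
Hypothesis gv_inj : forall a b a' b', ev2 f a b = 0 -> r.[a] != 0 ->
  ev2 f a' b' = 0 -> r.[a'] != 0 -> pt (gv g a b) = pt (gv g a' b') -> a = a' /\ b = b'.

Lemma pencil_ex : exists h1 h2 a0 bs a1 b1,
  [/\ (forall a, (redN h1).[a] != 0 \/ (redN h2).[a] != 0) /\ (redN h1)`_N != 0,
      fiber_roots f a0 bs /\ uniq bs, ev2 f a1 b1 = 0 /\ dotp h2 (gv g a1 b1) != 0,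
      {in bs, forall b, dotp h2 (gv g a0 b) != 0} /\
      {in bs &, injective (fun b => dotp h1 (gv g a0 b) / dotp h2 (gv g a0 b))} &
      {in bs, forall b, dotp h1 (gv g a0 b) / dotp h2 (gv g a0 b) !=
         dotp h1 (gv g a1 b1) / dotp h2 (gv g a1 b1)}].
Proof.
have [rs rs0 hrs] := pc_separable hf.
have [a0] : exists a, (r * rs).[a] != 0 by apply: poly_nonroot; rewrite mulf_neq0.
rewrite hornerM mulf_eq0 negb_or => /andP[ra0 rsa0].
have [a1] : exists a, (r * ('X - a0%:P)).[a] != 0.
  by apply: poly_nonroot; rewrite mulf_neq0 // polyXsubC_eq0.
rewrite hornerM hornerXsubC mulf_eq0 negb_or => /andP[ra1 a10].
have [bs sbs hbs] := fiber_ex a0 mf (pc_size hf); have ubs := hrs _ _ rsa0 hbs.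
have [b1 fb1] := pc_point hf a1.
have fbs b : b \in bs -> ev2 f a0 b = 0 by rewrite (fiber_rootsP _ hbs) => /eqP.
pose L := (a1, b1) :: [seq (a0, b) | b <- bs].
have LP p : p \in L -> ev2 f p.1 p.2 = 0 /\ r.[p.1] != 0.
  by rewrite inE => /orP[/eqP->//|/mapP [b /fbs fb ->]].
have gL p : p \in L -> gv g p.1 p.2 != 0 by move=> /LP [fp rp]; apply: gv0.
have neqL p q : p \in L -> q \in L -> p <> q -> pt (gv g p.1 p.2) <> pt (gv g q.1 q.2).
  move=> /LP [fp rp] /LP [fq rq] pq e; apply: pq.
  have [e1 e2] := gv_inj fp rp fq rq e; by rewrite [p]surjective_pairing [q]surjective_pairing e1 e2.
(* h2 is fixed first; h1 must then avoid the roots of the reduced norm of h2 and give distinct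
   ratios at the points of [L]. *)
have [h2] : exists h2, \prod_(p <- L) dotp h2 (gv g p.1 p.2) * (redN h2)`_N != 0.
  by apply: pfn_nz; apply: pfnM => //; apply: pfn_prod => p /gL; apply: pfn_dotp.
rewrite mulf_eq0 negb_or => /andP[/prod_seq_neq0 h2L h2N].
have [zs Ezs] := closed_field_poly_normal (redN h2).
have redN2 : redN h2 != 0 by apply: contraNneq h2N => ->; rewrite coef0.
pose L2 := [seq pq <- [seq (p, q) | p <- L, q <- L] | pq.1 != pq.2].
have L2P pq : pq \in L2 -> [/\ pq.1 \in L, pq.2 \in L & pq.1 <> pq.2].
  by rewrite mem_filter => /andP[/eqP ne /allpairsP [[p q] /= [pL qL e]]]; rewrite e in ne *.
pose Xp pq h := dotp h (gv g pq.1.1 pq.1.2) * dotp h2 (gv g pq.2.1 pq.2.2)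
              - dotp h (gv g pq.2.1 pq.2.2) * dotp h2 (gv g pq.1.1 pq.1.2).
have [h1] : exists h1, \prod_(pq <- L2) Xp pq h1 * (\prod_(a <- zs) (redN h1).[a] * (redN h1)`_N) != 0.
  apply: pfn_nz; apply: pfnM.
    apply: pfn_prod => pq /L2P [pL qL ne]; apply: pfn_cross; [exact: gL|exact: gL|exact: neqL|].
    exact: h2L.
  by apply: pfnM => //; apply: pfn_prod => a _.
rewrite !mulf_eq0 !negb_or => /and3P[/prod_seq_neq0 h1L /prod_seq_neq0 h1z h1N].
have sepL p q : p \in L -> q \in L -> p != q ->
    dotp h1 (gv g p.1 p.2) / dotp h2 (gv g p.1 p.2) != dotp h1 (gv g q.1 q.2) / dotp h2 (gv g q.1 q.2).
  move=> pL qL pq; rewrite eqr_div ?h2L // -subr_eq0.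
  by apply: (h1L (p, q)); rewrite mem_filter pq; apply/allpairsP; exists (p, q).
have inL b : b \in bs -> (a0, b) \in L.
  by move=> bbs; rewrite inE; apply/orP; right; apply/mapP; exists b.
have L1 : (a1, b1) \in L by apply: mem_head.
exists h1, h2, a0, bs, a1, b1; split=> //.
- split=> // a; have [za|za] := eqVneq (redN h2).[a] 0; last by right.
  left; apply: h1z; move/eqP: za; rewrite -/(root _ a) Ezs rootZ ?lead_coef_eq0 //.
  by rewrite root_prod_XsubC.
- by split=> //; apply: (h2L (a1, b1)).
- split=> [b /inL bL|b b' /inL bL /inL b'L e]; first exact: (h2L _ bL).
  apply/eqP; apply: contraT => bb'.
  have pq : (a0, b) != (a0, b') by apply: contraNneq bb' => -[->].
  by have := sepL _ _ bL b'L pq; rewrite /= e eqxx.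
move=> b /inL bL; apply: (sepL _ _ bL L1).
by apply: contraNneq a10 => -[<- _]; rewrite subrr.
Qed.

(** One member whose reduced norm has only simple roots is enough, and it is found in the pencil of
    [pencil_ex]. *)
Lemma pfn_syl : pfn (fun h => syl N (redN h)).
Proof.
split; first exact: polyfun_syl.
have [h1 [h2 [a0 [bs [a1 [b1 [[nr h1N] [hbs ubs] [fb1 h2b1] [h2bs inj] ne]]]]]]] := pencil_ex.
pose A k := horner_mx (cmx f) (comb k).
(* The norm of h1 - t h2, with outer variable t and inner variable x. *)
pose Q : BB := \det (map_mx polyC (A h1) - 'X *: map_mx polyC (A h2)).
have QE t : Q.[t%:P] = Nm f (comb (h1 - t *: h2)).
  rewrite comb_line /Q /Nm -[LHS]/(horner_eval t%:P _) -det_map_mx; congr (\det _).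
  apply/matrixP => i j; rewrite [in RHS]rmorphB [in RHS]rmorphM /= horner_mx_C -mulmxE mul_scalar_mx !mxE /=.
  by rewrite /horner_eval !hornerE.
have Qev t a bb : fiber_roots f a bb -> ev2 Q a t =
    \prod_(b <- bb) (dotp h1 (gv g a b) - t * dotp h2 (gv g a b)).
  move=> hbb; rewrite /ev2 QE (Nm_fiber _ mf sf hbb); apply: eq_bigr => b _.
  by rewrite comb_line ev2B ev2M ev2c !ev2_comb.
have sbs : size bs = d.
  have : size (fiber f a0) = d.+1.
    by rewrite size_map_poly_id0 ?(pc_size hf) // (eqP mf) rmorph1 oner_neq0.
  by rewrite hbs size_prod_XsubC => -[].
(* Over each a, [Q] is a product of d factors of degree at most 1 in t. *)
have sQ : (size Q <= d.+1)%N.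
  apply/leq_sizeP => j dj; apply: poly_fun0 => a; rewrite -coef_fiber.
  have [bb sbb hbb] := fiber_ex a mf (pc_size hf).
  have -> : fiber Q a = \prod_(b <- bb) ((dotp h1 (gv g a b))%:P - dotp h2 (gv g a b) *: 'X).
    apply: (@poly_fun_inj _ _ _ 1); rewrite ?oner_neq0 // => t _.
    rewrite fiberE (Qev _ _ _ hbb) horner_prod; apply: eq_bigr => b _.
    by rewrite !hornerE mulrC.
  apply: nth_default; apply: leq_trans dj; rewrite -sbb; apply: size_prod_le2 => b.
  by rewrite (leq_trans (size_polyD _ _)) // geq_max size_polyN (leq_trans (size_scale_leq _ _))
    ?size_polyX // (leq_trans (size_polyC_leq1 _)).
pose ts := [seq dotp h1 (gv g a0 b) / dotp h2 (gv g a0 b) | b <- bs].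
pose c := \prod_(b <- bs) - dotp h2 (gv g a0 b).
have c0 : c != 0.
  by rewrite prodf_seq_neq0; apply/allP => b /h2bs /=; rewrite oppr_eq0.
have fQ : fiber Q a0 = c *: \prod_(t <- ts) ('X - t%:P).
  apply: (@poly_fun_inj _ _ _ 1); rewrite ?oner_neq0 // => t _.
  rewrite fiberE (Qev _ _ _ hbs) hornerZ horner_prod big_map -big_split big_seq [RHS]big_seq.
  by apply: eq_bigr => b /h2bs b0 /=; rewrite !hornerE; field.
have uts : uniq ts by rewrite map_inj_in_uniq.
have sts : size ts = d by rewrite size_map.
have {}sQ : size Q = (size ts).+1.
  apply/eqP; rewrite eqn_leq sts sQ /= -[X in (X <= _)%N](_ : size (fiber Q a0) = _).
    exact: size_poly.
  by rewrite fQ size_scale // size_prod_XsubC sts.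
have Q0 : Q != 0 by rewrite -size_poly_eq0 sQ.
have sep := pencil_separable c0 uts (_ : 0 < size ts)%N sQ fQ.
have {}sep : coprimep Q (dy Q) by apply: sep; rewrite sts (pc_gt0 hf).
have nroot t : Q.[t%:P] != 0.
  rewrite QE; apply/eqP => /(Nm_eq0 hf) vn.
  have [b0 b0s] : exists b0, b0 \in bs.
    case: (bs) sbs => [e|b0 bs' _]; last by exists b0; apply: mem_head.
    by have := pc_gt0 hf; rewrite -e.
  have tE a b : ev2 f a b = 0 -> dotp h2 (gv g a b) != 0 ->
      dotp h1 (gv g a b) / dotp h2 (gv g a b) = t.
    move=> fab h2ab; have /eqP := vn a b fab.
    by rewrite comb_line ev2B ev2M ev2c !ev2_comb subr_eq0 => /eqP ->; rewrite mulfK.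
  have fb0 : ev2 f a0 b0 = 0 by apply/eqP; rewrite -(fiber_rootsP _ hbs).
  by have := ne b0 b0s; rewrite !tE ?eqxx // h2bs.
have [U [V [R [R0 BZ]]]] := pencil_bezout Q0 sep nroot.
have redNZ e h : redN (e *: h) = e ^+ d *: redN h by rewrite /redN combZ Nm_cc divpZl.
(* For fixed a not all members have the root a: it is missing for h1 or for h2, and h2 is the member
   at t = infinity. *)
have line a : exists2 q : {poly K}, q != 0 & forall t, (redN (h1 - t *: h2)).[a] = q.[t].
  have [q hq] := polyfun_line h1 (- h2) (pfn_root a).1.
  have {}hq t : (redN (h1 - t *: h2)).[a] = q.[t] by rewrite -hq scalerN.
  exists q => //; have [h1a|h2a] := nr a.
    by apply: contraNneq h1a => q0; have := hq 0; rewrite scale0r subr0 q0 horner0 => ->.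
  have [q' hq'] := polyfun_line h2 (- h1) (pfn_root a).1.
  have q'0 : q' != 0.
    by apply: contraNneq h2a => q0; have := hq' 0; rewrite scale0r addr0 q0 horner0 => ->.
  have [w] : exists w, ('X * q').[w] != 0 by apply: poly_nonroot; rewrite mulf_neq0 ?polyX_eq0.
  rewrite hornerM hornerX mulf_eq0 negb_or => /andP[w0 q'w].
  apply: contraNneq q'w => q0; rewrite -hq'.
  have -> : h2 + w *: - h1 = (- w) *: (h1 - w^-1 *: h2).
    by rewrite scalerBr scalerA mulNr mulfV // !scaleNr scale1r opprK scalerN addrC.
  by rewrite redNZ hornerZ hq q0 horner0 mulr0.
(* A multiple root in x is a common zero of Q and dQ/dx, hence a root of R; a general t keeps the
   reduced norm nonzero at these finitely many points. *)
have [zs Ezs] := closed_field_poly_normal (R * D).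
have [q q0 hq] : exists2 q : {poly K}, q != 0 &
    forall t, q.[t] != 0 -> forall a, a \in zs -> (redN (h1 - t *: h2)).[a] != 0.
  elim: (zs) => [|a s [q q0 IH]]; first by exists 1; rewrite ?oner_neq0.
  have [q2 q20 hq2] := line a; exists (q2 * q); first by rewrite mulf_neq0.
  move=> t; rewrite hornerM mulf_eq0 negb_or => /andP[q2t qt] a'.
  by rewrite inE => /predU1P[->|/(IH t qt)//]; rewrite hq2.
have [qN hqN] := polyfun_line h1 (- h2) pfn_top.1.
have qN0 : qN != 0.
  by apply: contraNneq h1N => e; have := hqN 0; rewrite scale0r addr0 e horner0 => ->.
have [t] : exists t, (q * qN).[t] != 0 by apply: poly_nonroot; rewrite mulf_neq0.
rewrite hornerM mulf_eq0 negb_or => /andP[/hq hz]; rewrite -hqN scalerN => hN.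
exists (h1 - t *: h2); set h := h1 - t *: h2 in hz hN *.
apply: syl_neq0.
  apply/eqP; rewrite eqn_leq sizeN ltnNge; apply: contra hN => sN.
  by rewrite nth_default.
move=> a Pa P'a; have Qa : Q.[t%:P].[a] = 0 by rewrite QE redNE hornerM Pa mul0r.
have Qxa : (dx Q).[t%:P].[a] = 0.
  by rewrite horner_dx QE redNE derivM hornerD !hornerM Pa P'a; ring.
have := congr1 (fun B => ev2 B a t) BZ; rewrite ev2D !ev2M ev2C.
rewrite [ev2 Q a t]Qa [ev2 (dx Q) a t]Qxa !mulr0 addr0 => Ra.
have /hz : a \in zs.
  have : root (R * D) a by rewrite /root hornerM -Ra mul0r.
  by rewrite Ezs rootZ ?lead_coef_eq0 ?mulf_neq0 // root_prod_XsubC.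
by rewrite Pa eqxx.
Qed.

Variable V : set (projspace K n).
Hypothesis imV : forall a b, ev2 f a b = 0 -> r.[a] != 0 -> V (pt (gv g a b)).
Hypothesis finV : finite_set [set u | V u /\
  ~ exists a b, [/\ ev2 f a b = 0, r.[a] != 0 & u = pt (gv g a b)]].

(** The points of V outside the image or over roots of r D are finite in number and avoided by a
    general hyperplane. The other points of the section correspond to the N simple roots of the
    reduced norm, with exactly one point over each. *)
Lemma degree_family : degree V = N.
Proof.
pose s := r * D; have s0 : s != 0 by rewrite mulf_neq0.
pose Ex := [set u | V u /\ ~ exists a b, [/\ ev2 f a b = 0, s.[a] != 0 & u = pt (gv g a b)]].
have finEx : finite_set Ex.
  pose Sp := [set u | exists a b, [/\ ev2 f a b = 0, s.[a] = 0 & u = pt (gv g a b)]].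
  apply: (@sub_finite_set _ _ ([set u | V u /\
    ~ exists a b, [/\ ev2 f a b = 0, r.[a] != 0 & u = pt (gv g a b)]] `|` Sp)).
    move=> u [Vu nu]; have [[a [b [fab ra e]]]|] := pselect (exists a b,
      [/\ ev2 f a b = 0, r.[a] != 0 & u = pt (gv g a b)]); last by left.
    right; exists a, b; split=> //; apply/eqP/negPn/negP => sa.
    by apply: nu; exists a, b.
  rewrite finite_setU; split=> //.
  apply: (sub_finite_set _ (finite_image (fun p => pt (gv g p.1 p.2)) (finite_fiber s0))).
  by move=> u [a [b [fab sa ->]]]; exists (a, b).
have [E EE] := (@finite_seqP {W : {vspace 'rV[K]_n.+1} | \dim W == 1%N} Ex).1 finEx.
have [zs Ezs] := closed_field_poly_normal s.
have zsP a : (a \in zs) = (s.[a] == 0).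
  by rewrite -[_ == 0]/(root s a) Ezs rootZ ?lead_coef_eq0 // root_prod_XsubC.
(* The conditions on the hyperplane: no zero over the roots of s, no exceptional point, N roots, all
   of them simple. *)
pose Delta h := \prod_(a <- zs) (redN h).[a] *
  (\prod_(u <- E) dotp h (coords (u : projspace K n)) * ((redN h)`_N * syl N (redN h))).
have pD : pfn Delta.
  apply: pfnM; first by apply: pfn_prod => a _.
  apply: pfnM; last by apply: pfnM => //; apply: pfn_syl.
  by apply: pfn_prod => u _; apply: pfn_dotp; apply: coords_neq0.
have [v Dv] := pD.2; have [U [oU nU hU]] := zopen_polyfun pD.1 Dv.
apply: (degree_eq oU nU) => h /hU [c []]; set k := c *: coords h => Dk c0.
move: Dk; rewrite /Delta !mulf_eq0 !negb_or => /and4P[/prod_seq_neq0 kz /prod_seq_neq0 kE kN ks].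
have HP u : hyperplane h u <-> dotp k (coords u) = 0.
  rewrite /hyperplane /= /pairing -/(dotp (coords h) (coords u)) /k dotpZl.
  by split=> [->|/eqP]; [rewrite mulr0|rewrite mulf_eq0 (negPf c0) => /eqP].
have kP a b : gv g a b != 0 -> hyperplane h (pt (gv g a b)) <-> dotp k (gv g a b) = 0.
  move=> /coords_pt [e e0 Ee]; rewrite HP Ee dotpZr.
  by split=> [/eqP|->]; [rewrite mulf_eq0 (negPf e0) => /eqP|rewrite mulr0].
have [ss Ess] := closed_field_poly_normal (redN k).
have k0 : redN k != 0 by apply: contraNneq kN => ->; rewrite coef0.
have ssP a : (a \in ss) = ((redN k).[a] == 0).
  by rewrite -[_ == 0]/(root (redN k) a) Ess rootZ ?lead_coef_eq0 // root_prod_XsubC.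
have szk : size (redN k) = N.+1.
  apply/eqP; rewrite eqn_leq sizeN ltnNge; apply: contra kN => sN.
  by rewrite nth_default.
have sss : size ss = N.
  by move: szk; rewrite Ess size_scale ?lead_coef_eq0 // size_prod_XsubC => -[].
have nd a : (redN k).[a] = 0 -> (redN k)^`().[a] = 0 -> False.
  exact: (syl_noroot (sizeN k) kN ks).
have uss : uniq ss.
  rewrite -separable_prod_XsubC separable_poly.unlock.
  have l0 : lead_coef (redN k) != 0 by rewrite lead_coef_eq0.
  rewrite -(coprimepZl _ _ l0) -(coprimepZr _ _ l0) -derivZ -Ess.
  rewrite /coprimep; apply/negPn/negP => /closed_rootP [a].
  by rewrite root_gcd => /andP[/eqP pa /eqP p'a]; apply: (nd a).
have ssz a : a \in ss -> s.[a] != 0.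
  by rewrite ssP -zsP => ra; apply: contraTN ra => /kz.
have rsz a : s.[a] != 0 -> r.[a] != 0.
  by rewrite /s hornerM mulf_eq0 negb_or => /andP[].
have Dsz a : s.[a] != 0 -> D.[a] != 0.
  by rewrite /s hornerM mulf_eq0 negb_or => /andP[].
have /choice [be hbe] : forall a, exists b, ev2 f a b = 0 /\ (a \in ss -> dotp k (gv g a b) = 0).
  move=> a; have [ass|_] := boolP (a \in ss); last first.
    by have [b fb] := pc_point hf a; exists b.
  have : (Nm f (comb k)).[a] = 0.
    by move: ass; rewrite ssP redNE hornerM => /eqP ->; rewrite mul0r.
  by move/(Nm_root hf) => [b [fb kb]]; exists b; split=> // _; rewrite -ev2_comb.
pose F i := pt (gv g ss`_i (be ss`_i)).
have inss i : (i < N)%N -> ss`_i \in ss by move=> iN; rewrite mem_nth // sss.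
have -> : V `&` hyperplane h = F @` `I_N.
  apply/seteqP; split=> u; last first.
    case=> i /= /inss is_ <-; have [fb /(_ is_) kb] := hbe ss`_i.
    have sa := rsz _ (ssz _ is_).
    by split; [apply: imV|apply/kP => //; apply: gv0].
  move=> [Vu hu]; have [a [b [fab sa e]]] : exists a b, [/\ ev2 f a b = 0, s.[a] != 0 & u = pt (gv g a b)].
    apply: contrapT => nu; have : Ex u by [].
    rewrite EE => /= /kE; rewrite (HP u).1 // => /eqP; apply; reflexivity.
  have g0 := gv0 fab (rsz _ sa).
  have kab : dotp k (gv g a b) = 0 by apply/kP => //; rewrite -e.
  have ass : a \in ss.
    have : (Nm f (comb k)).[a] = 0 by apply/(Nm_root hf); exists b; rewrite ev2_comb.
    by rewrite redNE hornerM => /eqP; rewrite mulf_eq0 (negPf (Dsz a sa)) orbF -ssP.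
  exists (index a ss); first by rewrite /= -sss index_mem.
  rewrite /F nth_index // e; have [fb' /(_ ass) kb'] := hbe a.
  suff -> : be a = b by [].
  apply/eqP; apply: contraT => nb.
  (* Two zeros over the same a would give a double root of the norm, and of its quotient by [D]
     since D(a) is nonzero. *)
  have : ('X - a%:P) ^+ 2 %| redN k * D.
    by rewrite -redNE; apply: (Nm_double_zero mf nb); rewrite ?ev2_comb.
  rewrite Gauss_dvdpl; last first.
    by rewrite coprimep_expl // coprimep_sym coprimep_XsubC /root Dsz.
  move=> /dvdpP [q Eq]; case: (nd a).
    by rewrite Eq hornerM horner_exp hornerXsubC subrr expr0n mulr0.
  by rewrite Eq expr2 !derivM !(hornerXsubC, hornerM, hornerD) subrr !(mul0r, mulr0, addr0).
apply: inj_card_eq => i j; rewrite !inE /= => iN jN e.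
have [ai aj] := (inss _ iN, inss _ jN).
have [fi _] := hbe ss`_i; have [fj _] := hbe ss`_j.
have [e' _] := gv_inj fi (rsz _ (ssz _ ai)) fj (rsz _ (ssz _ aj)) e.
by apply/eqP; rewrite -(nth_uniq 0 _ _ uss) ?sss // e'.
Qed.

End Degree.
End Family.

(** * Closure of an image *)

Lemma rV_neq0_coord (K : fieldType) m (v : 'rV[K]_m) : v != 0 -> exists i, v 0 i != 0.
Proof.
move=> v0; apply/existsP; apply: contraNT v0; rewrite negb_exists => /forallP h.
by apply/eqP/rowP => i; rewrite mxE; apply/eqP; have := h i; rewrite negbK.
Qed.

Section AlgebraicDependence.
Variable K : numClosedFieldType.
Local Notation BB := {poly {poly K}}.
Variables (f : BB) (d : nat).
Hypothesis hf : plane_curve f d.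

(** Euclidean division in y: f is monic in y with y-degree equal to its total degree, so no step
    raises the total degree. *)
Lemma tdeg_mod T (A : BB) : tdeg T A ->
  exists A' : BB, [/\ (size A' <= d)%N, tdeg T A' & van f (A - A')].
Proof.
have [m] := ubnP (size A); elim: m => // m IH in A *; rewrite ltnS => sA hA.
have [sd|sd] := leqP (size A) d.
  by exists A; split=> // a b _; rewrite subrr ev2_0.
have A0 : A != 0 by apply: contraTneq sd => ->; rewrite size_poly0.
have sAE : size A = (size A).-1.+1 by rewrite prednK // (leq_ltn_trans _ sd).
set l := lead_coef A; pose B : BB := l *: 'X^((size A).-1 - d).
have dA : (d <= (size A).-1)%N by rewrite -ltnS -sAE.
have dT : (d <= T)%N.
  have /hA : A`_(size A).-1`_(size l).-1 != 0.
    by rewrite -lead_coefE -/l -lead_coefE lead_coef_eq0 lead_coef_eq0.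
  by move=> /(leq_trans (leq_addl _ _)); apply: leq_trans.
have tB : tdeg (T - d) B.
  move=> i j; rewrite coefZ coefXn; have [->|_] := eqVneq j; last by rewrite mulr0 coef0 eqxx.
  rewrite mulr1 /l lead_coefE => /hA h.
  by rewrite addnBA // leq_sub2r.
pose A1 := A - B * f.
have tA1 : tdeg T A1.
  apply: tdegD => // i j; rewrite coefN coefN oppr_eq0.
  by move: i j; rewrite -(subnK dT); apply: tdegM => //; apply: (pc_tdeg hf).
have sB : size (B * f) = size A.
  rewrite size_Mmonic ?(pc_monic hf) //; last first.
    by rewrite -size_poly_eq0 /B size_scale ?lead_coef_eq0 // size_polyXn.
  by rewrite /B size_scale ?lead_coef_eq0 // size_polyXn (pc_size hf) addSn /= addnS subnK.
have sA1 : (size A1 < size A)%N.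
  rewrite [X in (_ < X)%N]sAE ltnS; apply/leq_sizeP => j; rewrite leq_eqVlt => /predU1P[<-|lj].
    rewrite coefB -lead_coefE -sB -lead_coefE lead_coef_Mmonic ?(pc_monic hf) //.
    by rewrite /B lead_coefZ lead_coefXn mulr1 subrr.
  have jA : (size A <= j)%N by rewrite sAE.
  by rewrite coefB !nth_default ?subrr ?sB.
have [A' [h1 h2 h3]] := IH A1 (leq_trans sA1 sA) tA1.
exists A'; split=> // a b fab; have := h3 a b fab.
by rewrite /A1 !ev2B ev2M fab mulr0 subr0.
Qed.

(** A dimension count: monomials of degree N in u0, u1, u2 reduce modulo f into a space whose
    dimension grows only linearly in m, while there are m^2 of them. *)
Lemma alg_dep (u0 u1 u2 : BB) : exists2 R : BB, R != 0 &
  forall a b, ev2 f a b = 0 -> ev2 u0 a b != 0 ->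
    ev2 R (ev2 u1 a b / ev2 u0 a b) (ev2 u2 a b / ev2 u0 a b) = 0.
Proof.
have [c0 h0] := tdeg_ex u0; have [c1 h1] := tdeg_ex u1; have [c2 h2] := tdeg_ex u2.
pose c := (c0 + c1 + c2)%N.
have {}h0 : tdeg c u0 by apply: tdeg_leq h0; rewrite /c -addnA leq_addr.
have {}h1 : tdeg c u1 by apply: tdeg_leq h1; rewrite /c addnAC leq_addl.
have {}h2 : tdeg c u2 by apply: tdeg_leq h2; rewrite /c leq_addl.
(* Two exponents below m add up to less than N = 2 m, and m^2 exceeds the dimension d (T + 1) = 2 c
   d m + d. *)
pose m := (2 * c * d + d).+1; pose N := (2 * m)%N; pose T := (c * N)%N.
pose mon (p : 'I_m * 'I_m) := u0 ^+ (N - p.1 - p.2) * u1 ^+ p.1 * u2 ^+ p.2.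
have pN (p : 'I_m * 'I_m) : (p.1 + p.2 <= N)%N.
  by have := ltn_ord p.1; have := ltn_ord p.2; rewrite /N; lia.
have tmon p : tdeg T (mon p).
  have -> : T = (c * (N - p.1 - p.2) + c * p.1 + c * p.2)%N.
    by rewrite -!mulnDr /T; congr muln; have := pN p; lia.
  by apply: tdegM; [apply: tdegM|]; apply: tdeg_exp.
have /choice [red hred] := fun p => tdeg_mod (tmon p).
pose I : finType := ('I_m * 'I_m)%type; pose J : finType := ('I_d * 'I_T.+1)%type.
pose M : 'M[K]_(#|I|, #|J|) := \matrix_(p < #|I|, q < #|J|)
  (red (enum_val p))`_((enum_val q).1)`_((enum_val q).2).
have ltJI : (#|J| < #|I|)%N.
  rewrite !card_prod !card_ord /T /N /m; nia.
have : kermx M != 0.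
  rewrite -mxrank_eq0 mxrank_ker subn_eq0 -ltnNge.
  exact: leq_ltn_trans (rank_leq_col M) ltJI.
move=> /rowV0Pn [v /sub_kermxP vM v0].
pose w (i j : nat) : K := v 0 (enum_rank ((inord i, inord j) : I)).
pose R : BB := \poly_(j < m) \poly_(i < m) w i j.
exists R.
  have [p vp] := rV_neq0_coord v0; set ij := enum_val p.
  apply/eqP => R0; have := congr1 (fun P : BB => P`_ij.2`_ij.1) R0.
  rewrite /R coef_poly ltn_ord coef_poly ltn_ord !coef0 /w !inord_val -surjective_pairing.
  by rewrite enum_valK => /eqP; rewrite (negPf vp).
move=> a b fab u00; set t1 := ev2 u1 a b / _; set t2 := ev2 u2 a b / _.
rewrite {1}/ev2 horner_poly horner_sum.
have E : \sum_p v 0 p * ev2 (mon (enum_val p)) a b = 0.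
  transitivity (ev2 (\sum_p cc (v 0 p) * red (enum_val p)) a b).
    rewrite ev2_sum; apply: eq_bigr => p _; rewrite ev2M ev2c; congr (_ * _).
    by have [_ _ /(_ a b fab)] := hred (enum_val p); rewrite ev2B => /subr0_eq.
  suff -> : \sum_p cc (v 0 p) * red (enum_val p) = 0 by rewrite ev2_0.
  apply/polyP => j; apply/polyP => i; rewrite !coef0 coef_sum coef_sum.
  have [jd|dj] := ltnP j d; last first.
    apply: big1 => p _; rewrite coefCM; have [s1 _ _] := hred (enum_val p).
    by rewrite (nth_default _ (leq_trans s1 dj)) mulr0 coef0.
  have [iT|Ti] := ltnP i T.+1; last first.
    apply: big1 => p _; rewrite coefCM coefCM; have [_ hT _] := hred (enum_val p).
    have [->|/hT] := eqVneq ((red (enum_val p))`_j)`_i 0; first by rewrite mulr0.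
    by move=> /(leq_trans (leq_addr _ _)); rewrite leqNgt Ti.
  have := congr1 (fun X : 'rV_#|J| => X 0 (enum_rank ((Ordinal jd, Ordinal iT) : J))) vM.
  rewrite !mxE => e; rewrite -[RHS]e; apply: eq_bigr => p _.
  by rewrite !mxE enum_rankK coefCM coefCM.
have {}E : \sum_(p : I) v 0 (enum_rank p) * ev2 (mon p) a b = 0.
  rewrite -[RHS]E [RHS](reindex (@enum_rank I)) /=.
    by apply: eq_bigr => p _; rewrite enum_rankK.
  by exists enum_val => p _; rewrite ?enum_rankK ?enum_valK.
have {}E : \sum_(p : I) v 0 (enum_rank p) * (t1 ^+ p.1 * t2 ^+ p.2) = 0.
  have u0N : ev2 u0 a b ^+ N != 0 by rewrite expf_neq0.
  apply: (mulfI u0N); rewrite mulr0 -[RHS]E mulr_sumr; apply: eq_bigr => p _.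
  rewrite /mon !ev2M !ev2_exp /t1 /t2 !expr_div_n.
  have -> : ev2 u0 a b ^+ N = ev2 u0 a b ^+ (N - p.1 - p.2) * ev2 u0 a b ^+ p.1 * ev2 u0 a b ^+ p.2.
    by rewrite -!exprD -addnA -subnDA subnK // pN.
  by field; rewrite !expf_neq0.
rewrite -[RHS]E (eq_bigr (fun p : I => v 0 (enum_rank (p.1, p.2)) * (t1 ^+ p.1 * t2 ^+ p.2))); last by case.
rewrite -(pair_bigA _ (fun i j : 'I_m => v 0 (enum_rank ((i, j) : I)) * (t1 ^+ i * t2 ^+ j))) /=.
rewrite exchange_big /=; apply: eq_bigr => j _.
rewrite hornerM horner_exp hornerC horner_poly mulr_suml; apply: eq_bigr => i _.
by rewrite /w !inord_val mulrA.
Qed.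

End AlgebraicDependence.

Section ClosureOfImage.
Variable K : numClosedFieldType.
Local Notation BB := {poly {poly K}}.
Variables (f : BB) (d : nat).
Hypothesis hf : plane_curve f d.
Variables (n : nat) (g : 'I_n.+1 -> BB).

Definition im (q : {poly K}) : set (projspace K n) :=
  [set u | exists a b, [/\ ev2 f a b = 0, q.[a] != 0 & u = pt (gv g a b)]].

Variable q : {poly K}.
Hypothesis q0 : q != 0.
Hypothesis gv0 : forall a b, ev2 f a b = 0 -> q.[a] != 0 -> gv g a b != 0.

Lemma tdeg_top (R : BB) : R != 0 -> exists N, tdeg N R /\ exists2 j, (j <= N)%N & R`_j`_(N - j) != 0.
Proof.
move=> R0; have [M hM] := tdeg_ex R.
pose P m := [exists j : 'I_m.+1, R`_j`_(m - j) != 0].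
have PE i j : R`_j`_i != 0 -> P (i + j)%N.
  by move=> h; apply/existsP; exists (Ordinal (leq_addl i j : (j < (i + j).+1)%N)); rewrite /= addnK.
have exP : exists m, P m.
  have : R`_(size R).-1`_(size (lead_coef R)).-1 != 0.
    by rewrite -lead_coefE -lead_coefE !lead_coef_eq0.
  by move/PE; eexists; eassumption.
have ubP m : P m -> (m <= M)%N.
  by move=> /existsP [j /hM]; rewrite subnK // -ltnS.
case: (ex_maxnP exP ubP) => N /existsP [j hj] Nmax; exists N; split.
  by move=> i k /PE /Nmax.
by exists j => //; rewrite -ltnS.
Qed.

Lemma finite_box (Z : 'I_n.+1 -> 'I_n.+1 -> seq K) :
  finite_set [set u : projspace K n | exists v i, [/\ u = pt v & forall j, v 0 j \in Z i j]].
Proof.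
pose M := (\max_(i : 'I_n.+1) \max_(j : 'I_n.+1) size (Z i j)).
pose F (p : 'I_n.+1 * {ffun 'I_n.+1 -> 'I_M.+1}) : projspace K n :=
  pt (\row_j (Z p.1 j)`_(p.2 j)).
apply: (@sub_finite_set _ _ (F @` setT)); last by apply: finite_image; apply: finite_finset.
move=> u [v [i [-> hv]]]; exists (i, [ffun j => inord (index (v 0 j) (Z i j))]) => //.
rewrite /F /=; congr pt; apply/rowP => j; rewrite mxE ffunE inordK ?nth_index //.
rewrite ltnS (leq_trans (index_size _ _)) //.
apply: leq_trans (leq_bigmax (F := fun j => size (Z i j)) j) _.
exact: (leq_bigmax (F := fun i => \max_j size (Z i j)) i).
Qed.

(* The top degree part of an algebraic relation between u_i^(e+1) / G and u_j u_i^e / G is an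
   equation for u_j / u_i at the points of the closure where G = 0. *)
Let closure_form_pos (G : {mpoly K[n.+1]}) e (A : set (projspace K n)) : G \is e.+1.-homog ->
  A `<=` im q -> ~ van f (sub2 g G) ->
  finite_set [set u | zclosure A u /\ value G u = 0].
Proof.
move=> hG Aim nv; have [s s0 hs] := pc_cof hf nv.
pose E := [set u : projspace K n | exists a b, [/\ ev2 f a b = 0, s.[a] = 0 & u = pt (gv g a b)]].
have finE : finite_set E.
  apply: (sub_finite_set _ (finite_image (fun p => pt (gv g p.1 p.2)) (finite_fiber hf s0))).
  by move=> u [a [b [fab sa ->]]]; exists (a, b).
(* The points of the curve with G nonzero; they cover [A] up to the finite set [E]. *)
pose A1 := [set u | exists a b, [/\ ev2 f a b = 0, gv g a b != 0, mev G (gv g a b) != 0 & u = pt (gv g a b)]].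
have AA : zclosure A `<=` zclosure A1 `|` E.
  apply: subset_trans (zclosureU_finite finE); apply: zclosureS => u /Aim [a [b [fab qa ->]]].
  have [kab|kab] := eqVneq (mev G (gv g a b)) 0; last by left; exists a, b; split=> //; apply: gv0.
  by right; exists a, b; split=> //; apply: (hs a b fab); rewrite ev2_sub2_mev.
have dep i j : exists2 Z : {poly K}, Z != 0 & forall u, zclosure A1 u ->
    value G u = 0 -> coords u 0 i != 0 -> Z.[coords u 0 j / coords u 0 i] = 0.
  have [R R0 hR] := alg_dep hf (sub2 g G) (g i ^+ e.+1) (g j * g i ^+ e).
  have [N [tN [j0 j0N Rj0]]] := tdeg_top R0.
  pose H := hom G ('X_i ^+ e.+1) ('X_j * 'X_i ^+ e) N R.
  have hX k m : ('X_k : {mpoly K[n.+1]}) ^+ m \is m.-homog.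
    by rewrite -[m in m.-homog]mul1n; apply: dhomogMn; apply: homogeneousX.
  have hH : homogeneous H.
    exists (e.+1 * N)%N; apply: hom_homog => //.
    by rewrite -[e.+1]add1n; apply: dhomogM => //; apply: homogeneousX.
  have HA u : A1 u -> value H u = 0.
    move=> [a [b [fab g0 kab ->]]]; apply/eqP; rewrite value_pt_eq0 //; apply/eqP.
    rewrite /mev /H meval_hom //.
    rewrite mevalM !rmorphXn /= !mevalXU !mxE.
    by have := hR a b fab; rewrite ev2_sub2_mev ev2M !ev2_exp => /(_ kab); rewrite /mev => ->; rewrite mulr0.
  (* Where G = 0 only the top degree part of [R] survives in [H], and [Z] is its dehomogenization;
     it is nonzero because the total degree N is attained. *)
  pose Z := \poly_(l < N.+1) R`_l`_(N - l).
  exists Z; first by apply: contraNneq Rj0 => e'; have := congr1 (fun p : {poly K} => p`_j0) e'; rewrite coef_poly ltnS j0N coef0 => ->.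
  move=> u uA ku ui; have : value H u = 0 by move/zclosureP: uA; apply.
  rewrite /value /H meval_hom_sum -/(mev _ _) -value_coords ku mevalM !rmorphXn /= !mevalXU.
  have yx : coords u 0 j / coords u 0 i = (coords u 0 j * coords u 0 i ^+ e) / coords u 0 i ^+ e.+1.
    by rewrite exprS; field; rewrite ui expf_neq0.
  rewrite yx; have : coords u 0 i ^+ e.+1 != 0 by rewrite expf_neq0.
  move: (coords u 0 i ^+ e.+1) (coords u 0 j * coords u 0 i ^+ e) => x y x0 e'.
  have xN : x ^+ N != 0 by rewrite expf_neq0.
  apply: (mulfI xN); rewrite mulr0 -[RHS]e' horner_poly mulr_sumr; apply: eq_bigr => l _.
  have lN : (l <= N)%N by rewrite -ltnS.
  have NlN : (N - l < N.+1)%N by rewrite ltnS leq_subr.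
  rewrite (bigD1 (Ordinal NlN)) /= ?subnK // subKn // subnn expr0 mul1r big1 ?addr0 => [|m /andP[ml]].
    rewrite expr_div_n; have -> : x ^+ N = x ^+ (N - l) * x ^+ l by rewrite -exprD subnK.
    by field; rewrite expf_neq0.
  rewrite -val_eqE /= => nm; have : (0 < N - m - l)%N by lia.
  by case: (N - m - l)%N => // t _; rewrite expr0n !mul0r mulr0.
have /choice [Z0 hZ0] : forall ij : 'I_n.+1 * 'I_n.+1, exists Z : seq K, forall u, zclosure A1 u ->
    value G u = 0 -> coords u 0 ij.1 != 0 -> coords u 0 ij.2 / coords u 0 ij.1 \in Z.
  move=> [i j]; have [Z Z0 hZ] := dep i j; have [zs Ezs] := closed_field_poly_normal Z.
  exists zs => u uA ku ui; have /eqP := hZ u uA ku ui.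
  by rewrite -[_ == 0]/(root Z _) {1}Ezs rootZ ?lead_coef_eq0 // root_prod_XsubC.
apply: (sub_finite_set (B := E `|` [set u : projspace K n | exists v i, [/\ u = pt v & forall j, v 0 j \in Z0 (i, j)]])); last first.
  by rewrite finite_setU; split=> //; apply: (finite_box (fun i j => Z0 (i, j))).
move=> u [/AA [uA|uE] ku]; [right|by left].
have /rv_neq0P [i ui] := coords_neq0 u.
exists ((coords u 0 i)^-1 *: coords u), i; split; first by rewrite ptZ ?invr_eq0 // pt_coords.
by move=> j; rewrite mxE mulrC; apply: (hZ0 (i, j)).
Qed.

Lemma closure_form (G : {mpoly K[n.+1]}) (A : set (projspace K n)) : homogeneous G ->
  A `<=` im q -> ~ van f (sub2 g G) ->
  finite_set [set u | zclosure A u /\ value G u = 0].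
Proof.
move=> [[|e] hG] Aim nv; last exact: (closure_form_pos hG).
rewrite (_ : [set u | _] = set0) //; apply/seteqP; split=> // u [_ Gu]; apply: nv => a b _.
have c v : mev G v = mev G 0 by have := mevZ 0 v hG; rewrite expr0 mul1r scale0r.
by rewrite ev2_sub2_mev c -(c (coords u)) -value_coords Gu.
Qed.

Lemma closure_hyperplane (k : 'rV[K]_n.+1) (A : set (projspace K n)) :
  A `<=` im q -> ~ van f (comb g k) ->
  finite_set [set u | zclosure A u /\ dotp k (coords u) = 0].
Proof.
move=> Aim nv; have h1 : homogeneous (linform k) by exists 1%N; apply: linform_homog.
apply: (sub_finite_set _ (closure_form h1 Aim _)).
  by move=> u [Au ku]; split=> //; rewrite value_coords mev_linform.
by move=> v; apply: nv => a b fab; rewrite ev2_comb -mev_linform -ev2_sub2_mev v.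
Qed.

Lemma infinite_field : infinite_set [set: K].
Proof.
move=> /finite_seqP [s e].
have [a] : exists a, (\prod_(b <- s) ('X - b%:P)).[a] != 0.
  by apply: poly_nonroot; apply: monic_neq0; apply: monic_prod_XsubC.
rewrite -[_ == 0]/(root _ a) root_prod_XsubC => /negP; apply.
by have : [set: K] a by []; rewrite e.
Qed.

Lemma infinite_nonroots : infinite_set [set a | q.[a] != 0].
Proof.
move=> fin; apply: infinite_field.
apply: (@sub_finite_set _ _ ([set a | q.[a] != 0] `|` [set a | q.[a] = 0])).
  by move=> a _; have [e|e] := eqVneq q.[a] 0; [right|left].
by rewrite finite_setU; split=> //; apply: root_finite.
Qed.

Lemma form_vanish (F : {mpoly K[n.+1]}) : homogeneous F -> van f (sub2 g F) ->
  forall u, zclosure (im q) u -> value F u = 0.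
Proof.
move=> hF h u /zclosureP; apply=> // _ [a [b [fab qa ->]]].
by apply/eqP; rewrite value_pt_eq0 ?gv0 // -ev2_sub2_mev h.
Qed.

Hypothesis gv_inj : forall a b a' b', ev2 f a b = 0 -> q.[a] != 0 ->
  ev2 f a' b' = 0 -> q.[a'] != 0 -> pt (gv g a b) = pt (gv g a' b') -> a = a' /\ b = b'.

Lemma im_infinite : infinite_set (im q).
Proof.
move=> fin; apply: infinite_nonroots.
pose F u := xget 0 [set a | exists b, [/\ ev2 f a b = 0, q.[a] != 0 & u = pt (gv g a b)]].
apply: (sub_finite_set _ (finite_image F fin)) => a qa.
have [b fab] := pc_point hf a; exists (pt (gv g a b)); first by exists a, b.
apply: xget_unique; first by exists b.
by move=> a' [b' [fab' qa' e]]; have [-> _] := gv_inj fab' qa' fab qa (esym e).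
Qed.

Lemma image_curve : finite_set (zclosure (im q) `\` im q) -> irreducible_curve (zclosure (im q)).
Proof.
move=> fin; apply: irreducible_curveI.
- exact: zclosure_closed.
- by apply: sub_infinite_set im_infinite; apply: sub_zclosure.
move=> F hF; have [h|/(pc_cof hf) [s s0 hs]] := pselect (van f (sub2 g F)).
  by left; apply: form_vanish.
right; apply: (@sub_finite_set _ _ ((zclosure (im q) `\` im q) `|`
   (fun p => pt (gv g p.1 p.2)) @` [set p : K * K | ev2 f p.1 p.2 = 0 /\ s.[p.1] = 0])).
  move=> u [Vu Fu]; have [uim|] := pselect (im q u); last by left.
  right; have [a [b [fab qa e]]] := uim; exists (a, b) => //=; split=> //.
  apply: (hs a b fab); rewrite ev2_sub2_mev; apply/eqP; rewrite -value_pt_eq0 ?gv0 //.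
  by rewrite -e Fu.
by rewrite finite_setU; split=> //; apply: finite_image; apply: (finite_fiber hf).
Qed.

End ClosureOfImage.

(** * Derivation along the curve *)

Section Differential.
Variable K : numClosedFieldType.
Local Notation BB := {poly {poly K}}.
Local Notation x := (xx K).
Local Notation y := (yy K).
Variables (f : BB) (d : nat).
Hypothesis hf : plane_curve f d.
Local Notation "'δ' A" := (delta f A) (at level 10, A at level 9).

Lemma vanD A B : van f A -> van f B -> van f (A + B).
Proof. by move=> hA hB a b fab; rewrite ev2D hA // hB // addr0. Qed.

Lemma vanMl A B : van f B -> van f (A * B).
Proof. by move=> h a b fab; rewrite ev2M h // mulr0. Qed.

Lemma van_eq A B : A = B -> van f B -> van f A. Proof. by move=> ->. Qed.

(** * Functions killed by the derivation are constant *)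

Section Constants.
Variables A B : BB.
Hypotheses (nB : ~ van f B) (hAB : van f (B * δ A - A * δ B)).

Let rel (P : BB) := forall a b, ev2 f a b = 0 -> ev2 B a b != 0 ->
  ev2 P a (ev2 A a b / ev2 B a b) = 0.

(** The monomial is (A / B)^i B^(i + j), and A / B is killed by the derivation. *)
Let monom i j : van f (B * δ (A ^+ i * B ^+ j) - (i + j)%:R * δ B * (A ^+ i * B ^+ j)).
Proof.
have h0 : δ (1 : BB) = 0 by have := delta_c f 1; rewrite /cc !polyC1.
elim: i => [|i IH].
  elim: j => [|j IH].
    by apply: van_eq (_ : van f 0); [rewrite !expr0 mulr1 h0 mulr0; ring|move=> a b _; rewrite ev2_0].
  apply: van_eq (vanMl B IH); rewrite !expr0 !mul1r exprS deltaM addnS -addn1 natrD; ring.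
apply: van_eq (vanD (vanMl A IH) (vanMl (A ^+ i * B ^+ j) hAB)).
by rewrite exprS -!mulrA deltaM addSn -addn1 natrD; ring.
Qed.

Let hmg k (P : BB) : BB := \sum_(i < k.+1) (P`_i)%:P * (A ^+ i * B ^+ (k - i)).

Let hmgE k (P : BB) a b : (size P <= k.+1)%N -> ev2 B a b != 0 ->
  ev2 (hmg k P) a b = ev2 B a b ^+ k * ev2 P a (ev2 A a b / ev2 B a b).
Proof.
move=> sP B0; rewrite /hmg ev2_sum [ev2 P a _]/ev2 (horner_coef_wide _ sP) horner_sum mulr_sumr.
apply: eq_bigr => i _; rewrite !ev2M ev2C !ev2_exp hornerM horner_exp hornerC expr_div_n.
have -> : ev2 B a b ^+ k = ev2 B a b ^+ (k - i) * ev2 B a b ^+ i.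
  by rewrite -exprD subnK // -ltnS.
by field; rewrite expf_neq0.
Qed.

Let delta_hmg k (P : BB) : van f (B * δ (hmg k P) - (dy f * B * hmg k (dx P) + k%:R * δ B * hmg k P)).
Proof.
have hs (F : 'I_k.+1 -> BB) : δ (\sum_i F i) = \sum_i δ (F i).
  by apply: (big_morph _ (deltaD f) (delta0 f)).
rewrite /hmg hs !mulr_sumr -big_split -sumrB /=; apply: (big_ind (van f)).
- by move=> a b _; rewrite ev2_0.
- exact: vanD.
move=> i _; apply: van_eq (vanMl (P`_i)%:P (@monom i (k - i))).
by rewrite deltaM deltaC coef_dx subnKC ?ltnS -1?ltnS //; ring.
Qed.

(** Differentiating P(x, A / B) = 0 along the curve, with A / B killed, leaves f_y times the
    derivative of P in x. *)
Let rel_dx (P : BB) : rel P -> rel (dx P).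
Proof.
move=> hP; set k := (size P).-1.
have sP : (size P <= k.+1)%N by rewrite /k; case: (size P).
have sdP : (size (dx P) <= k.+1)%N by apply: leq_trans (size_poly _ _) sP.
have vP : van f (hmg k P).
  have [s s0 hs] := pc_cof hf nB; apply: (van_cof hf s0) => a b fab sa.
  have B0 : ev2 B a b != 0 by apply: contraNneq sa => /(hs a b fab) ->.
  by rewrite hmgE // hP // mulr0.
have vdP := van_delta hf vP.
have /(van_mul hf) [/(van_mul hf) [/(nvan_dy hf)//|//]|v] : van f (dy f * B * hmg k (dx P)).
  move=> a b fab; have := @delta_hmg k P a b fab.
  rewrite ev2B ev2D [ev2 (B * _) _ _]ev2M vdP // mulr0 sub0r => /eqP; rewrite oppr_eq0.
  by rewrite [ev2 (_ * hmg k P) _ _]ev2M vP // mulr0 addr0 => /eqP.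
move=> a b fab B0; have /eqP := v a b fab; rewrite hmgE // mulf_eq0 expf_eq0 (negPf B0) andbF.
by move=> /eqP.
Qed.

(* A minimal algebraic equation of A/B over K(x) has constant coefficients once d(A/B) = 0. *)
Lemma constant_of_delta0 : exists c, van f (A - cc c * B).
Proof.
have [P P0 hP] : exists2 P, P != 0 & rel P.
  have [R R0 hR] := alg_dep hf B (x * B) A; exists R => // a b fab B0.
  by have := hR a b fab B0; rewrite ev2M ev2x mulfK.
have [m] := ubnP (size P); elim: m => // m IH in P P0 hP *; rewrite ltnS => sP.
set l := lead_coef P; have l0 : l != 0 by rewrite lead_coef_eq0.
(* The leading terms cancel, so either [W] is a shorter equation, or W = 0 and every coefficient is
   a constant multiple of l. *)
pose W := l *: dx P - l^`() *: P.
have relW : rel W.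
  move=> a b fab B0; rewrite /W -!mul_polyC ev2B !ev2M (rel_dx hP) // (hP a b) //.
  by rewrite !mulr0 subr0.
have sPE : size P = (size P).-1.+1 by rewrite prednK // lt0n size_poly_eq0.
have sW : (size W < size P)%N.
  rewrite [X in (_ < X)%N]sPE ltnS; apply/leq_sizeP => j; rewrite leq_eqVlt => /predU1P[<-|lj].
    by rewrite coefB !coefZ coef_dx -lead_coefE -/l; ring.
  have jP : (size P <= j)%N by rewrite sPE.
  by rewrite coefB !coefZ coef_dx !(nth_default _ jP) deriv0; ring.
have [W0|W0] := eqVneq W 0; last exact: (IH W W0 relW (leq_trans sW sP)).
have /choice [cs hcs] : forall i, exists c, P`_i = c *: l.
  move=> i; apply: wronskian0 => //; have := congr1 (fun p : BB => p`_i) W0.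
  by rewrite coefB !coefZ coef_dx coef0 => /subr0_eq; rewrite mulrC => ->; rewrite mulrC.
pose P1 := \poly_(i < size P) cs i.
have EP : P = l *: map_poly polyC P1.
  apply/polyP => i; rewrite coefZ coef_map_id0 ?polyC0 // coef_poly; case: ltnP => si.
    by rewrite hcs mulrC mul_polyC.
  by rewrite nth_default // polyC0 mulr0.
have [ts Ets] := closed_field_poly_normal P1.
have P10 : P1 != 0 by apply: contraNneq P0 => e; rewrite EP e rmorph0 scaler0.
(* A / B is a root of the polynomial [P1] with constant coefficients; as the ideal of the curve is
   prime, it is the same root everywhere. *)
have : van f (\prod_(t <- ts) (A - cc t * B)).
  have [s s0 hs] := pc_cof hf nB.
  have ls0 : l * s != 0 by rewrite mulf_neq0.
  apply: (van_cof hf ls0) => a b fab; rewrite hornerM mulf_eq0 negb_or => /andP[la sa].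
  have B0 : ev2 B a b != 0 by apply: contraNneq sa => /(hs a b fab) ->.
  have := hP a b fab B0; rewrite {1}EP -mul_polyC ev2M ev2C /ev2 horner_map hornerC => /eqP.
  rewrite mulf_eq0 (negPf la) /= Ets hornerZ mulf_eq0 lead_coef_eq0 (negPf P10) /=.
  rewrite horner_prod prodf_seq_eq0 => /hasP [t tts /=]; rewrite hornerXsubC subr_eq0 => /eqP e.
  apply/eqP; rewrite -/(ev2 _ a b) ev2_prod prodf_seq_eq0; apply/hasP; exists t => //=.
  by rewrite ev2B ev2M ev2c -e mulfVK ?subrr.
elim: (ts) => [|t r IHr]; rewrite ?big_nil ?big_cons.
  by move/(nvan_C hf (oner_neq0 _)).
by move/(van_mul hf) => [h|/IHr//]; exists t.
Qed.

End Constants.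

(* W, W' and W'' are linearly independent where flex does not vanish. *)
Definition flex : BB :=
  let u := dy f in let v := dx f in
  u * v * δ (δ u) + 3%:R * δ u * (u * δ v - v * δ u) - u ^+ 2 * δ (δ v).

(** On the curve, [flex] is f_y^5 times the third derivative of y in x. If it vanishes, three
    integrations give y = (c1 / 2) x^2 + c2 x + c3. *)
Lemma nvan_flex : (1 < d)%N -> ~ van f flex.
Proof.
move=> d1 vflex; pose u := dy f; pose v := dx f; pose H := v * δ u - u * δ v.
have nu : ~ van f u by apply: (nvan_dy hf).
have nu3 : ~ van f (u ^+ 3).
  by rewrite !exprS expr0 mulr1 => /(van_mul hf) [//|/(van_mul hf) []].
have [c1 h1] : exists c, van f (H - cc c * u ^+ 3).
  apply: constant_of_delta0 => //; apply: van_eq (vanMl (u ^+ 2) vflex).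
  rewrite /H !exprS expr0 !mulr1 !deltaE /flex -/u -/v; ring.
have [c2 h2] : exists c, van f ((- v - cc c1 * x * u) - cc c * u).
  apply: constant_of_delta0 => //; apply: van_eq h1.
  by rewrite !deltaE /H -/u -/v; ring.
have [c3 h3] : exists c, van f ((y - cc (c1 / 2%:R) * x ^+ 2 - cc c2 * x) - cc c * 1).
  apply: constant_of_delta0.
    by move/(nvan_C hf (oner_neq0 _)).
  have h0 : δ (1 : BB) = 0 by have := delta_c f 1; rewrite /cc !polyC1.
  apply: van_eq h2; rewrite h0 expr2 !deltaE -/u -/v.
  have -> : cc c1 = cc (c1 / 2%:R) + cc (c1 / 2%:R).
    by rewrite /cc -!polyCD -Num.Theory.splitr.
  by ring.
set G := _ - _ in h3.
have GE : G = y - ((c1 / 2%:R) *: 'X^2 + c2 *: 'X + c3%:P)%:P.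
  by rewrite /G /cc /xx mulr1 -!mul_polyC !polyCD !polyCM; ring.
(* [G] has degree 1 < d in y, so it could vanish on the curve only by being zero, but it is monic in
   y. *)
have : G = 0.
  apply: (van_size hf h3); rewrite GE /yy size_XsubC; lia.
by rewrite GE => /eqP; rewrite /yy polyXsubC_eq0.
Qed.

(** * Order of vanishing at a point with f_y nonzero *)

Section Order.
Variables a b : K.
Hypotheses (fab : ev2 f a b = 0) (fy : ev2 (dy f) a b != 0).

(** Membership in the ideal of (x - a)^k in the local ring at (a, b), with denominator s; where f_y
    is nonzero, x - a is a local parameter. *)
Definition vord k A := exists s A', ev2 s a b != 0 /\ van f (s * A - (x - cc a) ^+ k * A').

Lemma vordM k l A B : vord k A -> vord l B -> vord (k + l) (A * B).
Proof.
move=> [s [A' [s0 hA]]] [t [B' [t0 hB]]]; exists (s * t), (A' * B'); split.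
  by rewrite ev2M mulf_neq0.
apply: van_eq (vanD (vanMl (t * B) hA) (vanMl ((x - cc a) ^+ k * A') hB)).
by rewrite exprD; ring.
Qed.

Lemma vordD k A B : vord k A -> vord k B -> vord k (A + B).
Proof.
move=> [s [A' [s0 hA]]] [t [B' [t0 hB]]]; exists (s * t), (t * A' + s * B'); split.
  by rewrite ev2M mulf_neq0.
by apply: van_eq (vanD (vanMl t hA) (vanMl s hB)); ring.
Qed.

Lemma vord0 k : vord k 0.
Proof.
by exists 1, 0; split; rewrite ?ev2_1 ?oner_neq0 // => a' b' _; rewrite !mulr0 subr0 ev2_0.
Qed.

Lemma vord_unit k G A : ev2 G a b != 0 -> vord k (G * A) -> vord k A.
Proof.
move=> G0 [s [A' [s0 hA]]]; exists (s * G), A'; split; first by rewrite ev2M mulf_neq0.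
by apply: van_eq hA; ring.
Qed.

Lemma vord_ext k A B : van f (A - B) -> vord k A -> vord k B.
Proof.
move=> hAB [s [A' [s0 hA]]]; exists s, A'; split=> //.
by apply: van_eq (vanD hA (vanMl (- s) hAB)); ring.
Qed.

Lemma taylor1 A : exists A1 A2, A = cc (ev2 A a b) + (x - cc a) * A1 + (y - cc b) * A2.
Proof.
have /factor_theorem [q hq] : root (A - (A.[b%:P])%:P) b%:P.
  by rewrite /root hornerD hornerN hornerC subrr.
have /factor_theorem [p hp] : root (A.[b%:P] - (A.[b%:P].[a])%:P) a.
  by rewrite /root hornerD hornerN hornerC subrr.
exists p%:P, q; rewrite -[LHS](subrK (A.[b%:P])%:P) hq.
rewrite -[A.[b%:P] in LHS](subrK (A.[b%:P].[a])%:P) hp polyCD polyCM polyCB /ev2 /cc /xx /yy.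
ring.
Qed.

(** In f = (x - a) F1 + (y - b) F2, the factor F2 takes the value f_y at the point and so is a unit:
    on the curve y - b is a multiple of x - a. *)
Lemma vord1 A : ev2 A a b = 0 -> vord 1 A.
Proof.
move=> A0; have [A1 [A2 EA]] := taylor1 A; have [F1 [F2 EF]] := taylor1 f.
rewrite A0 /cc !rmorph0 add0r in EA; rewrite fab /cc !rmorph0 add0r in EF.
have F20 : ev2 F2 a b = ev2 (dy f) a b.
  have := congr1 (fun A => ev2 (dy A) a b) EF; rewrite /dy derivD !derivM !derivB /xx /yy derivX !derivC.
  by rewrite -/(xx K) -/(yy K) !ev2E => ->; ring.
exists F2, (F2 * A1 - A2 * F1); split; first by rewrite F20.
move=> a' b' fab'; have : ev2 (A2 * f) a' b' = 0 by rewrite ev2M fab' mulr0.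
by rewrite {1}EF EA => e; rewrite -[RHS]e; congr ev2; rewrite /cc; ring.
Qed.

Lemma delta_rel k s A A' : van f (s * A - (x - cc a) ^+ k.+1 * A') ->
  van f (s * s * δ A - (x - cc a) ^+ k *
    (s * (k.+1%:R * dy f * A' + (x - cc a) * δ A') - δ s * ((x - cc a) * A'))).
Proof.
move=> hA.
have dpow j : δ ((x - cc a) ^+ j.+1) = j.+1%:R * dy f * (x - cc a) ^+ j.
  elim: j => [|j IH]; first by rewrite expr1 expr0 !deltaE; ring.
  by rewrite exprS deltaM IH deltaB delta_c delta_x [j.+2%:R]mulrS !exprS; ring.
apply: van_eq (vanD (vanMl s (van_delta hf hA)) (vanMl (- δ s) hA)).
by rewrite deltaB !deltaM dpow exprS; ring.
Qed.

Lemma vord_delta k A : vord k.+1 A -> ev2 A a b = 0 /\ vord k (δ A).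
Proof.
move=> [s [A' [s0 hA]]]; split.
  have := hA a b fab; rewrite ev2B !ev2M ev2_exp ev2B ev2x ev2c subrr expr0n mul0r subr0.
  by move/eqP; rewrite mulf_eq0 (negPf s0) => /eqP.
exists (s * s); eexists; split; last exact: delta_rel hA.
by rewrite ev2M mulf_neq0.
Qed.

Lemma vordS k A : vord k A -> (forall s A', ev2 s a b != 0 ->
  van f (s * A - (x - cc a) ^+ k * A') -> ev2 A' a b = 0) -> vord k.+1 A.
Proof.
move=> [s [A' [s0 hA]]] h; have [t [B [t0 hB]]] := vord1 (h _ _ s0 hA).
exists (t * s), B; split; first by rewrite ev2M mulf_neq0.
rewrite expr1 in hB.
by apply: van_eq (vanD (vanMl t hA) (vanMl ((x - cc a) ^+ k) hB)); rewrite exprS; ring.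
Qed.

(** The derivation maps x - a to the unit f_y, so in characteristic 0 it lowers a positive order by
    exactly one. *)
Lemma vord3P A : vord 3 A <->
  [/\ ev2 A a b = 0, ev2 (δ A) a b = 0 & ev2 (δ (δ A)) a b = 0].
Proof.
split=> [/vord_delta [h0 /vord_delta [h1 /vord_delta [h2 _]]]|[h0 h1 h2]]; first by split.
have key s B B' : van f (s * B - (x - cc a) ^+ 1 * B') -> ev2 B a b = 0 -> ev2 (δ B) a b = 0 ->
    ev2 B' a b = 0.
  move=> hB B0 dB0; have := van_delta hf hB fab.
  rewrite expr1 deltaB !deltaM deltaB delta_x delta_c !ev2E B0 dB0 subrr.
  rewrite !(mulr0, mul0r, add0r, addr0, subr0, sub0r) => /eqP; rewrite oppr_eq0 mulf_eq0 (negPf fy).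
  by move=> /eqP.
apply: vordS (vordS (vord1 h0) _) _ => s A' s0 hA; first exact: key hA h0 h1.
have ev2n m : ev2 (m%:R : BB) a b = m%:R.
  by rewrite /ev2 -(polyC_natr {poly K}) hornerC -(polyC_natr K) hornerC.
have /eqP := key _ _ _ (delta_rel hA) h1 h2.
rewrite ev2B [ev2 (s * _) a b]ev2M [ev2 (_ * _ + _) a b]ev2D [ev2 (_ * dy f * _) a b]ev2M.
rewrite [ev2 (_ * dy f) a b]ev2M ev2n [ev2 (δ s * _) a b]ev2M ![ev2 ((x - cc a) * _) a b]ev2M.
rewrite ev2B ev2x ev2c subrr !(mulr0, mul0r, subr0, addr0).
by rewrite !mulf_eq0 (negPf s0) (negPf fy) Num.Theory.pnatr_eq0 => /eqP.
Qed.

End Order.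

End Differential.

(** * Affine model of a plane curve *)

Section Factorization.
Variable K : numClosedFieldType.
Local Notation BB := {poly {poly K}}.
Implicit Types (A B f : BB).

Lemma fiber_eq0_dvd A a : fiber A a = 0 -> exists A', A = ('X - a%:P) *: A'.
Proof.
move=> h; exists (map_poly (fun p => p %/ ('X - a%:P)) A); apply/polyP => i.
rewrite coefZ coef_map_id0 ?div0p // mulrC divpK // dvdp_XsubCl /root.
by rewrite -coef_fiber h coef0.
Qed.

(* Gauss' lemma: roots of the denominator c can be cancelled one at a time. *)
Lemma gauss_monic f A B (c : {poly K}) : f \is monic -> c != 0 -> c *: f = A * B ->
  exists A1 B1, [/\ A1 \is monic, B1 \is monic, f = A1 * B1 & size A1 = size A].
Proof.
move=> mf; have [m] := ubnP (size c); elim: m => // m IH in c A B *; rewrite ltnS => sc c0 E.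
have f0 : f != 0 by apply: monic_neq0.
have AB0 : A * B != 0 by rewrite -E -size_poly_eq0 size_scale // size_poly_eq0.
have [A0 B0] : A != 0 /\ B != 0 by move: AB0; rewrite mulf_eq0 negb_or => /andP[].
(* When c is constant, the leading coefficients of A and B in y are constants too and can be scaled
   to 1. *)
have [s1|s1] := eqVneq (size c) 1%N.
  have [k k0 ck] : exists2 k, k != 0 & c = k%:P.
    exists c`_0; last by apply: size1_polyC; rewrite s1.
    by apply: contraNneq c0 => e; rewrite (size1_polyC (_ : size c <= 1)%N) ?s1 // e polyC0.
  have lAB : lead_coef A * lead_coef B = k%:P.
    by rewrite -lead_coefM -E lead_coefZ (eqP mf) mulr1.
  have : size (lead_coef A * lead_coef B) = 1%N by rewrite lAB size_polyC k0.
  rewrite size_mul ?lead_coef_eq0 // => sAB.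
  have sA0 : size (lead_coef A) != 0%N by rewrite size_poly_eq0 lead_coef_eq0.
  have sB0 : size (lead_coef B) != 0%N by rewrite size_poly_eq0 lead_coef_eq0.
  have aux (p q : nat) : (p + q).-1 = 1%N -> p != 0%N -> q != 0%N -> p = 1%N /\ q = 1%N by lia.
  have [sA sB] := aux _ _ sAB sA0 sB0.
  have lA := size1_polyC (eq_leq sA); have lB := size1_polyC (eq_leq sB).
  set al := (lead_coef A)`_0 in lA; set be := (lead_coef B)`_0 in lB.
  have al0 : al != 0 by apply: contraTneq A0 => e; rewrite -lead_coef_eq0 lA e polyC0 eqxx.
  have be0 : be != 0 by apply: contraTneq B0 => e; rewrite -lead_coef_eq0 lB e polyC0 eqxx.
  exists ((al^-1)%:P *: A), ((be^-1)%:P *: B); split.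
  - by rewrite monicE lead_coefZ lA -rmorphM /= mulVf.
  - by rewrite monicE lead_coefZ lB -rmorphM /= mulVf.
  - rewrite -scalerAl -scalerAr -E !scalerA ck -!rmorphM /=.
    have -> : k = al * be by have := lAB; rewrite lA lB -rmorphM => /polyC_inj.
    have -> : al^-1 / be * (al * be) = 1 by field; rewrite ?al0 ?be0.
    by rewrite scale1r.
  by rewrite size_scale // polyC_eq0 invr_eq0.
have /closed_rootP [a ca] := s1.
have {ca} /factor_theorem [c' Ec] := ca.
have c'0 : c' != 0 by apply: contraNneq c0 => e; rewrite Ec e mul0r.
have sc' : (size c' < m)%N.
  by move: sc; rewrite Ec size_Mmonic ?monicXsubC // size_XsubC addn2.
have X0 : 'X - a%:P != 0 by rewrite polyXsubC_eq0.
have fAB : fiber A a * fiber B a = 0.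
  rewrite -[_ * _](rmorphM (map_poly (horner_eval a))) /= -E -mul_polyC rmorphM /= map_polyC /=.
  by rewrite /horner_eval Ec hornerM hornerXsubC subrr mulr0 polyC0 mul0r.
have scaleI (P Q : BB) : ('X - a%:P) *: P = ('X - a%:P) *: Q -> P = Q.
  by move=> e; apply/polyP => i; apply: (mulfI X0); rewrite -!coefZ e.
move/eqP: fAB; rewrite mulf_eq0 => /orP[/eqP|/eqP] /fiber_eq0_dvd [A' EA'].
  have : c' *: f = A' * B.
    by apply: scaleI; rewrite scalerAl -EA' -E Ec scalerA mulrC.
  move=> /(IH _ _ _ sc' c'0) [A1 [B1 [h1 h2 h3 h4]]]; exists A1, B1; split=> //.
  by rewrite h4 EA' size_scale.
have : c' *: f = A * A'.
  by apply: scaleI; rewrite scalerAr -EA' -E Ec scalerA mulrC.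
by move=> /(IH _ _ _ sc' c'0).
Qed.

Lemma topev_small e N A c : tdeg e A -> (e < N)%N -> topev N A c = 0.
Proof.
move=> h eN; rewrite /topev ev2_revp_sum big1 // => j _; apply: big1 => i ij.
have [->|/h h'] := eqVneq (A`_j`_i) 0; first by rewrite mul0r.
have : (0 < N - i - j)%N by lia.
by case: (N - i - j)%N => // m _; rewrite exprS mul0r mul0r mulr0.
Qed.

Lemma coef_fiber_revp N A j : (j <= N)%N -> (fiber (revp N A) 0)`_j = A`_j`_(N - j).
Proof.
move=> jN; rewrite coef_fiber coef_poly ltnS jN horner_sum.
have NjN : (N - j < N.+1)%N by rewrite ltnS leq_subr.
rewrite (bigD1 (Ordinal NjN)) /= ?subnK // subKn // subnn expr0 hornerZ hornerC mulr1.
rewrite big1 ?addr0 // => i /andP[ij]; rewrite -val_eqE /= => ni.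
have : (0 < N - i - j)%N by lia.
by case: (N - i - j)%N => // m _; rewrite hornerZ hornerXn exprS mul0r mulr0.
Qed.

(** The exact total degrees N1 and N2 add, because the product of nonzero top degree parts is
    nonzero. So N1 + N2 is at most k + l, while N2 is at least l. *)
Lemma tdeg_factor A B k l d : A \is monic -> size A = k.+1 -> B \is monic -> size B = l.+1 ->
  (k + l = d)%N -> tdeg d (A * B) -> tdeg k A.
Proof.
move=> mA sA mB sB kl hd.
have [N1 [t1 [j1 j1N c1]]] := tdeg_top (monic_neq0 mA).
have [N2 [t2 [j2 j2N c2]]] := tdeg_top (monic_neq0 mB).
have low N (P : BB) m : P \is monic -> size P = m.+1 -> tdeg N P -> (m <= N)%N.
  move=> mP sP t; apply: (t 0%N m); have := eqP mP; rewrite lead_coefE sP /= => ->.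
  by rewrite coef1 oner_neq0.
have k1 := low _ _ _ mA sA t1; have l2 := low _ _ _ mB sB t2.
have [d12|d12] := leqP (N1 + N2) d; first by apply: tdeg_leq t1; lia.
exfalso; have n1 : fiber (revp N1 A) 0 != 0.
  by apply: contraNneq c1 => e; rewrite -coef_fiber_revp // e coef0.
have n2 : fiber (revp N2 B) 0 != 0.
  by apply: contraNneq c2 => e; rewrite -coef_fiber_revp // e coef0.
have [c] : exists c, (fiber (revp N1 A) 0 * fiber (revp N2 B) 0).[c] != 0.
  by apply: poly_nonroot; rewrite mulf_neq0.
rewrite hornerM !fiberE -[ev2 _ 0 c * _](topevM c t1 t2).
by rewrite (topev_small c hd d12) eqxx.
Qed.

End Factorization.

Section LinearCoordinates.
Variable K : numClosedFieldType.
Local Notation BB := {poly {poly K}}.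

Definition vec3 (a b c : K) : 'rV[K]_3 := \row_i [:: a; b; c]`_i.

Definition gX (M : 'M[K]_3) (i : 'I_3) : BB := cc (M 0 i) + xx K * cc (M 1 i) + yy K * cc (M 2%:R i).

Lemma vec3_mul a b c (M : 'M[K]_3) i : (vec3 a b c *m M) 0 i = a * M 0 i + b * M 1 i + c * M 2%:R i.
Proof.
rewrite mxE !big_ord_recl big_ord0 addr0 !mxE /= addrA.
congr (_ * M _ i + _ * M _ i + _ * M _ i); exact: val_inj.
Qed.

Lemma gv_gX M a b : gv (gX M) a b = vec3 1 a b *m M.
Proof.
by apply/rowP => i; rewrite vec3_mul mxE /gX !ev2E mul1r.
Qed.

Lemma vec3E (w : 'rV[K]_3) : w = vec3 (w 0 0) (w 0 1) (w 0 2%:R).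
Proof.
apply/rowP => i; rewrite mxE; case: i => [[|[|[|//]]] h] /=; congr (w 0 _); exact: val_inj.
Qed.

Lemma vec3_0 a b c : vec3 a b c 0 0 = a. Proof. by rewrite mxE. Qed.
Lemma vec3_1 a b c : vec3 a b c 0 1 = b. Proof. by rewrite mxE. Qed.
Lemma vec3_2 a b c : vec3 a b c 0 2%:R = c. Proof. by rewrite mxE. Qed.

Lemma vec3Z k a b c : k *: vec3 a b c = vec3 (k * a) (k * b) (k * c).
Proof. by apply/rowP => i; rewrite !mxE; case: i => [[|[|[|//]]] h]. Qed.

Lemma tdeg_gX M i : tdeg 1 (gX M i).
Proof.
apply: tdegD; first apply: tdegD.
- by apply: (@tdeg_leq _ 0); last exact: tdeg_c.
- by apply: (@tdegM _ 1 0); [apply: tdeg_x|apply: tdeg_c].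
by apply: (@tdegM _ 1 0); [apply: tdeg_y|apply: tdeg_c].
Qed.

Definition cform (M : 'M[K]_3) (i : 'I_3) : {mpoly K[3]} := linform (\row_j invmx M j i).

Lemma mev_cform M i w : mev (cform M i) w = (w *m invmx M) 0 i.
Proof. by rewrite mev_linform mxE; apply: eq_bigr => j _; rewrite mxE mulrC. Qed.

Lemma polyfun_lin m p (M : 'M[K]_(m, p)) (F : {mpoly K[p]}) :
  polyfun (fun w : 'rV[K]_m => F.@[fun i => (w *m M) 0 i]).
Proof.
elim/mpoly_induction: F => [|i F IH|F G IF IG|c F IF].
- by apply: (@polyfun_ext _ _ (fun=> 1)) => [w|]; [rewrite meval1|apply: polyfun_const].
- apply: (@polyfun_ext _ _ (fun w => (\sum_j w 0 j * M j i) * F.@[fun i => (w *m M) 0 i])) => [w|].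
    by rewrite mevalM mevalXU mxE.
  apply: polyfunM => //; apply: polyfun_sum => j _.
  by apply: polyfunM; [apply: polyfun_coord|apply: polyfun_const].
- apply: (@polyfun_ext _ _ (fun w => F.@[fun i => (w *m M) 0 i] + G.@[fun i => (w *m M) 0 i])) => [w|].
    by rewrite mevalD.
  exact: polyfunD.
apply: (@polyfun_ext _ _ (fun w => c * F.@[fun i => (w *m M) 0 i])) => [w|].
  by rewrite mevalZ.
by apply: polyfunM => //; apply: polyfun_const.
Qed.

Variables (M : 'M[K]_3) (F : {mpoly K[3]}) (d : nat).
Hypotheses (uM : M \in unitmx) (hF : F \is d.-homog).
Let f := sub2 (gX M) F.

Lemma ev2_model a b : ev2 f a b = mev F (vec3 1 a b *m M).
Proof. by rewrite ev2_sub2_mev gv_gX. Qed.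

Lemma tdeg_model : tdeg d f.
Proof. by rewrite -[d]mul1n; apply: tdeg_sub2 => // i; apply: tdeg_gX. Qed.

(** Both sides agree where the first coordinate is nonzero, hence everywhere; this gives access to
    [F] at infinity. *)
Lemma form_expand w : mev F (w *m M) = mev (hom 'X_0 'X_1 'X_2%:R d f) w.
Proof.
pose phi (w : 'rV[K]_3) := mev F (w *m M) - mev (hom 'X_0 'X_1 'X_2%:R d f) w.
have pphi : polyfun phi.
  apply: polyfunD; first exact: polyfun_lin.
  by apply: polyfunN; apply: polyfun_mev.
have z0 (u : 'rV[K]_3) : u 0 0 != 0 -> phi u = 0.
  move=> u0; apply/eqP; rewrite subr_eq0; apply/eqP.
  rewrite [in RHS]/mev meval_hom ?mevalXU //; last exact: tdeg_model.
  rewrite ev2_model -(mevZ _ _ hF) scalemxAl vec3Z mulr1 ![_ 0 0 * (_ / _)]mulrC !divfK //.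
  by rewrite -vec3E.
apply/eqP; rewrite -subr_eq0; apply: contraT => pw.
have c0 : (const_mx 1 : 'rV[K]_3) 0 0 != 0 by rewrite mxE oner_neq0.
have [t [h1 h2]] := @polyfun_mul_neq0 K _ phi (fun v : 'rV[K]_3 => v 0 0) w (const_mx 1) pphi
  (polyfun_coord _ _) pw c0.
by move: h1; rewrite z0 ?eqxx.
Qed.

Lemma topev_model c : topev d f c = mev F (vec3 0 1 c *m M).
Proof.
rewrite form_expand /mev meval_hom_sum /topev ev2_revp_sum.
apply: eq_bigr => j _; apply: eq_bigr => i _; rewrite !mevalXU vec3_0 vec3_1 vec3_2.
by rewrite expr1n mulr1.
Qed.

Lemma coef_model_top : f`_d = (mev F (vec3 0 0 1 *m M))%:P.
Proof.
apply/polyP => i; rewrite coefC; have [->|i0] := eqVneq i 0%N.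
  rewrite form_expand /mev meval_hom_sum (bigD1 ord_max) //= (bigD1 ord0) ?add0n ?leqnn //=.
  rewrite subn0 subnn !expr0 !mevalXU vec3_2 expr1n !mulr1 big1 ?addr0 => [|k /andP[kd k0]].
    rewrite big1 ?addr0 // => j jd; apply: big1 => k kj; rewrite vec3_0 vec3_1.
    case: (nat_of_ord k) kj => [|m] mj; last by rewrite !exprS !mul0r !mulr0 mul0r mulr0.
    have : (0 < d - 0 - j)%N.
      by rewrite subn0 subn_gt0 ltn_neqAle -ltnS ltn_ord andbT.
    by case: (d - 0 - j)%N => // t _; rewrite !exprS !mul0r mulr0.
  by exfalso; move: kd k0; rewrite -val_eqE /=; lia.
apply/eqP; apply: contraT => /tdeg_model; lia.
Qed.

End LinearCoordinates.

(** * An equation of least degree defines an irreducible affine curve *)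

Section PlaneModel.
Variable K : numClosedFieldType.
Local Notation BB := {poly {poly K}}.
Variable X : set (projspace K 2).
Hypothesis hX : irreducible_curve X.

(** Minimality of the degree takes the place of irreducibility of the form; an equation exists
    because X is not the whole plane. *)
Lemma min_form : exists d (F : {mpoly K[3]}), [/\ F \is d.-homog, forall u, X u -> value F u = 0,
  exists v, mev F v != 0 & forall e (G : {mpoly K[3]}), (e < d)%N -> G \is e.-homog ->
    (forall u, X u -> value G u = 0) -> forall v, mev G v = 0].
Proof.
pose P m := `[< exists F : {mpoly K[3]}, [/\ F \is m.-homog, forall u, X u -> value F u = 0 &
   exists v, mev F v != 0] >].
have exP : exists m, P m.
  have [u nXu] : exists u, ~ X u.
    apply: contrapT => /forallNP h; apply: (plane_not_curve hX).
    by apply/seteqP; split=> // u _; apply: contrapT; apply: h.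
  have [[[S [hS XE]] _ _] _] := hX.
  have /existsNP [F /not_implyP [SF /eqP Fu]] : ~ forall F, S F -> value F u = 0.
    by move=> h; apply: nXu; rewrite XE.
  have [m hF] := hS _ SF; exists m; apply/asboolP; exists F; split=> //.
    by move=> w; rewrite XE; apply.
  by exists (coords u).
case: (ex_minnP exP) => d /asboolP [F [hF FX Fv]] dmin; exists d, F; split=> //.
move=> e G ed hG GX v; apply/eqP; apply: contraT => Gv.
have : P e by apply/asboolP; exists G; split=> //; exists v.
by move/dmin; rewrite leqNgt ed.
Qed.

Variables (M : 'M[K]_3) (F : {mpoly K[3]}) (d : nat).
Hypotheses (uM : M \in unitmx) (hF : F \is d.-homog) (FX : forall u, X u -> value F u = 0).
Hypothesis Fmin : forall e (G : {mpoly K[3]}), (e < d)%N -> G \is e.-homog ->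
    (forall u, X u -> value G u = 0) -> forall v, mev G v = 0.
Hypothesis F1 : mev F (vec3 0 0 1 *m M) = 1.
Let f := sub2 (gX M) F.

Let d_gt0 : (0 < d)%N.
Proof.
rewrite lt0n; apply/eqP => d0; have [[_ [u Xu] _] _] := hX.
have cst v : mev F v = mev F 0.
  by have := mevZ 0 v hF; rewrite d0 expr0 mul1r scale0r.
have := FX Xu; rewrite value_coords cst -(cst (vec3 0 0 1 *m M)) F1 => /eqP.
by rewrite oner_eq0.
Qed.

Let fd1 : f`_d = 1. Proof. by rewrite coef_model_top ?F1. Qed.

Let size_f : size f = d.+1.
Proof.
apply/eqP; rewrite eqn_leq (tdeg_size (@tdeg_model K M F d hF)) ltnNge; apply/negP => /(nth_default 0).
by rewrite fd1 => /eqP; rewrite oner_eq0.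
Qed.

Let monic_f : f \is monic. Proof. by rewrite monicE lead_coefE size_f fd1. Qed.

Lemma gX_neq0 a b : gv (gX M) a b != 0.
Proof.
rewrite gv_gX; apply/eqP => e.
have /rowP /(_ 0) : vec3 1 a b = 0 by rewrite -[LHS](mulmxK uM) e mul0mx.
by rewrite vec3_0 mxE => /eqP; rewrite oner_eq0.
Qed.

Lemma gX_pt u : (coords u *m invmx M) 0 0 != 0 ->
  let w := coords u *m invmx M in
  u = pt (gv (gX M) (w 0 1 / w 0 0) (w 0 2%:R / w 0 0)).
Proof.
move=> w0 w; rewrite gv_gX; have -> : vec3 1 (w 0 1 / w 0 0) (w 0 2%:R / w 0 0) = (w 0 0)^-1 *: w.
  by rewrite [X in _ *: X]vec3E vec3Z mulVf // ![_^-1 * _]mulrC.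
by rewrite -scalemxAl mulmxKV // ptZ ?invr_eq0 // pt_coords.
Qed.

Lemma gX_inj a b a' b' : pt (gv (gX M) a b) = pt (gv (gX M) a' b') -> a = a' /\ b = b'.
Proof.
move=> /(pt_eqP (gX_neq0 a b) (gX_neq0 a' b')) [c c0]; rewrite !gv_gX scalemxAl => e.
have {}e : vec3 1 a b = c *: vec3 1 a' b' by rewrite -[LHS](mulmxK uM) e mulmxK.
rewrite vec3Z in e; have := congr1 (fun w : 'rV_3 => w 0 0) e; rewrite !vec3_0 mulr1 => c1.
have := congr1 (fun w : 'rV_3 => w 0 1) e; rewrite !vec3_1 -c1 mul1r => ->.
by have := congr1 (fun w : 'rV_3 => w 0 2%:R) e; rewrite !vec3_2 -c1 mul1r => ->.
Qed.

Lemma affine_part u : value F u = 0 -> (coords u *m invmx M) 0 0 != 0 ->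
  exists a b, ev2 f a b = 0 /\ u = pt (gv (gX M) a b).
Proof.
move=> Fu w0; have E := gX_pt w0; move: E => /= E; eexists; eexists; split; last exact: E.
rewrite ev2_sub2_mev; apply/eqP; rewrite -value_pt_eq0 ?gX_neq0 //; last by exists d.
by rewrite -E Fu.
Qed.

Lemma infinity_finite : finite_set [set u | value F u = 0 /\ (coords u *m invmx M) 0 0 = 0].
Proof.
have [mr _] := revp_monic monic_f size_f (@tdeg_model K M F d hF).
have r0 : fiber (revp d f) 0 != 0.
  by apply: monic_neq0; apply: monic_map.
apply: (sub_finite_set _ (finite_image (fun c => pt (vec3 0 1 c *m M)) (root_finite r0))).
move=> u [Fu w0]; set w := coords u *m invmx M in w0.
have uE : coords u = w *m M by rewrite mulmxKV.
have [w1|w1] := eqVneq (w 0 1) 0.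
  have Ew : w = w 0 2%:R *: vec3 0 0 1 by rewrite {1}[w]vec3E w0 w1 vec3Z !mulr0 mulr1.
  have w20 : w 0 2%:R != 0.
    by apply: contraNneq (coords_neq0 u) => e; rewrite uE Ew e scale0r mul0mx.
  move: Fu; rewrite value_coords uE Ew -scalemxAl (mevZ _ _ hF) F1 mulr1 => /eqP.
  by rewrite expf_eq0 (negPf w20) andbF.
have Ew : w = w 0 1 *: vec3 0 1 (w 0 2%:R / w 0 1).
  by rewrite {1}[w]vec3E w0 vec3Z mulr0 mulr1 mulrC divfK.
exists (w 0 2%:R / w 0 1); last first.
  by rewrite -(ptZ _ w1) scalemxAl -Ew -uE pt_coords.
have := @topev_model K M F d hF (w 0 2%:R / w 0 1); rewrite /topev -fiberE /= => ->.
apply: (mulfI (expf_neq0 d w1)); rewrite mulr0 -(mevZ _ _ hF) scalemxAl -Ew -uE.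
exact: Fu.
Qed.

Let X_affine : exists2 u, X u & (coords u *m invmx M) 0 0 != 0.
Proof.
apply: contrapT => h; apply: (curve_infinite hX); apply: sub_finite_set infinity_finite.
move=> u Xu; split; first exact: FX.
by apply/eqP; apply: contraT => w0; case: h; exists u.
Qed.

(* A monic proper factor of f vanishing on X would homogenize to a form of smaller degree. *)
Let no_factor (P Q : BB) k l : f = P * Q -> P \is monic -> size P = k.+1 ->
  Q \is monic -> size Q = l.+1 -> (0 < k)%N -> (0 < l)%N -> False.
Proof.
move=> E mP sP mQ sQ k0 l0.
have kl : (k + l = d)%N.
  by have := size_f; rewrite E size_Mmonic ?monic_neq0 // sP sQ addnS addSn /= => -[].
have tP : tdeg k P by apply: (tdeg_factor mP sP mQ sQ kl); rewrite -E; apply: tdeg_model.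
have tQ : tdeg l Q.
  by apply: (tdeg_factor mQ sQ mP sP (d := d)); rewrite 1?addnC // mulrC -E; apply: tdeg_model.
pose H m A := hom (cform M 0) (cform M 1) (cform M 2%:R) m A.
have hH m A : H m A \is m.-homog.
  by rewrite -[m in m.-homog]mul1n; apply: hom_homog; apply: linform_homog.
have HE m A u : tdeg m A -> (coords u *m invmx M) 0 0 != 0 ->
   value (H m A) u = (coords u *m invmx M) 0 0 ^+ m *
     ev2 A ((coords u *m invmx M) 0 1 / (coords u *m invmx M) 0 0)
           ((coords u *m invmx M) 0 2%:R / (coords u *m invmx M) 0 0).
  move=> tA w0; rewrite value_coords /mev /H meval_hom -?/(mev _ _) ?mev_cform //.
have nz m A : A \is monic -> size A = m.+1 -> mev (H m A) (vec3 0 0 1 *m M) != 0.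
  move=> mA sA; rewrite /mev meval_hom_sum -!/(mev _ _) !mev_cform mulmxK // vec3_0 vec3_1 vec3_2.
  rewrite (bigD1 ord_max) //= (bigD1 ord0) ?add0n ?leqnn //= subn0 subnn !expr0 expr1n !mulr1.
  have -> : A`_m`_0 = 1 by have := eqP mA; rewrite lead_coefE sA /= => ->; rewrite coef1.
  rewrite !big1 ?addr0 ?oner_neq0 // => [i im|i /andP[im]]; last first.
    by rewrite -val_eqE /=; lia.
  apply: big1 => j ij; case: (nat_of_ord j) ij => [|t] tj; last by rewrite !exprS !mul0r !mulr0 mul0r mulr0.
  have : (0 < m - 0 - i)%N.
    by rewrite subn0 subn_gt0 ltn_neqAle -ltnS ltn_ord andbT.
  by case: (m - 0 - i)%N => // t _; rewrite !exprS !mul0r mulr0.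
have hl0 : homogeneous (cform M 0) by exists 1%N; apply: linform_homog.
have hHom m A : homogeneous (H m A) by exists m.
have irr := hX.1.
have dis u : X u -> value (cform M 0) u * value (H k P * H l Q) u = 0.
  move=> Xu; rewrite valueM [value (cform M 0) u]value_coords mev_cform.
  have [->|w0] := eqVneq ((coords u *m invmx M) 0 0) 0; first by rewrite mul0r.
  rewrite !HE // mulrACA -ev2M -E.
  have fz : ev2 f ((coords u *m invmx M) 0 1 / (coords u *m invmx M) 0 0)
      ((coords u *m invmx M) 0 2%:R / (coords u *m invmx M) 0 0) = 0.
    rewrite ev2_sub2_mev; apply/eqP; rewrite -value_pt_eq0 ?gX_neq0 //; last by exists d.
    by rewrite -(gX_pt w0) FX.
  by rewrite fz !mulr0.
have [h|h] := irreducible_forms irr hl0 (homogeneousM (hHom k P) (hHom l Q)) dis.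
  have [u Xu] := X_affine; have := h u Xu; rewrite value_coords mev_cform => ->.
  by rewrite eqxx.
have [h'|h'] := irreducible_forms irr (hHom k P) (hHom l Q) (fun u Xu => etrans (esym (valueM _ _ _)) (h u Xu)).
  have := nz k P mP sP; rewrite (Fmin _ (hH k P) h') ?eqxx //; lia.
have := nz l Q mQ sQ; rewrite (Fmin _ (hH l Q) h') ?eqxx //; lia.
Qed.

(** If [A] is not prime to f over K(x), Gauss' lemma turns their common factor into a monic factor
    of f of positive degree, which [no_factor] forces to be all of f. *)
Lemma model_plane_curve : plane_curve f d.
Proof.
split=> //; first exact: tdeg_model.
move=> A; have f0 := monic_neq0 monic_f.
have [cop|ncop] := boolP (coprimep A f).
  right; have /Pdiv.Idomain.Bezout_coprimepP [[U V] /=] := cop.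
  rewrite -size_poly_eq1 => /eqP s1; exists U, V, (U * A + V * f)`_0.
  have E : U * A + V * f = ((U * A + V * f)`_0)%:P by apply: size1_polyC; rewrite s1.
  by split=> //; apply: contra_eq_neq s1 => e; rewrite E e polyC0 size_poly0.
left; set G := gcdp A f in ncop.
have /Pdiv.Idomain.dvdpP [[c q] /= c0 E] : G %| f := dvdp_gcdr A f.
have /(gauss_monic monic_f c0) [Q [P [mQ mP Ef sQ]]] : c *: f = G * q by rewrite E mulrC.
have G0 : G != 0 by rewrite gcdp_eq0 negb_and f0 orbT.
have sG : (1 < size G)%N.
  move: ncop; rewrite coprimep_def -/G; move: (size_poly_eq0 G); rewrite (negPf G0).
  by case: (size G) => [|[|]].
have [k sQ1] : exists k, size Q = k.+2 by rewrite sQ; case: (size G) sG => [|[|k]] // _; exists k.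
have [l sP1] : exists l, size P = l.+1.
  by exists (size P).-1; rewrite prednK // lt0n size_poly_eq0 monic_neq0.
have l0 : l = 0%N.
  by apply/eqP; rewrite -leqn0 leqNgt; apply/negP => l0; apply: (no_factor Ef mQ sQ1 mP sP1).
have P1 : P = 1.
  by rewrite (size1_polyC (_ : size P <= 1)%N) ?sP1 ?l0 //; have := eqP mP; rewrite lead_coefE sP1 l0 /= => ->.
have eqGf : G %= f.
  by rewrite -dvdp_size_eqp ?dvdp_gcdr // -sQ Ef P1 mulr1.
have fA : f %| A by rewrite -(eqp_dvdl _ eqGf) dvdp_gcdl.
exact/(Pdiv.IdomainMonic.dvdpP monic_f).
Qed.

(** An equation of X not vanishing on f = 0 would have only finitely many zeros there, yet it
    vanishes on the infinite set X. *)
Lemma model_point a b : ev2 f a b = 0 -> X (pt (gv (gX M) a b)).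
Proof.
move=> fab; have hf := model_plane_curve.
have [[[S [hS XE]] _ _] _] := hX; rewrite XE => G SG.
suff v : van f (sub2 (gX M) G).
  by apply/eqP; rewrite value_pt_eq0 ?gX_neq0 -?ev2_sub2_mev ?v //; apply: hS.
apply: contrapT => /(pc_cof hf) [r r0 hr]; apply: (curve_infinite hX).
apply: (@sub_finite_set _ _ ([set u | value F u = 0 /\ (coords u *m invmx M) 0 0 = 0] `|`
   (fun p => pt (gv (gX M) p.1 p.2)) @` [set p : K * K | ev2 f p.1 p.2 = 0 /\ r.[p.1] = 0])).
  move=> u Xu; have Fu := FX Xu.
  have [w0|w0] := eqVneq ((coords u *m invmx M) 0 0) 0; first by left.
  right; have [a' [b' [fab' e]]] := affine_part Fu w0; exists (a', b') => //=; split=> //.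
  apply: (hr a' b' fab'); rewrite ev2_sub2_mev; apply/eqP.
  rewrite -value_pt_eq0 ?gX_neq0 -?e //; last exact: hS.
  by apply/eqP; move: Xu; rewrite XE; apply.
rewrite finite_setU; split; first exact: infinity_finite.
by apply: finite_image; apply: (finite_fiber hf).
Qed.

End PlaneModel.

Section ModelExistence.
Variable K : numClosedFieldType.
Local Notation BB := {poly {poly K}}.

Lemma row_complete (w : 'rV[K]_3) : w != 0 -> exists2 M : 'M[K]_3, M \in unitmx &
  exists2 c, c != 0 & vec3 0 0 1 *m M = c *: w.
Proof.
move=> /rv_neq0P [i wi].
(* w is the last row, completed by the two unit vectors of indices other than i, where w is
   nonzero. *)
pose M : 'M[K]_3 := \matrix_(j, k) if j == 2%:R then w 0 k else
   (k == (if j == 0 then lift i 0 else lift i 1))%:R.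
have vM (v : 'rV[K]_3) k : (v *m M) 0 k = v 0 0 * M 0 k + v 0 1 * M 1 k + v 0 2%:R * M 2%:R k.
  by rewrite [v in LHS]vec3E vec3_mul.
exists M; last first.
  exists 1; rewrite ?oner_neq0 // scale1r; apply/rowP => k.
  by rewrite vec3_mul !mul0r !add0r mul1r mxE.
rewrite -row_free_unit -kermx_eq0; apply/negPn/negP => /rowV0Pn [v /sub_kermxP vM0 v0].
have e k : v 0 0 * M 0 k + v 0 1 * M 1 k + v 0 2%:R * M 2%:R k = 0 by rewrite -vM vM0 mxE.
have M0 k : M 0 k = (k == lift i 0)%:R by rewrite mxE.
have M1 k : M 1 k = (k == lift i 1)%:R by rewrite mxE.
have M2 k : M 2%:R k = w 0 k by rewrite mxE.
have v2 : v 0 2%:R = 0.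
  have := e i; rewrite M0 M1 M2 !(negPf (neq_lift _ _)) !mulr0 !add0r => /eqP.
  by rewrite mulf_eq0 (negPf wi) orbF => /eqP.
have v00 : v 0 0 = 0.
  by have := e (lift i 0); rewrite M0 M1 M2 v2 mul0r addr0 eqxx (inj_eq lift_inj) mulr0 addr0 mulr1.
have v01 : v 0 1 = 0.
  by have := e (lift i 1); rewrite M0 M1 M2 v2 mul0r addr0 eqxx (inj_eq lift_inj) mulr0 add0r mulr1.
by move: v0; rewrite [v]vec3E v00 v01 v2 (_ : vec3 0 0 0 = 0) ?eqxx // -[0 in RHS](scale0r (vec3 0 0 1)) vec3Z !mul0r.
Qed.

(** In the coordinates given by M the points at infinity are (0 : 1 : c) with c in [cs]. *)
Record plane_model (X : set (projspace K 2)) (M : 'M[K]_3) (f : BB) (d : nat) (cs : seq K) : Prop :=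
 PlaneModel {
  pm_unit : M \in unitmx;
  pm_curve : plane_curve f d;
  pm_infinity : fiber_roots (revp d f) 0 cs /\ uniq cs;
  pm_form : exists F, [/\ F \is d.-homog, forall u, X u -> value F u = 0 & f = sub2 (gX M) F];
  pm_point : forall a b, ev2 f a b = 0 -> X (pt (gv (gX M) a b));
  pm_affine : forall u, X u -> (coords u *m invmx M) 0 0 != 0 ->
      exists a b, ev2 f a b = 0 /\ u = pt (gv (gX M) a b);
  pm_finite : finite_set [set u | X u /\ (coords u *m invmx M) 0 0 = 0] }.

(** A point off the curve is moved to (0 : 0 : 1), which makes f monic in y; then a line x = a
    through that point, with d distinct points on the curve, is moved to infinity. *)
Lemma plane_model_ex (X : set (projspace K 2)) : irreducible_curve X ->
  exists M f d cs, plane_model X M f d cs.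
Proof.
move=> hX; have [d [F [hF FX [w Fw] Fmin]]] := min_form hX.
have w0 : w != 0.
  apply: contraNneq Fw => w0; have [[_ [u Xu] _] _] := hX.
  have := mevZ 0 w hF; rewrite scale0r w0; case: d hF {Fmin} => [|d] hF.
    move=> _; have := mevZ 0 (coords u) hF; rewrite expr0 mul1r scale0r => ->.
    by apply/eqP/(FX u).
  by rewrite exprS !mul0r => ->.
have [M uM [c c0 Mw]] := row_complete w0.
pose F' := (mev F (vec3 0 0 1 *m M))^-1 *: F.
have Fw' : mev F (vec3 0 0 1 *m M) != 0 by rewrite Mw (mevZ _ _ hF) mulf_neq0 // expf_neq0.
have hF' : F' \is d.-homog by apply: rpredZ.
have FX' u : X u -> value F' u = 0.
  by move=> Xu; rewrite /value mevalZ -/(value F u) FX // mulr0.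
have F1 : mev F' (vec3 0 0 1 *m M) = 1 by rewrite /mev mevalZ mulVf.
have hf := model_plane_curve hX uM hF' FX' Fmin F1.
have [r r0 hr] := pc_separable hf; have [a ra] := poly_nonroot r0.
have [cs scs hcs] := fiber_ex a (pc_monic hf) (pc_size hf); have ucs := hr a cs ra hcs.
(* Fixes (0 : 0 : 1) and sends (0 : 1 : c) to (1 : a : c), so that the new line at infinity is the
   old line x = a. *)
pose P : 'M[K]_3 := \matrix_(i, j) (if i == 0 then vec3 0 1 0 else if i == 1 then vec3 1 a 0 else vec3 0 0 1) 0 j.
have rP (v : 'rV[K]_3) : v *m P = vec3 (v 0 1) (v 0 0 + a * v 0 1) (v 0 2%:R).
  apply/rowP => k; rewrite [v]vec3E vec3_mul !vec3_0 !vec3_1 !vec3_2 !mxE /=.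
  by case: k => [[|[|[|//]]] h] /=; ring.
have uP : P \in unitmx.
  rewrite -row_free_unit -kermx_eq0; apply/negPn/negP => /rowV0Pn [v /sub_kermxP vP v0].
  move: vP; rewrite rP => e; have := congr1 (fun w : 'rV_3 => w 0 0) e; rewrite vec3_0 mxE => v1.
  have := congr1 (fun w : 'rV_3 => w 0 1) e; rewrite vec3_1 mxE v1 mulr0 addr0 => v00.
  have := congr1 (fun w : 'rV_3 => w 0 2%:R) e; rewrite vec3_2 mxE => v2.
  move: v0; rewrite [v]vec3E v00 v1 v2 (_ : vec3 0 0 0 = 0) ?eqxx //.
  by rewrite -[0 in RHS](scale0r (vec3 0 0 1)) vec3Z !mul0r.
pose M2 := P *m M.
have uM2 : M2 \in unitmx by rewrite unitmx_mul uP.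
have F12 : mev F' (vec3 0 0 1 *m M2) = 1.
  by rewrite mulmxA rP !vec3_0 !vec3_1 !vec3_2 mulr0 addr0 F1.
exists M2, (sub2 (gX M2) F'), d, cs; split=> //.
- exact: (model_plane_curve hX uM2 hF' FX' Fmin F12).
- split=> //; rewrite /fiber_roots -hcs; apply: (@poly_fun_inj _ _ _ 1); rewrite ?oner_neq0 // => t _.
  rewrite !fiberE -/(topev _ _ _) topev_model // ev2_model //.
  by rewrite mulmxA rP !vec3_0 !vec3_1 !vec3_2 mulr1 add0r.
- by exists F'.
- exact: (model_point hX uM2 hF' FX' Fmin F12).
- by move=> u Xu; apply: (affine_part uM2 hF' (FX' u Xu)).
apply: sub_finite_set (infinity_finite uM2 hF' F12).
by move=> u [Xu w0']; split=> //; apply: FX'.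
Qed.

End ModelExistence.

Section PlaneDegree.
Variable K : numClosedFieldType.
Local Notation BB := {poly {poly K}}.

Lemma ev2_inj (A B : BB) : (forall a b, ev2 A a b = ev2 B a b) -> A = B.
Proof.
move=> h; apply/polyP => i; apply: (@poly_fun_inj _ _ _ 1); rewrite ?oner_neq0 // => a _.
rewrite -!coef_fiber (_ : fiber A a = fiber B a) //.
apply: (@poly_fun_inj _ _ _ 1); rewrite ?oner_neq0 // => b _; by rewrite !fiberE.
Qed.

Lemma tdeg_comb n (g : 'I_n.+1 -> BB) N h : (forall i, tdeg N (g i)) -> tdeg N (comb g h).
Proof.
by move=> tg; apply: tdeg_sum => i _; apply: (@tdegM _ 0 N); first exact: tdeg_c.
Qed.

Lemma Nm1 (f : BB) : Nm f 1 = 1.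
Proof. by rewrite /Nm rmorph1 det1. Qed.

Lemma comb_gX (M : 'M[K]_3) i : M \in unitmx ->
  comb (gX M) (\row_j invmx M j i) = [:: 1; xx K; yy K]`_i.
Proof.
move=> uM; apply: ev2_inj => a b; rewrite ev2_comb gv_gX dotpC.
have -> : dotp (vec3 1 a b *m M) (\row_j invmx M j i) = (vec3 1 a b *m M *m invmx M) 0 i.
  by rewrite [RHS]mxE; apply: eq_bigr => j _; rewrite [X in _ * X = _]mxE.
rewrite mulmxK // mxE; case: i => [[|[|[|//]]] hi] /=; by rewrite ?ev2E.
Qed.

Variables (X : set (projspace K 2)) (M : 'M[K]_3) (f : BB) (d : nat) (cs : seq K).
Hypothesis hM : plane_model X M f d cs.
Let hf := pm_curve hM.

(** The family of linear forms: it contains 1, of norm 1, so D = 1; it contains x, nonzero at every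
    point at infinity, so the norm reaches degree d. *)
Lemma plane_degree : degree X = d.
Proof.
have [hcs _] := pm_infinity hM; have uM := pm_unit hM.
have tg h : tdeg 1 (comb (gX M) h) by apply: tdeg_comb => i; apply: tdeg_gX.
have redE h : redN f (gX M) 1 h = Nm f (comb (gX M) h) by rewrite /redN divp1.
apply: (@degree_family K f d hf 2 (gX M) 1 d (oner_neq0 _) _ _ _ _ 1).
- by move=> h; rewrite dvd1p.
- move=> a; exists (\row_j invmx M j 0); rewrite redE comb_gX // Nm1 hornerC oner_neq0 //.
- by move=> h; rewrite redE; have [+ _] := Nm_infinity hf hcs (tg h); rewrite muln1.
- exists (\row_j invmx M j 1); rewrite redE; have [_] := Nm_infinity hf hcs (tg (\row_j invmx M j 1)).
  rewrite muln1 => ->; rewrite comb_gX //= big1 ?oner_neq0 // => c _; exact: topev_x.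
- exact: oner_neq0.
- by move=> a b _ _; apply: gX_neq0.
- by move=> a b a' b' _ _ _ _; apply: gX_inj.
- by move=> a b fab _; apply: (pm_point hM).
apply: sub_finite_set (pm_finite hM) => u [Xu nu]; split=> //; apply/eqP; apply: contraT => u0.
have [a [b [fab e]]] := pm_affine hM Xu u0; case: nu; exists a, b; split=> //.
by rewrite hornerC oner_neq0.
Qed.

End PlaneDegree.

(** * The contact curve *)

Section ClosureForms.
Variable K : numClosedFieldType.
Local Notation BB := {poly {poly K}}.
Variables (f : BB) (n : nat) (g : 'I_n.+1 -> BB) (q : {poly K}).
Hypothesis gv0 : forall a b, ev2 f a b = 0 -> q.[a] != 0 -> gv g a b != 0.

Lemma comb_delta i : comb g (delta_mx 0 i) = g i.
Proof.
rewrite /comb (bigD1 i) //= big1 => [|j ji].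
  by rewrite mxE !eqxx addr0 /cc !polyC1 mul1r.
by rewrite mxE eqxx /= (negPf ji) /cc !polyC0 mul0r.
Qed.

Lemma dotp_delta i (w : 'rV[K]_n.+1) : dotp (delta_mx 0 i) w = w 0 i.
Proof.
rewrite /dotp (bigD1 i) //= big1 => [|j ji]; first by rewrite mxE !eqxx mul1r addr0.
by rewrite mxE eqxx /= (negPf ji) mul0r.
Qed.

Lemma combD h k : comb g (h + k) = comb g h + comb g k.
Proof.
rewrite /comb -big_split /=; apply: eq_bigr => i _.
by rewrite mxE /cc !rmorphD mulrDl.
Qed.

Lemma im_form (F : {mpoly K[n.+1]}) : homogeneous F ->
  (forall a b, ev2 f a b = 0 -> q.[a] != 0 -> mev F (gv g a b) = 0) ->
  forall u, zclosure (im f g q) u -> mev F (coords u) = 0.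
Proof.
move=> hF h u /zclosureP hu; rewrite -value_coords; apply: hu => // _ [a [b [fab qa ->]]].
by apply/eqP; rewrite value_pt_eq0 ?gv0 // h.
Qed.

End ClosureForms.

Lemma ord4_ind (P : 'I_4 -> Prop) : P 0 -> P 1 -> P 2%:R -> P 3%:R -> forall i, P i.
Proof.
move=> h0 h1 h2 h3 [[|[|[|[|//]]]] hi].
- by rewrite (_ : Ordinal hi = 0) //; apply: val_inj.
- by rewrite (_ : Ordinal hi = 1) //; apply: val_inj.
- by rewrite (_ : Ordinal hi = 2%:R) //; apply: val_inj.
- by rewrite (_ : Ordinal hi = 3%:R) //; apply: val_inj.
Qed.

Section ContactCurve.
Variable K : numClosedFieldType.
Local Notation BB := {poly {poly K}}.
Variables (f : BB) (d : nat).
Hypothesis hf : plane_curve f d.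

Definition contact : 'I_4 -> BB := fun i =>
  [:: dy f; xx K * dy f; - dx f; 2%:R * yy K * dy f + xx K * dx f]`_i.
Local Notation W := contact.

(* x = l1 / l0 and y = l2 / l0 on the contact curve *)
Definition l0 : {mpoly K[4]} := 2%:R *: ('X_0 * 'X_0).
Definition l1 : {mpoly K[4]} := 2%:R *: ('X_0 * 'X_1).
Definition l2 : {mpoly K[4]} := 'X_3%:R * 'X_0 + 'X_1 * 'X_2%:R.

Lemma l_homog : [/\ l0 \is 2.-homog, l1 \is 2.-homog & l2 \is 2.-homog].
Proof.
have h i j : ('X_i * 'X_j : {mpoly K[4]}) \is 2.-homog.
  by rewrite -[2%N]/(1 + 1)%N; apply: dhomogM; apply: homogeneousX.
split; rewrite /l0 /l1 /l2.
by apply: rpredZ; apply: h.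
by apply: rpredZ; apply: h.
apply: rpredD; apply: h.
Qed.

Lemma l_mev (w : 'rV[K]_4) : [/\ mev l0 w = 2%:R * (w 0 0 * w 0 0), mev l1 w = 2%:R * (w 0 0 * w 0 1) &
  mev l2 w = w 0 3%:R * w 0 0 + w 0 1 * w 0 2%:R].
Proof. by rewrite /mev /l0 /l1 /l2 !mevalZ mevalD !mevalM !mevalXU. Qed.

Lemma gvW a b (u := ev2 (dy f) a b) (v := ev2 (dx f) a b) (w := gv W a b) :
  [/\ w 0 0 = u, w 0 1 = a * u, w 0 2%:R = - v & w 0 3%:R = 2%:R * b * u + a * v].
Proof.
by rewrite /w /u /v; split; rewrite mxE /W /= ?ev2E //; ring.
Qed.

Variable q : {poly K}.
Hypothesis q0 : q != 0.
Hypothesis qy : forall a b, ev2 f a b = 0 -> q.[a] != 0 -> ev2 (dy f) a b != 0.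
Local Notation C := (zclosure (im f W q)).

Lemma contact_neq0 a b : ev2 f a b = 0 -> q.[a] != 0 -> gv W a b != 0.
Proof.
move=> fab qa; apply/rv_neq0P; exists 0; have [-> _ _ _] := gvW a b; exact: qy.
Qed.

Lemma contact_l a b : ev2 (dy f) a b != 0 -> [/\ mev l0 (gv W a b) != 0,
  mev l1 (gv W a b) / mev l0 (gv W a b) = a & mev l2 (gv W a b) / mev l0 (gv W a b) = b].
Proof.
move=> u0; have [-> -> ->] := l_mev (gv W a b); have [-> -> -> ->] := gvW a b.
have n2 : 2%:R != 0 :> K by rewrite Num.Theory.pnatr_eq0.
split; first by rewrite !mulf_neq0.
  by field; rewrite ?u0 ?n2.
by field; rewrite ?u0 ?n2.
Qed.

Lemma contact_inj a b a' b' : ev2 f a b = 0 -> q.[a] != 0 -> ev2 f a' b' = 0 -> q.[a'] != 0 ->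
  pt (gv W a b) = pt (gv W a' b') -> a = a' /\ b = b'.
Proof.
move=> fab qa fab' qa' /(pt_eqP (contact_neq0 fab qa) (contact_neq0 fab' qa')) [c c0 e].
have [_ ha hb] := contact_l (qy fab qa); have [_ ha' hb'] := contact_l (qy fab' qa').
have [h0 h1 h2] := l_homog; have k0 : c ^+ 2 != 0 by rewrite expf_neq0.
split; [rewrite -[LHS]ha -[RHS]ha' e (mevZ _ _ h1)|rewrite -[LHS]hb -[RHS]hb' e (mevZ _ _ h2)];
  by rewrite (mevZ _ _ h0) invfM mulrACA divff ?mul1r.
Qed.

Let n2 : 2%:R != 0 :> K. Proof. by rewrite Num.Theory.pnatr_eq0. Qed.

(* On C the point (a, b) is recovered from w, and w is proportional to W (a, b). *)
Lemma contact_relations u (w := coords u) : C u -> w 0 0 != 0 ->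
  let a := w 0 1 / w 0 0 in let b := mev l2 w / mev l0 w in
  [/\ mev l0 w != 0, mev l1 w / mev l0 w = a, ev2 f a b = 0 &
      ev2 (dy f) a b *: w = w 0 0 *: gv W a b].
Proof.
move=> Cu w0 a b; have [e0 e1 e2] := l_mev w; have [h0 h1 h2] := l_homog.
have l00 : mev l0 w != 0 by rewrite e0 !mulf_neq0.
have ea : mev l1 w / mev l0 w = a by rewrite e0 e1 /a; field; rewrite ?n2 ?w0.
have fab : ev2 f a b = 0.
  have hF : homogeneous (hom l0 l1 l2 d f) by exists (2 * d)%N; apply: hom_homog.
  have vF a' b' : ev2 f a' b' = 0 -> q.[a'] != 0 -> mev (hom l0 l1 l2 d f) (gv W a' b') = 0.
    move=> f' q'; have [n0 ea' eb'] := contact_l (qy f' q').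
    rewrite /mev meval_hom //; first by rewrite -!/(mev _ _) ea' eb' f' mulr0.
    exact: pc_tdeg hf.
  have := im_form contact_neq0 hF vF Cu; rewrite /mev meval_hom //; last exact: pc_tdeg hf.
  by rewrite -!/(mev _ _) ea => /eqP; rewrite mulf_eq0 expf_eq0 (negPf l00) andbF => /eqP.
(* The slope relation w0 f_x + w2 f_y = 0, homogenized in w. *)
split=> //; pose H := 'X_0 * hom l0 l1 l2 d.-1 (dx f) + 'X_2%:R * hom l0 l1 l2 d.-1 (dy f).
have tx : tdeg d.-1 (dx f) by apply: tdeg_dx; apply: pc_tdeg hf.
have ty : tdeg d.-1 (dy f) by apply: tdeg_dy; apply: pc_tdeg hf.
have HE w' : mev l0 w' != 0 -> mev H w' = mev l0 w' ^+ d.-1 *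
  (w' 0 0 * ev2 (dx f) (mev l1 w' / mev l0 w') (mev l2 w' / mev l0 w') +
   w' 0 2%:R * ev2 (dy f) (mev l1 w' / mev l0 w') (mev l2 w' / mev l0 w')).
  by move=> n0; rewrite /mev mevalD !mevalM !meval_hom // !mevalXU; ring.
have hH : homogeneous H.
  exists (1 + 2 * d.-1)%N; apply: rpredD; apply: dhomogM; by [apply: homogeneousX|apply: hom_homog].
have vH a' b' : ev2 f a' b' = 0 -> q.[a'] != 0 -> mev H (gv W a' b') = 0.
  move=> f' q'; have [n0 ea' eb'] := contact_l (qy f' q'); rewrite HE // ea' eb'.
  by have [-> _ -> _] := gvW a' b'; ring.
have := im_form contact_neq0 hH vH Cu; rewrite HE // ea => /eqP.
rewrite mulf_eq0 expf_eq0 (negPf l00) andbF /= -/b => /eqP e.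
have eb : 2%:R * b * w 0 0 = w 0 3%:R + a * w 0 2%:R.
  by rewrite /b e0 e2 /a; field; rewrite ?n2 ?w0.
have ea1 : a * w 0 0 = w 0 1 by rewrite divfK.
have [g0 g1 g2 g3] := gvW a b; move: (ev2 (dx f) a b) (ev2 (dy f) a b) e g0 g1 g2 g3 => v v' e g0 g1 g2 g3.
have w2 : w 0 2%:R * v' = - (w 0 0 * v) by apply/eqP; rewrite -addr_eq0 addrC e.
have key (i : 'I_4) : v' * w 0 i = w 0 0 * gv W a b 0 i.
  elim/ord4_ind: i.
  - by rewrite g0 mulrC.
  - by rewrite g1 -ea1; ring.
  - by rewrite g2 mulrC w2; ring.
  - rewrite g3; have -> : w 0 3%:R = 2%:R * b * w 0 0 - a * w 0 2%:R by rewrite eb; ring.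
    by rewrite mulrBr [v' * (a * _)]mulrCA [v' * w 0 2%:R]mulrC w2; ring.
by apply/rowP => i; rewrite !mxE -[RHS](_ : w 0 0 * gv W a b 0 i = _) ?key // mxE.
Qed.

Lemma contact_im u (w := coords u) : C u -> w 0 0 != 0 -> q.[w 0 1 / w 0 0] != 0 -> im f W q u.
Proof.
move=> Cu w0 qa; have [_ _ fab e] := contact_relations Cu w0.
exists (w 0 1 / w 0 0), (mev l2 w / mev l0 w); split=> //.
by rewrite -(ptZ _ w0) -e ptZ ?pt_coords //; apply: qy.
Qed.

(** A point of the closure outside the image lies on w0 = 0 or on w1 = a w0 for a root a of q, and
    none of these hyperplanes contains the curve. *)
Lemma contact_finite : finite_set (C `\` im f W q).
Proof.
have nu : ~ van f (dy f) := nvan_dy hf.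
apply: (@sub_finite_set _ _ ([set u | C u /\ dotp (delta_mx 0 0) (coords u) = 0] `|`
  \bigcup_(a in [set a | q.[a] = 0])
    [set u | C u /\ dotp (delta_mx 0 1 - a *: delta_mx 0 0) (coords u) = 0])).
  move=> u [Cu nu']; have [w0|w0] := eqVneq (coords u 0 0) 0.
    by left; split=> //; rewrite dotp_delta.
  right; exists (coords u 0 1 / coords u 0 0).
    by apply/eqP; apply: contraT => qa; case: nu'; apply: contact_im.
  split=> //; rewrite dotpDl -scaleNr dotpZl !dotp_delta.
  by rewrite mulNr divfK // subrr.
rewrite finite_setU; split.
  apply: (closure_hyperplane hf q0 contact_neq0) => //.
  by rewrite comb_delta.
apply: bigcup_finite; first exact: root_finite.
move=> a _; apply: (closure_hyperplane hf q0 contact_neq0) => //.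
rewrite combD -scaleNr combZ !comb_delta /W /=.
have -> : xx K * dy f + cc (- a) * dy f = ('X - a%:P)%:P * dy f.
  by rewrite -mulrDl /xx /cc !rmorphN rmorphB.
by case/(van_mul hf) => [|/nu //]; apply: (nvan_C hf); rewrite polyXsubC_eq0.
Qed.

Lemma contact_curve : irreducible_curve C.
Proof.
by apply: (image_curve hf q0 contact_neq0 contact_inj); apply: contact_finite.
Qed.

End ContactCurve.

Section FormSubstitution.
Variables (K : numClosedFieldType) (n : nat).

Lemma homog_prod I (s : seq I) (F : I -> {mpoly K[n.+1]}) (N : I -> nat) :
  (forall i, F i \is (N i).-homog) -> \prod_(i <- s) F i \is (\sum_(i <- s) N i)%N.-homog.
Proof.
move=> hF; elim: s => [|i s IH]; first by rewrite !big_nil dhomog1.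
by rewrite !big_cons; apply: dhomogM.
Qed.

Definition fv m (L : 'I_m.+1 -> {mpoly K[n.+1]}) (w : 'rV[K]_n.+1) : 'rV[K]_m.+1 := \row_j mev (L j) w.

Lemma fvZ m (L : 'I_m.+1 -> {mpoly K[n.+1]}) k c w : (forall j, L j \is k.-homog) ->
  fv L (c *: w) = c ^+ k *: fv L w.
Proof. by move=> hL; apply/rowP => j; rewrite !mxE (mevZ _ _ (hL j)). Qed.

Lemma form_sub m (L : 'I_m.+1 -> {mpoly K[n.+1]}) k (F : {mpoly K[m.+1]}) d :
  (forall j, L j \is k.-homog) -> F \is d.-homog ->
  exists2 G : {mpoly K[n.+1]}, G \is (k * d).-homog & forall w, mev G w = mev F (fv L w).
Proof.
move=> hL hF; exists (\sum_(m <- msupp F) F@_m *: \prod_i L i ^+ m i).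
  rewrite big_seq; apply: rpred_sum => mm mF; apply: rpredZ.
  rewrite -(dhomog_mf hF mF) /= mdegE big_distrr /=; apply: homog_prod => i.
  exact: dhomogMn.
move=> w; rewrite [in RHS]/mev [in RHS](mpolyE F) [in LHS]/mev !raddf_sum /=.
apply: eq_bigr => mm _; rewrite !mevalZ mevalX rmorph_prod; congr (_ * _).
by apply: eq_bigr => i _; rewrite /= rmorphXn /= -/(mev _ _) mxE.
Qed.

Lemma form_linear_sub (M : 'M[K]_n.+1) (F : {mpoly K[n.+1]}) d : F \is d.-homog ->
  exists2 G : {mpoly K[n.+1]}, G \is d.-homog & forall w, mev G w = mev F (w *m M).
Proof.
move=> hF; have [j|G hG GE] := form_sub (L := fun i => linform (\row_j M j i)) (k := 1) _ hF.
  exact: linform_homog.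
exists G => [|w]; first by rewrite -[d]mul1n.
rewrite GE; congr (mev F _); apply/rowP => i; rewrite !mxE mev_linform dotpC.
by apply: eq_bigr => j _; rewrite mxE.
Qed.

End FormSubstitution.

(** * Osculating planes of the contact curve *)

Section Osculation.
Variable K : numClosedFieldType.
Local Notation BB := {poly {poly K}}.
Variables (f : BB) (d : nat).
Hypothesis hf : plane_curve f d.
Local Notation W := (contact f).
Local Notation "'δ' A" := (delta f A) (at level 10, A at level 9).

Lemma dotp4 (v w : 'rV[K]_4) :
  dotp v w = v 0 0 * w 0 0 + v 0 1 * w 0 1 + v 0 2%:R * w 0 2%:R + v 0 3%:R * w 0 3%:R.
Proof.
rewrite /dotp !big_ord_recl big_ord0 addr0 !addrA.
congr (_ + v _ _ * w _ _ + v _ _ * w _ _ + v _ _ * w _ _); exact: val_inj.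
Qed.

(** Matrix of the symplectic form: [w *m Om] is (- w3, - w2, w1, w0), the coordinates of the plane
    attached to w. *)
Definition Om : 'M[K]_4 := \matrix_(i, j) if j == rev_ord i then (if (j < 2)%N then -1 else 1) else 0.

Lemma mul_Om (w : 'rV[K]_4) : [/\ (w *m Om) 0 0 = - w 0 3%:R, (w *m Om) 0 1 = - w 0 2%:R,
  (w *m Om) 0 2%:R = w 0 1 & (w *m Om) 0 3%:R = w 0 0].
Proof.
have E j : (w *m Om) 0 j = w 0 (rev_ord j) * (if (j < 2)%N then -1 else 1).
  rewrite mxE (bigD1 (rev_ord j)) //= big1 => [|i ij]; first by rewrite mxE rev_ordK eqxx addr0.
  by rewrite mxE ifN ?mulr0 // -(inj_eq rev_ord_inj) rev_ordK eq_sym.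
split; rewrite E /= ?mulrN1 ?mulr1; congr (_ (w _ _)) || congr (w _ _); exact: val_inj.
Qed.

Lemma Om_unit : Om \in unitmx.
Proof.
have E : Om *m (- Om) = 1%:M.
  apply/row_matrixP => i; rewrite !rowE !mulmxN mulmxA mulmx1; move: (delta_mx 0 i) => v.
  have [a0 a1 a2 a3] := mul_Om (v *m Om); have [b0 b1 b2 b3] := mul_Om v.
  by apply/rowP; elim/ord4_ind; rewrite mxE ?a0 ?a1 ?a2 ?a3 ?b0 ?b1 ?b2 ?b3 ?opprK.
by have [] := mulmx1_unit E.
Qed.

Lemma delta_comb n (g : 'I_n.+1 -> BB) h : δ (comb g h) = comb (fun i => δ (g i)) h.
Proof.
rewrite /comb; elim/big_rec2: _ => [|i A B _ IH]; first exact: delta0.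
by rewrite deltaD deltaM delta_c mul0r add0r -IH.
Qed.

Definition jetW (k : nat) : 'I_4 -> BB := fun i => iter k (delta f) (W i).

Let W3 : 2%:R * yy K * dy f = (yy K + yy K) * dy f.
Proof. by rewrite mulr_natl mulr2n. Qed.

Section JetCoordinates.
Variables a b : K.
Let u := ev2 (dy f) a b. Let v := ev2 (dx f) a b.
Let u1 := ev2 (δ (dy f)) a b. Let v1 := ev2 (δ (dx f)) a b.
Let u2 := ev2 (δ (δ (dy f))) a b. Let v2 := ev2 (δ (δ (dx f))) a b.

Lemma gv_jet1 (w := gv (jetW 1) a b) : [/\ w 0 0 = u1, w 0 1 = u ^+ 2 + a * u1, w 0 2%:R = - v1 &
  w 0 3%:R = 2%:R * b * u1 + a * v1 - u * v].
Proof.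
rewrite /w /u /u1 /v /v1; split; rewrite mxE /jetW /= /contact /= ?W3 ?deltaE ?ev2E //; ring.
Qed.

Lemma gv_jet2 (w := gv (jetW 2) a b) : [/\ w 0 0 = u2, w 0 1 = 3%:R * u * u1 + a * u2, w 0 2%:R = - v2 &
  w 0 3%:R = 2%:R * b * u2 + a * v2 - 3%:R * v * u1].
Proof.
rewrite /w /u /u1 /v /v1 /u2 /v2; split; rewrite mxE /jetW /= /contact /= ?W3 ?deltaE ?ev2E //; ring.
Qed.

Lemma ev2_flex : ev2 (flex f) a b = u * v * u2 + 3%:R * u1 * (u * v1 - v * u1) - u ^+ 2 * v2.
Proof.
rewrite /flex (_ : 3%:R = cc 3%:R); last by rewrite /cc !rmorph_nat.
by rewrite !ev2E.
Qed.

(** Eliminating h0 and h1 from the three conditions leaves (h2 - a h3) flex = 0; then h2 = a h3, and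
    h0 and h1 are determined by h3. *)
Lemma osculating_plane_unique (h : 'rV[K]_4) : u != 0 -> ev2 (flex f) a b != 0 ->
  (forall k, (k < 3)%N -> dotp h (gv (jetW k) a b) = 0) -> u *: h = h 0 3%:R *: (gv W a b *m Om).
Proof.
move=> u0; rewrite ev2_flex => fl0 e.
have := e 0%N isT; have := e 1%N isT; have := e 2%N isT; rewrite !dotp4.
have [-> -> -> ->] := gv_jet2; have [-> -> -> ->] := gv_jet1; have [-> -> -> ->] := gvW f a b.
rewrite -/u -/v; set h0 := h 0 0; set h1 := h 0 1; set h2 := h 0 2%:R; set h3 := h 0 3%:R.
set E3 := (h0 * u2 + _ + _ + _); set E2 := (h0 * u1 + _ + _ + _); set E1 := (h0 * u + _ + _ + _).
move=> z3 z2 z1.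
have /eqP : (h2 - a * h3) * (u * v * u2 + 3%:R * u1 * (u * v1 - v * u1) - u ^+ 2 * v2) = 0.
  transitivity (u ^+ 2 * E3 - u * u2 * E1 - 3%:R * u * u1 * E2 + 3%:R * u1 ^+ 2 * E1).
    by rewrite /E1 /E2 /E3; ring.
  by rewrite z1 z2 z3; ring.
rewrite mulf_eq0 (negPf fl0) orbF subr_eq0 => /eqP k2.
have /eqP : (h0 + a * h1 + 2%:R * b * h3) * u = 0.
  by rewrite -z1 /E1 k2; ring.
rewrite mulf_eq0 (negPf u0) orbF => /eqP S0.
have /eqP : (h1 * u - h3 * v) * u = 0.
  transitivity (E2 - (h0 + a * h1 + 2%:R * b * h3) * u1); first by rewrite /E2 k2; ring.
  by rewrite z2 S0; ring.
rewrite mulf_eq0 (negPf u0) orbF subr_eq0 => /eqP k1.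
have k0 : h0 = - (a * h1 + 2%:R * b * h3) by apply/eqP; rewrite -addr_eq0 addrA S0.
have [m0 m1 m2 m3] := mul_Om (gv W a b); have [w0 w1 w2 w3] := gvW f a b.
have E i : (u *: h) 0 i = u * h 0 i /\ (h3 *: (gv W a b *m Om)) 0 i = h3 * (gv W a b *m Om) 0 i.
  by rewrite [LHS]mxE; split=> //; rewrite [LHS]mxE.
apply/rowP; elim/ord4_ind; rewrite (E _).1 (E _).2.
- rewrite -/h0 m0 w3 k0 -/u -/v; transitivity (- (a * (h1 * u) + 2%:R * b * h3 * u)); first by ring.
  by rewrite k1; ring.
- by rewrite -/h1 m1 w2 -/v mulrC k1; ring.
- by rewrite -/h2 m2 w1 -/u k2; ring.
by rewrite -/h3 m3 w0 mulrC.
Qed.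

Lemma osculating_plane_ex k : (k < 3)%N -> dotp (gv W a b *m Om) (gv (jetW k) a b) = 0.
Proof.
have [m0 m1 m2 m3] := mul_Om (gv W a b); have [w0 w1 w2 w3] := gvW f a b.
rewrite dotp4 m0 m1 m2 m3 w0 w1 w2 w3 -/u -/v; case: k => [|[|[|//]]] _.
- by have [-> -> -> ->] := gvW f a b; rewrite -/u -/v; ring.
- by have [-> -> -> ->] := gv_jet1; ring.
by have [-> -> -> ->] := gv_jet2; ring.
Qed.

Lemma vord3_jet h : ev2 f a b = 0 -> u != 0 ->
  vord f a b 3 (comb W h) <-> forall k, (k < 3)%N -> dotp h (gv (jetW k) a b) = 0.
Proof.
move=> fab u0; rewrite (vord3P hf fab u0) !delta_comb !ev2_comb; split=> [[z0 z1 z2]|z].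
  by case=> [|[|[|//]]] _.
by split; [apply: (z 0%N)|apply: (z 1%N)|apply: (z 2%N)].
Qed.

End JetCoordinates.

Section AtPoint.
Variable q : {poly K}.
Hypothesis q0 : q != 0.
Hypothesis qy : forall a b, ev2 f a b = 0 -> q.[a] != 0 -> ev2 (dy f) a b != 0.
Local Notation C := (zclosure (im f W q)).
Variables a b : K.
Hypotheses (fab : ev2 f a b = 0) (qa : q.[a] != 0).
Let fy := qy fab qa.
Let p0 := pt (gv W a b).
Let w0 : gv W a b != 0. Proof. exact: (contact_neq0 qy). Qed.

Lemma vord_any A : vord f a b 0 A.
Proof. by exists 1, A; rewrite ev2_1 oner_neq0 expr0 subrr; split=> // x y _; rewrite ev2_0. Qed.

Lemma vordMl k A B : vord f a b k B -> vord f a b k (A * B).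
Proof. by rewrite -[k in X in _ -> X]add0n; apply: vordM; apply: vord_any. Qed.

Lemma vord_prod k (A : 'I_k -> BB) : (forall j, vord f a b 1 (A j)) -> vord f a b k (\prod_j A j).
Proof.
elim: k A => [|k IH] A hA; first exact: vord_any.
by rewrite big_ord_recl; apply: (@vordM _ _ _ _ 1 k) => //; apply: IH => j.
Qed.

Lemma vord_sum k r (A : 'I_r -> BB) : (forall j, vord f a b k (A j)) -> vord f a b k (\sum_j A j).
Proof.
by move=> hA; apply: (big_ind (vord f a b k)) => //; [apply: vord0|apply: vordD].
Qed.

Lemma zopen_form n (U : set (projspace K n)) x : zopen U -> U x ->
  exists F, [/\ homogeneous F, value F x != 0 & forall y, value F y != 0 -> U y].
Proof.
move=> [S [hS E]] Ux.
have /existsNP [F /not_implyP [SF /eqP Fx]] : ~ forall F, S F -> value F x = 0.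
  by move=> h; have : (~` U) x by [rewrite E]; apply.
exists F; split=> //; first exact: hS.
move=> y Fy; apply: contrapT => nU; have : (~` U) y by [].
by rewrite E => /(_ _ SF) e; move: Fy; rewrite e eqxx.
Qed.

Lemma value_ratio n (F G : {mpoly K[n.+1]}) k v : F \is k.-homog -> G \is k.-homog -> v != 0 ->
  value F (pt v) / value G (pt v) = mev F v / mev G v.
Proof.
move=> hF hG v0; rewrite !value_coords; have [c c0 ->] := coords_pt v0.
rewrite (mevZ _ _ hF) (mevZ _ _ hG) invfM mulrACA divff ?mul1r // expf_neq0 //.
Qed.

(** The local functions are pulled back to the affine curve and their denominators cleared; each
    numerator vanishes at (a, b), hence has order at least 1, and products of three have order at
    least 3. *)
Lemma osculates_vord h : osculates C p0 h -> vord f a b 3 (comb W (coords h)).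
Proof.
case=> _ [g gx [r [A [hA [U [oU Ux hU]]]]]].
have [H [hH Hx HU]] := zopen_form oU Ux.
have {hA} hA (ij : 'I_r * 'I_3) : {FG : {mpoly K[4]} * {mpoly K[4]} | exists k,
   [/\ FG.1 \is k.-homog, FG.2 \is k.-homog, mev FG.1 (gv W a b) = 0, mev FG.2 (gv W a b) != 0 &
    forall y, C y -> value FG.2 y != 0 -> A ij.1 ij.2 y = value FG.1 y / value FG.2 y]}.
  apply: cid; have [[k [F [G [hF hG Gx FG]]]] Ax] := hA ij.1 ij.2; exists (F, G), k; split=> //=.
  - have Cp : C p0 by apply: sub_zclosure; exists a, b.
    move/eqP: (FG _ Cp Gx); rewrite Ax eq_sym mulf_eq0 invr_eq0 (negPf Gx) orbF.
    by rewrite value_pt_eq0 // => [/eqP //|]; exists k.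
  - by move: Gx; rewrite value_pt_eq0 //; exists k.
pose Fm ij := (sval (hA ij)).1; pose Gm ij := (sval (hA ij)).2.
pose FF ij := sub2 W (Fm ij); pose GG ij := sub2 W (Gm ij).
have FG0 ij : ev2 (FF ij) a b = 0 by rewrite ev2_sub2_mev; have [k []] := svalP (hA ij).
have GG0 ij : ev2 (GG ij) a b != 0 by rewrite ev2_sub2_mev; have [k []] := svalP (hA ij).
pose P := comb W (coords h); pose Q := comb W (coords g).
have Q0 : ev2 Q a b != 0.
  by rewrite ev2_comb -(pairing_pt (coords_neq0 g) w0) pt_coords.
have H0 : ev2 (sub2 W H) a b != 0 by rewrite ev2_sub2_mev -value_pt_eq0.
pose Den := \prod_ij GG ij.
have Den0 : ev2 Den a b != 0 by rewrite ev2_prod; apply/prodf_neq0 => ij _.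
(* The sum of products of the local functions, multiplied by [Den] cubed: one [Den] for each of the
   three factors. *)
pose S := \sum_i \prod_j (FF (i, j) * \prod_(ij | ij != (i, j)) GG ij).
have SE (x y : K) : (forall ij, ev2 (GG ij) x y != 0) -> exists2 e, e != 0 &
   ev2 S x y * e = ev2 Den x y ^+ 3 * e * \sum_i \prod_j (ev2 (FF (i, j)) x y / ev2 (GG (i, j)) x y).
  move=> nG; exists 1; rewrite ?oner_neq0 // !mulr1 /S ev2_sum mulr_sumr; apply: eq_bigr => i _.
  have -> : ev2 Den x y ^+ 3 = \prod_(j < 3) ev2 Den x y by rewrite prodr_const card_ord.
  rewrite ev2_prod -big_split /=; apply: eq_bigr => j _.
  rewrite ev2M /Den ev2_prod [in RHS](bigD1 (i, j)) //= ev2_prod; field; exact: nG.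
(* The equality of h / g with that sum, cleared of denominators. It is known only where q, H, Den
   and Q are nonzero; primality of the ideal extends it to the whole curve. *)
pose E := Den ^+ 3 * P - Q * S.
have vE : van f E.
  have nz B : ev2 B a b != 0 -> van f (B * E) -> van f E.
    move=> B0 /(van_mul hf) [vB|//]; by move: B0; rewrite vB ?eqxx.
  apply: (nz (q%:P * sub2 W H * Den * Q)).
    by rewrite !ev2E ev2C !mulf_neq0.
  move=> x y fxy; rewrite [LHS]ev2M.
  have [->|] := eqVneq (ev2 (q%:P * sub2 W H * Den * Q) x y) 0; first by rewrite mul0r.
  rewrite !ev2M ev2C !mulf_eq0 !negb_or => /andP[/andP[/andP[qx Hxy]] Dxy Qxy].
  have nG ij : ev2 (GG ij) x y != 0.
    by apply: contraNneq Dxy => z; rewrite /Den ev2_prod (bigD1 ij) //= z mul0r.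
  have wxy : gv W x y != 0 by exact: (contact_neq0 qy).
  pose y0 := pt (gv W x y); have Cy : C y0 by apply: sub_zclosure; exists x, y.
  have Uy : U y0 by apply: HU; rewrite value_pt_eq0 // -ev2_sub2_mev.
  have := hU y0 Cy Uy.
  have AE i j : A i j y0 = ev2 (FF (i, j)) x y / ev2 (GG (i, j)) x y.
    have [k [hF hG _ _ e]] := svalP (hA (i, j)).
    rewrite !ev2_sub2_mev -(value_ratio hF hG wxy); apply: e => //.
    by rewrite value_pt_eq0 //; [rewrite -ev2_sub2_mev; apply: nG|exists k].
  under eq_bigr do under eq_bigr do rewrite AE.
  have -> : pairing h y0 / pairing g y0 = ev2 P x y / ev2 Q x y.
    rewrite !ev2_comb /pairing -!/(dotp _ _); have [c c0 ->] := coords_pt wxy.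
    by rewrite !dotpZr invfM mulrACA divff ?mul1r.
  move=> e; have [c c0 Se] := SE x y nG; apply/eqP; rewrite mulf_eq0; apply/orP; right.
  rewrite !ev2E subr_eq0; apply/eqP; apply: (mulIf c0); rewrite -[RHS]mulrA Se -e; field.
  exact: Qxy.
have vS : vord f a b 3 S.
  apply: vord_sum => i; apply: vord_prod => j; rewrite mulrC; apply: vordMl.
  by apply: vord1.
apply: (@vord_unit _ _ _ _ _ (Den ^+ 3)); first by rewrite ev2_exp expf_neq0.
apply: (@vord_ext _ _ _ _ _ (Q * S)); last exact: vordMl.
by move=> x y fxy; rewrite ev2B; have := vE x y fxy; rewrite ev2B => /eqP; rewrite subr_eq0 => /eqP ->; rewrite subrr.
Qed.

End AtPoint.

End Osculation.

(** * Self-duality of the contact curve *)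

Section SelfDuality.
Variable K : numClosedFieldType.
Local Notation BB := {poly {poly K}}.
Variables (f : BB) (d : nat).
Hypothesis hf : plane_curve f d.
Local Notation W := (contact f).
Variable q : {poly K}.
Hypothesis q0 : q != 0.
Hypothesis qy : forall a b, ev2 f a b = 0 -> q.[a] != 0 -> ev2 (dy f) a b != 0.
Hypothesis qflex : forall a b, ev2 f a b = 0 -> q.[a] != 0 -> ev2 (flex f) a b != 0.
Local Notation C := (zclosure (im f W q)).

(** The local equation is divided by w0 and written as (x - a)^3 A / (s f_y), up to a constant, with
    every factor a quotient of forms in w. *)
Lemma vord_osculates a b h : ev2 f a b = 0 -> q.[a] != 0 -> vord f a b 3 (comb W (coords h)) ->
  osculates C (pt (gv W a b)) h.
Proof.
move=> fab qa [s [A [sab vs]]].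
have u0 := qy fab qa; have w0 := contact_neq0 qy fab qa.
have [[gw0 _ _ _] [l00 ea eb]] := (gvW f a b, contact_l u0).
have [N1 t1] := tdeg_ex A; have [N2 t2] := tdeg_ex (s * dy f).
(* Homogenizing A and s f_y in one degree N makes their ratio a quotient of forms of equal
   degree. *)
pose N := maxn N1 N2; have {}t1 : tdeg N A by apply: tdeg_leq t1; rewrite leq_maxl.
have {}t2 : tdeg N (s * dy f) by apply: tdeg_leq t2; rewrite leq_maxr.
have [h0 h1 h2] := l_homog K.
pose H1 := hom (l0 K) (l1 K) (l2 K) N A; pose H2 := hom (l0 K) (l1 K) (l2 K) N (s * dy f).
have hH1 : H1 \is (2 * N).-homog by apply: hom_homog.
have hH2 : H2 \is (2 * N).-homog by apply: hom_homog.
have hX i : ('X_i : {mpoly K[4]}) \is 1.-homog by apply: homogeneousX.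
pose F0 : {mpoly K[4]} := 'X_1 - a *: 'X_0.
have hF0 : F0 \is 1.-homog by apply: rpredB => //; apply: rpredZ.
have H2p : mev H2 (gv W a b) != 0.
  by rewrite /mev meval_hom // -!/(mev _ _) ea eb ev2M !mulf_neq0 // expf_neq0.
have e0 : delta_mx 0 0 != 0 :> 'rV[K]_4 by apply/rv_neq0P; exists 0; rewrite mxE !eqxx oner_neq0.
pose g := pt (delta_mx 0 0 : 'rV[K]_4); have [c c0 eg] := coords_pt e0.
have pg y : pairing g y = c * coords y 0 0 by rewrite /pairing -/(dotp _ _) eg dotpZl dotp_delta.
have hF1 : F0 * H1 \is (1 + 2 * N).-homog by apply: dhomogM.
have hG1 : c *: ('X_0 * H2) \is (1 + 2 * N).-homog by apply: rpredZ; apply: dhomogM.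
have Gx : value 'X_0 (pt (gv W a b)) != 0.
  by rewrite value_pt_eq0 //; [rewrite /mev mevalXU gw0|exists 1%N].
have G1x : value (c *: ('X_0 * H2)) (pt (gv W a b)) != 0.
  rewrite value_pt_eq0 //; last by exists (1 + 2 * N)%N.
  by rewrite /mev mevalZ mevalM mevalXU gw0 !mulf_neq0.
have F0x : value F0 (pt (gv W a b)) = 0.
  apply/eqP; rewrite value_pt_eq0 //; last by exists 1%N.
  by rewrite /mev mevalB mevalZ !mevalXU; have [-> -> _ _] := gvW f a b; rewrite subrr.
have hyp : dotp (coords h) (gv W a b) = 0.
  by have := vs a b fab; rewrite !ev2E subrr exprS !mul0r subr0 ev2_comb => /eqP; rewrite mulf_eq0 (negPf sab) => /eqP.
split.
  by apply/eqP; rewrite -[h]pt_coords pairing_pt ?coords_neq0 // hyp.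
exists g; first by rewrite pairing_pt // dotp_delta gw0.
(* A single product of three factors: x - a twice, and (x - a) A / (c s f_y), where c comes from the
   coordinates chosen for g. *)
exists 1%N, (fun _ j => if (j == 2%:R :> 'I_3) then fun y => value (F0 * H1) y / value (c *: ('X_0 * H2)) y
   else fun y => value F0 y / value 'X_0 y); split.
  move=> i j; case: ifP => _; split.
  - by exists (1 + 2 * N)%N, (F0 * H1), (c *: ('X_0 * H2)).
  - by rewrite valueM F0x !mul0r.
  - by exists 1%N, F0, 'X_0.
  - by rewrite F0x mul0r.
exists [set y | value (c *: ('X_0 * H2)) y != 0]; split=> //.
  rewrite /zopen (_ : ~` _ = [set y | value (c *: ('X_0 * H2)) y = 0]).
    by apply: zclosed_form; exists (1 + 2 * N)%N.
  apply/seteqP; split=> y /=; first by move=> /negP; rewrite negbK => /eqP.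
  by move=> ->; rewrite eqxx.
move=> y Cy /= Uy; rewrite big_ord1 !big_ord_recl big_ord0 mulr1 /= pg.
move: Uy; rewrite !value_coords; set w := coords y.
rewrite /mev !mevalM !mevalZ mevalB mevalZ !mevalM !mevalXU => nz.
have y0 : w 0 0 != 0 by apply: contraNneq nz => ->; rewrite mul0r mulr0.
have [] := contact_relations hf qy Cy y0; rewrite -/w; set b' := mev (l2 K) w / _; set a' := w 0 1 / _.
move=> n0 ea' f' ew; move: nz; rewrite !meval_hom // -!/(mev _ _) ea' -/b' => nz.
have [s' u'] : ev2 s a' b' != 0 /\ ev2 (dy f) a' b' != 0.
  by move: nz; rewrite ev2M !mulf_eq0 !negb_or => /and4P[_ _ _ /andP[]].
have w1 : w 0 1 = a' * w 0 0 by rewrite divfK.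
have hw : ev2 (dy f) a' b' * dotp (coords h) w = w 0 0 * ev2 (comb W (coords h)) a' b'.
  by rewrite ev2_comb -!dotpZr ew.
have := vs a' b' f'; rewrite !ev2E => /eqP; rewrite subr_eq0 => /eqP sP.
rewrite /pairing -/(dotp _ _) -/w w1.
have -> : dotp (coords h) w = w 0 0 * (a' - a) ^+ 3 * ev2 A a' b' / (ev2 s a' b' * ev2 (dy f) a' b').
  apply: (mulfI u'); rewrite hw; apply: (mulfI s'); rewrite mulrCA sP; field; by rewrite s' u'.
by field; rewrite c0 y0 s' u' expf_neq0.
Qed.

Lemma dual_neq0 (w : 'rV[K]_4) : w != 0 -> w *m Om K != 0.
Proof.
by apply: contraNneq => e; rewrite -[w](mulmxK (Om_unit K)) e mul0mx.
Qed.

Lemma Osc2P a b h : ev2 f a b = 0 -> q.[a] != 0 ->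
  is_Osc2 C (pt (gv W a b)) h <-> h = pt (gv W a b *m Om K).
Proof.
move=> fab qa; have u0 := qy fab qa; have fl0 := qflex fab qa.
have w0 := contact_neq0 qy fab qa.
have uniq_h k : osculates C (pt (gv W a b)) k -> k = pt (gv W a b *m Om K).
  move=> /(osculates_vord hf qy fab qa) /(vord3_jet hf (coords k) fab u0).
  move=> /(osculating_plane_unique u0 fl0) e.
  have k3 : coords k 0 3%:R != 0.
    apply: contraNneq (coords_neq0 k) => z; move: e; rewrite z scale0r => /eqP.
    by rewrite scaler_eq0 (negPf u0).
  by rewrite -(ptZ _ k3) -e ptZ // pt_coords.
have osc : osculates C (pt (gv W a b)) (pt (gv W a b *m Om K)).
  apply: vord_osculates => //; apply/(vord3_jet hf _ fab u0) => k k3.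
  have [c c0 ->] := coords_pt (dual_neq0 w0).
  by rewrite dotpZl osculating_plane_ex // mulr0.
by split=> [[o _]|->]; [apply: uniq_h|split].
Qed.

(** A plane containing C annihilates all derivatives of W, so it osculates at every parametrized
    point; these then all coincide, though they are infinitely many. *)
Lemma contact_spanning h : ~ C `<=` hyperplane h.
Proof.
move=> Ch; apply: (im_infinite hf q0 (contact_inj qy)).
have v0 : van f (comb W (coords h)).
  apply: (van_cof hf q0) => a b fab qa; rewrite ev2_comb; apply/eqP.
  rewrite -(pairing_pt (coords_neq0 h) (contact_neq0 qy fab qa)) pt_coords.
  have : hyperplane h (pt (gv W a b)) by apply: Ch; apply: sub_zclosure; exists a, b.
  by rewrite /hyperplane /= => ->.
have jet k : van f (comb (jetW f k) (coords h)).
  by elim: k => [//|k /(van_delta hf)]; rewrite delta_comb.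
apply: (sub_finite_set _ (finite_set1 (pt (coords h *m invmx (Om K))))).
move=> _ [a [b [fab qa ->]]] /=.
have u0 := qy fab qa; have fl0 := qflex fab qa.
have /(osculating_plane_unique u0 fl0) e : forall k, (k < 3)%N -> dotp (coords h) (gv (jetW f k) a b) = 0.
  by move=> k _; rewrite -ev2_comb jet.
have k3 : coords h 0 3%:R != 0.
  apply: contraNneq (coords_neq0 h) => z; move: e; rewrite z scale0r => /eqP.
  by rewrite scaler_eq0 (negPf u0).
rewrite -(ptZ _ k3) -[gv W a b](mulmxK (Om_unit K)) scalemxAl -e -scalemxAl ptZ //.
Qed.

(** For any U, a form vanishing on the planes over U pulls back to one vanishing on the dense
    parametrized part, hence on C. For the converse a single U that avoids the unparametrized points
    suffices. *)
Lemma contact_image_dual : linear_image (Om K) C = osculating_dual C.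
Proof.
have ptOm x y : Defs.point (coords x *m Om K) = Some y <-> y = pt (coords x *m Om K).
  split=> [/point_Some [_ ->] //|->]; by rewrite point_pt // dual_neq0 // coords_neq0.
apply/seteqP; split=> y.
  move=> [x Cx /ptOm ->] U [oU [x1 [Cx1 Ux1]]].
  have [H [hH Hx HU]] := zopen_form oU Ux1.
  apply/zclosureP => F [k hF] Fv; have [G hG GE] := form_linear_sub (Om K) hF.
  have w0 : coords x *m Om K != 0 by rewrite dual_neq0 ?coords_neq0.
  have hF' : homogeneous F by exists k.
  have hG' : homogeneous G by exists k.
  apply/eqP; rewrite value_pt_eq0 // -GE; apply/eqP.
  apply: (im_form (contact_neq0 qy) hG' _ Cx) => a b fab qa.
  suff v0 : van f (sub2 W G) by rewrite -ev2_sub2_mev v0.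
  have /(van_mul hf) [vH|//] : van f (sub2 W H * sub2 W G).
    apply: (van_cof hf q0) => a' b' f' q'; rewrite ev2M.
    have [->|Hab] := eqVneq (ev2 (sub2 W H) a' b') 0; first by rewrite mul0r.
    have p0 := contact_neq0 qy f' q'.
    have im' : im f W q (pt (gv W a' b')) by exists a', b'.
    have : value F (pt (gv W a' b' *m Om K)) = 0.
      apply: Fv; exists (pt (gv W a' b')).
        by split; [apply: sub_zclosure|apply: HU; rewrite value_pt_eq0 // -ev2_sub2_mev].
      by apply/Osc2P.
    move/eqP; rewrite value_pt_eq0 ?dual_neq0 // -GE -ev2_sub2_mev => /eqP ->.
    by rewrite mulr0.
  by move: Hx; rewrite (form_vanish (contact_neq0 qy) hH vH Cx1) eqxx.
(* [U] will be the set where w0 and q(w1 / w0) are nonzero, so that each point of C in it is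
   parametrized and [Osc2P] gives its plane. *)
have [N tN] := tdeg_ex q%:P; pose Q : {mpoly K[4]} := 'X_0 * hom 'X_0 'X_1 'X_1 N q%:P.
have hX i : ('X_i : {mpoly K[4]}) \is 1.-homog by apply: homogeneousX.
have hQ : homogeneous Q by exists (1 + 1 * N)%N; apply: dhomogM => //; apply: hom_homog.
have Qv (w : 'rV[K]_4) : w 0 0 != 0 -> mev Q w = w 0 0 ^+ N.+1 * q.[w 0 1 / w 0 0].
  by move=> w0; rewrite /mev mevalM meval_hom ?mevalXU // ev2C exprS mulrA.
pose U := [set x | value Q x != 0].
have oU : zopen U.
  rewrite /zopen (_ : ~` U = [set y | value Q y = 0]); first exact: zclosed_form.
  apply/seteqP; split=> z /=; first by move=> /negP; rewrite negbK => /eqP.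
  by rewrite /U /= => ->; rewrite eqxx.
have [a qa] := poly_nonroot q0; have [b fab] := pc_point hf a.
have CU : C `&` U !=set0.
  exists (pt (gv W a b)); split; first by apply: sub_zclosure; exists a, b.
  have [w0 w1 _ _] := gvW f a b; have u0 := qy fab qa.
  rewrite /U /= value_pt_eq0 ?(contact_neq0 qy) // Qv ?w0 // w1 mulfK // mulf_neq0 //.
  by rewrite expf_neq0.
move=> /(_ U (conj oU CU)) Zy.
have y0 := coords_neq0 y.
have w0 : coords y *m invmx (Om K) != 0.
  by apply: contraNneq y0 => e; rewrite -[coords y](mulmxKV (Om_unit K)) e mul0mx.
exists (pt (coords y *m invmx (Om K))); last first.
  apply/ptOm; have [c c0 ->] := coords_pt w0.
  by rewrite -scalemxAl mulmxKV ?Om_unit // ptZ // pt_coords.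
apply/zclosureP => F [k hF] Fv; have [G hG GE] := form_linear_sub (invmx (Om K)) hF.
have hF' : homogeneous F by exists k.
have hG' : homogeneous G by exists k.
apply/eqP; rewrite value_pt_eq0 // -GE -value_coords; apply/eqP.
move/zclosureP: Zy; apply=> // h [x [Cx Ux] hx].
have x0 : coords x 0 0 != 0.
  by apply: contraNneq Ux => z; rewrite value_coords /mev mevalM mevalXU z mul0r.
have qx : q.[coords x 0 1 / coords x 0 0] != 0.
  by move: Ux; rewrite /U /= value_coords Qv // mulf_eq0 negb_or => /andP[].
have imx := contact_im hf qy Cx x0 qx.
have := Fv _ imx; case: imx => a1 [b1 [f1 q1 e]]; rewrite e => Fx.
have p0 := contact_neq0 qy f1 q1.
have -> : h = pt (gv W a1 b1 *m Om K) by apply/Osc2P; rewrite // -e.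
apply/eqP; rewrite value_pt_eq0 ?dual_neq0 // GE mulmxK ?Om_unit //.
by rewrite -value_pt_eq0 // Fx.
Qed.

Lemma contact_self_dual : osculating_self_dual C.
Proof.
split; [exact: (contact_curve hf q0 qy)|exact: contact_spanning|].
by exists (Om K); [apply: Om_unit|apply: contact_image_dual].
Qed.

End SelfDuality.

(** * Birational maps *)

Section RationalMaps.
Variable K : numClosedFieldType.
Local Notation BB := {poly {poly K}}.
Variables (f : BB) (d : nat).
Hypothesis hf : plane_curve f d.
Variable q : {poly K}.
Hypothesis q0 : q != 0.

Section OneMap.
Variables (n m : nat) (g : 'I_n.+1 -> BB) (g' : 'I_m.+1 -> BB).
Hypothesis gv0 : forall a b, ev2 f a b = 0 -> q.[a] != 0 -> gv g a b != 0.
Hypothesis gv0' : forall a b, ev2 f a b = 0 -> q.[a] != 0 -> gv g' a b != 0.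
Variables (V : set (projspace K n)) (Y : set (projspace K m)).
Hypotheses (VA : V `<=` zclosure (im f g q)) (AV : im f g q `<=` V).
Variables (F : 'I_m.+1 -> {mpoly K[n.+1]}) (k : nat).
Hypothesis hF : forall j, F j \is k.-homog.
Hypothesis FE : forall a b, ev2 f a b = 0 -> q.[a] != 0 ->
  exists2 c, c != 0 & fv F (gv g a b) = c *: gv g' a b.

Lemma formmap_fv x : formmap F x = Defs.point (fv F (coords x)).
Proof. by []. Qed.

Lemma formmap_im a b : ev2 f a b = 0 -> q.[a] != 0 ->
  formmap F (pt (gv g a b)) = Some (pt (gv g' a b)).
Proof.
move=> fab qa; rewrite formmap_fv; have [e e0 ->] := coords_pt (gv0 fab qa).
have [c c0 Ec] := FE fab qa; have ek : e ^+ k * c != 0 by rewrite mulf_neq0 // expf_neq0.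
rewrite (fvZ _ _ hF) Ec scalerA point_pt ?ptZ //.
by rewrite scaler_eq0 negb_or ek gv0'.
Qed.

(** An equation of [Y] composed with [F] is a form vanishing on the image, hence on all of [V]. *)
Lemma im_rational_map : zclosed Y -> im f g' q `<=` Y -> rational_map V Y (formmap F).
Proof.
move=> [S [hS YE]] AY; split; first by exists k, F.
  have [a qa] := poly_nonroot q0; have [b fab] := pc_point hf a.
  exists (pt (gv g a b)), (pt (gv g' a b)); rewrite formmap_im //; split=> //.
  by apply: AV; exists a, b.
move=> x y Vx; rewrite formmap_fv => /point_Some [v0 ->]; rewrite YE => H SH.
have [l hH] := hS _ SH; have [G hG GE] := form_sub hF hH.
apply/eqP; rewrite value_pt_eq0 //; last exact: hS.
have hG' : homogeneous G by exists (k * l)%N.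
rewrite -GE; apply/eqP; apply: (im_form gv0 hG' _ (VA Vx)) => a b fab qa.
have [c c0 Ec] := FE fab qa; rewrite GE Ec (mevZ _ _ hH).
have : Y (pt (gv g' a b)) by apply: AY; exists a, b.
rewrite YE => /(_ _ SH) /eqP; rewrite value_pt_eq0 ?gv0' //; last exact: hS.
by move=> /eqP ->; rewrite mulr0.
Qed.

Variables (G : 'I_n.+1 -> {mpoly K[m.+1]}) (l : nat).
Hypothesis hG : forall j, G j \is l.-homog.
Hypothesis GE : forall a b, ev2 f a b = 0 -> q.[a] != 0 ->
  exists2 c, c != 0 & fv G (gv g' a b) = c *: gv g a b.

(** The minors of G(F(x)) and x are forms in x that vanish on the image, hence on [V]. *)
Lemma im_retraction : rational_retraction V (formmap F) (formmap G).
Proof.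
split.
  have [a qa] := poly_nonroot q0; have [b fab] := pc_point hf a.
  exists (pt (gv g a b)), (pt (gv g a b)); split; first by apply: AV; exists a, b.
  rewrite formmap_im //= /formmap -/(fv G _); have [e e0 ->] := coords_pt (gv0' fab qa).
  have [c c0 Ec] := GE fab qa; have ek : e ^+ l * c != 0 by rewrite mulf_neq0 // expf_neq0.
  rewrite -[X in Defs.point X]/(fv G _) (fvZ _ _ hG) Ec scalerA point_pt ?ptZ //.
  by rewrite scaler_eq0 negb_or ek gv0.
move=> x x' Vx; rewrite formmap_fv; case E : (Defs.point _) => [y|//] /=.
have [v0 Ey] := point_Some E; rewrite Ey /formmap -[X in Defs.point X]/(fv G _).
have [e e0 ->] := coords_pt v0; rewrite (fvZ _ _ hG) => /point_Some [w0 ->].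
have el : e ^+ l != 0 by rewrite expf_neq0.
have {}w0 : fv G (fv F (coords x)) != 0 by apply: contraNneq w0 => ->; rewrite scaler0.
rewrite ptZ // -[RHS]pt_coords; apply: pt_cross => //; first exact: coords_neq0.
have comp j : {H : {mpoly K[n.+1]} | H \is (k * l).-homog &
   forall w, mev H w = mev (G j) (fv F w)}.
  by apply: cid2; apply: form_sub.
move=> i j; case: (comp i) => Hi hHi HiE; case: (comp j) => Hj hHj HjE.
have hZ : homogeneous (Hi * 'X_j - Hj * 'X_i).
  by exists (k * l + 1)%N; apply: rpredB; apply: dhomogM => //; apply: homogeneousX.
have ZE w : mev (Hi * 'X_j - Hj * 'X_i) w = mev (G i) (fv F w) * w 0 j - mev (G j) (fv F w) * w 0 i.
  by rewrite -HiE -HjE /mev mevalB !mevalM !mevalXU.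
rewrite ![fv G _ _ _]mxE; apply/eqP; rewrite -subr_eq0 -ZE; apply/eqP.
apply: (im_form gv0 hZ _ (VA Vx)) => a b fab qa; rewrite ZE.
have [c c0 Ec] := FE fab qa; have [c' c0' Ec'] := GE fab qa.
have Gi i' : mev (G i') (fv F (gv g a b)) = c ^+ l * c' * gv g a b 0 i'.
  rewrite Ec (mevZ _ _ (hG i')); have := congr1 (fun w : 'rV_n.+1 => w 0 i') Ec'.
  by rewrite [LHS]mxE [RHS]mxE => ->; rewrite mulrA.
by rewrite !Gi; ring.
Qed.

End OneMap.
End RationalMaps.

Section ContactBirational.
Variable K : numClosedFieldType.
Local Notation BB := {poly {poly K}}.
Variables (X : set (projspace K 2)) (M : 'M[K]_3) (f : BB) (d : nat) (cs : seq K).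
Hypothesis hX : irreducible_curve X.
Hypothesis hM : plane_model X M f d cs.
Let hf := pm_curve hM.
Let uM := pm_unit hM.
Variable q : {poly K}.
Hypothesis q0 : q != 0.

Lemma model_cofinite : finite_set (X `\` im f (gX M) q).
Proof.
apply: (@sub_finite_set _ _ ([set u | X u /\ (coords u *m invmx M) 0 0 = 0] `|`
   (fun p => pt (gv (gX M) p.1 p.2)) @` [set p : K * K | ev2 f p.1 p.2 = 0 /\ q.[p.1] = 0])).
  move=> u [Xu nu]; have [u0|u0] := eqVneq ((coords u *m invmx M) 0 0) 0; first by left.
  have [a [b [fab e]]] := pm_affine hM Xu u0; right; exists (a, b) => //=; split=> //.
  by apply/eqP; apply: contraT => qa; case: nu; exists a, b.
rewrite finite_setU; split; first exact: (pm_finite hM).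
by apply: finite_image; apply: (finite_fiber hf).
Qed.

Lemma model_dense : X `<=` zclosure (im f (gX M) q).
Proof.
have [[cX _ irr] _] := hX.
have cov : X `<=` zclosure (im f (gX M) q) `|` (X `\` im f (gX M) q).
  by move=> u Xu; have [h|h] := pselect (im f (gX M) q u); [left; apply: sub_zclosure|right].
have [//|XE] := irr _ _ (zclosure_closed _) (finite_zclosed model_cofinite) cov.
by case: (curve_infinite hX); apply: sub_finite_set XE model_cofinite.
Qed.

Hypothesis qy : forall a b, ev2 f a b = 0 -> q.[a] != 0 -> ev2 (dy f) a b != 0.
Local Notation C := (zclosure (im f (contact f) q)).

Lemma tdeg_contact i : tdeg d (contact f i).
Proof.
have tf := pc_tdeg hf; have [e de] : exists e, d = e.+1 by exists d.-1; rewrite prednK // (pc_gt0 hf).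
have ty : tdeg d.-1 (dy f) by apply: tdeg_dy.
have tx : tdeg d.-1 (dx f) by apply: tdeg_dx.
rewrite de /= in ty tx *; have tl A : tdeg e A -> tdeg e.+1 A by apply: tdeg_leq.
have tX A B : tdeg 1 A -> tdeg e B -> tdeg e.+1 (A * B) by rewrite -[e.+1]add1n; apply: tdegM.
have tN A N : tdeg N A -> tdeg N (- A) by move=> h i' j'; rewrite !coefN oppr_eq0; apply: h.
elim/ord4_ind: i; rewrite /contact /=.
- exact: tl.
- by apply: tX => //; apply: tdeg_x.
- by apply: tN; apply: tl.
apply: tdegD; last by apply: tX => //; apply: tdeg_x.
by rewrite mulr_natl mulr2n; apply: tX => //; apply: tdegD; apply: tdeg_y.
Qed.

Lemma contact_birational : birational C X.
Proof.
have [h0 h1 h2] := l_homog K.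
(* [Phi] writes (l0 : l1 : l2) in the coordinates of X; [Psi] homogenizes W in degree d. *)
pose Phi (j : 'I_3) : {mpoly K[4]} := M 0 j *: l0 K + M 1 j *: l1 K + M 2%:R j *: l2 K.
pose Psi (i : 'I_4) : {mpoly K[3]} := hom (cform M 0) (cform M 1) (cform M 2%:R) d (contact f i).
have hPhi j : Phi j \is 2.-homog by apply: rpredD; [apply: rpredD|]; apply: rpredZ.
have hPsi i : Psi i \is d.-homog.
  by rewrite -[d in X in X.-homog]mul1n; apply: hom_homog; apply: linform_homog.
have gW := contact_neq0 qy.
have gX0 a b : ev2 f a b = 0 -> q.[a] != 0 -> gv (gX M) a b != 0 by move=> _ _; apply: gX_neq0.
have PhiE a b : ev2 f a b = 0 -> q.[a] != 0 -> exists2 c, c != 0 &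
    fv Phi (gv (contact f) a b) = c *: gv (gX M) a b.
  move=> fab qa; have [n0 ea eb] := contact_l (qy fab qa); exists (mev (l0 K) (gv (contact f) a b)) => //.
  have e1 : mev (l1 K) (gv (contact f) a b) = a * mev (l0 K) (gv (contact f) a b).
    by rewrite -[X in _ = X * _]ea divfK.
  have e2 : mev (l2 K) (gv (contact f) a b) = b * mev (l0 K) (gv (contact f) a b).
    by rewrite -[X in _ = X * _]eb divfK.
  apply/rowP => j; rewrite [LHS]mxE gv_gX [RHS]mxE vec3_mul.
  have -> w : mev (Phi j) w = M 0 j * mev (l0 K) w + M 1 j * mev (l1 K) w + M 2%:R j * mev (l2 K) w.
    by rewrite /mev 2!mevalD (mevalZ _ (M 0 j)) (mevalZ _ (M 1 j)) (mevalZ _ (M 2%:R j)).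
  by rewrite e1 e2; ring.
have PsiE a b : ev2 f a b = 0 -> q.[a] != 0 -> exists2 c, c != 0 &
    fv Psi (gv (gX M) a b) = c *: gv (contact f) a b.
  move=> _ _; exists 1; rewrite ?oner_neq0 // scale1r; apply/rowP => i; rewrite [LHS]mxE [RHS]mxE.
  have cE j : mev (cform M j) (gv (gX M) a b) = vec3 1 a b 0 j.
    by rewrite mev_cform gv_gX mulmxK.
  have n0 : mev (cform M 0) (gv (gX M) a b) != 0 by rewrite cE vec3_0 oner_neq0.
  have tW : tdeg d (contact f i) by exact: tdeg_contact.
  have := meval_hom (cform M 1) (cform M 2%:R) tW n0.
  by rewrite -!/(mev _ _) !cE vec3_0 vec3_1 vec3_2 !divr1 expr1n mul1r.
have AX : im f (gX M) q `<=` X by move=> _ [a [b [fab _ ->]]]; apply: (pm_point hM).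
exists (formmap Phi), (formmap Psi); split.
- apply: (im_rational_map hf q0 gW gX0 _ _ hPhi PhiE) => //; first exact: sub_zclosure.
  by have [[]] := hX.
- apply: (im_rational_map hf q0 gX0 gW model_dense AX hPsi PsiE); first exact: zclosure_closed.
  exact: sub_zclosure.
- apply: (im_retraction hf q0 gW gX0 _ _ hPhi PhiE hPsi PsiE) => //; exact: sub_zclosure.
exact: (im_retraction hf q0 gX0 gW model_dense AX hPsi PsiE hPhi PhiE).
Qed.

End ContactBirational.

(** * The dual curve *)

Section Gradient.
Variables (K : numClosedFieldType) (n : nat).
Local Notation BB := {poly {poly K}}.

Lemma mderiv_homog i (F : {mpoly K[n.+1]}) d : F \is d.-homog -> mderiv i F \is d.-1.-homog.
Proof.
move=> /dhomogP hF; apply/dhomogP => m; rewrite mcoeff_msupp mcoeff_mderiv => mF.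
have /hF : (m + U_(i))%MM \in msupp F.
  by rewrite mcoeff_msupp; apply: contraNneq mF => ->; rewrite mul0rn.
by rewrite /= mdegD mdeg1 addn1 => <-.
Qed.

Lemma ev2_nat k a b : ev2 (k%:R : BB) a b = k%:R.
Proof. by rewrite (_ : k%:R = cc k%:R) ?ev2c // /cc !rmorph_nat. Qed.

(** Differentiate F(t w) = t^d F(w) at t = 1, with the outer variable of [BB] as t. *)
Lemma euler (F : {mpoly K[n.+1]}) d w : F \is d.-homog ->
  \sum_i mev (mderiv i F) w * w 0 i = d%:R * mev F w.
Proof.
move=> hF; pose g (i : 'I_n.+1) : BB := cc (w 0 i) * yy K.
have gE b : gv g 0 b = b *: w by apply/rowP => i; rewrite !mxE !ev2E mulrC.
have Dcc c : (cc c : BB)^`() = 0 by apply: dyC.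
have := chain_rule g (@derivD _) (@derivM _) Dcc F.
have -> : sub2 g F = cc (mev F w) * yy K ^+ d.
  apply: ev2_inj => a b; rewrite ev2_sub2_mev !ev2E.
  have -> : gv g a b = b *: w by apply/rowP => i; rewrite !mxE !ev2E mulrC.
  by rewrite (mevZ _ _ hF) mulrC.
move=> /(congr1 (fun A : BB => ev2 A 0 1)); rewrite ev2_sum derivM Dcc mul0r add0r derivXn.
rewrite -mulr_natr !ev2E ev2_nat expr1n mul1r [LHS]mulrC => ->.
apply: eq_bigr => i _; rewrite ev2M ev2_sub2_mev gE scale1r derivM Dcc mul0r add0r derivX mulr1.
by rewrite ev2c.
Qed.

End Gradient.

Section DualFamily.
Variable K : numClosedFieldType.
Local Notation BB := {poly {poly K}}.
Variables (M : 'M[K]_3) (F : {mpoly K[3]}) (f : BB) (d : nat).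
Hypotheses (uM : M \in unitmx) (hf : plane_curve f d) (hF : F \is d.-homog) (fE : f = sub2 (gX M) F).
Local Notation "'δ' A" := (delta f A) (at level 10, A at level 9).

Definition gD (j : 'I_3) : BB := sub2 (gX M) (mderiv j F).

Lemma tdeg_gD j : tdeg d.-1 (gD j).
Proof.
rewrite -[d.-1]mul1n; apply: tdeg_sub2 (mderiv_homog j hF) _ => i; exact: tdeg_gX.
Qed.

Lemma gv_gD a b : gv gD a b = fv (fun j => mderiv j F) (gv (gX M) a b).
Proof. by apply/rowP => j; rewrite !mxE ev2_sub2_mev. Qed.

Let dxcc c : dx (cc c : BB) = 0. Proof. by rewrite dxC derivC polyC0. Qed.
Let dycc c : (cc c : BB)^`() = 0. Proof. exact: dyC. Qed.

Lemma comb_gD1 : comb gD (row 1 M) = dx f.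
Proof.
rewrite fE (chain_rule _ (@dxD _) (@dxM _) dxcc); apply: eq_bigr => j _.
rewrite mxE mulrC; congr (_ * _).
by rewrite /gX !dxD !dxM !dxcc dxy (_ : dx (xx K) = 1) ?dxC ?derivX //; ring.
Qed.

Lemma comb_gD2 : comb gD (row 2%:R M) = dy f.
Proof.
rewrite fE /dy (chain_rule _ (@derivD _) (@derivM _) dycc); apply: eq_bigr => j _.
rewrite mxE mulrC; congr (_ * _).
rewrite /gX !derivD !derivM !dycc [(xx K)^`()]derivC derivX.
by ring.
Qed.

Lemma comb_gD0 : comb gD (row 0 M) = d%:R * f - xx K * dx f - yy K * dy f.
Proof.
have E : \sum_j gX M j * gD j = d%:R * f.
  apply: ev2_inj => a b; rewrite ev2_sum ev2M ev2_nat fE ev2_sub2_mev -(euler _ hF).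
  by apply: eq_bigr => j _; rewrite ev2M mulrC ev2_sub2_mev [in RHS]mxE.
rewrite -E -comb_gD1 -comb_gD2 /comb !mulr_sumr -!sumrB; apply: eq_bigr => j _.
by rewrite !mxE /gX; ring.
Qed.

Lemma dotp_mulmx (z : 'rV[K]_3) w : dotp (z *m M) w = \sum_i z 0 i * dotp (row i M) w.
Proof.
rewrite /dotp; under [RHS]eq_bigr do rewrite mulr_sumr; rewrite exchange_big /=.
by apply: eq_bigr => j _; rewrite mxE mulr_suml; apply: eq_bigr => i _; rewrite mxE mulrA.
Qed.

Lemma dotp_mulmx3 (z : 'rV[K]_3) w : dotp (z *m M) w =
  z 0 0 * dotp (row 0 M) w + z 0 1 * dotp (row 1 M) w + z 0 2%:R * dotp (row 2%:R M) w.
Proof.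
rewrite dotp_mulmx !big_ord_recl big_ord0 addr0 addrA.
congr (_ + z _ _ * dotp (row _ M) _ + z _ _ * dotp (row _ M) _); exact: val_inj.
Qed.

Section AtPoint.
Variables a b : K.
Hypothesis fab : ev2 f a b = 0.
Let u := ev2 (dy f) a b. Let v := ev2 (dx f) a b.
Let u1 := ev2 (δ (dy f)) a b. Let v1 := ev2 (δ (dx f)) a b.

Lemma dotp_gD (z : 'rV[K]_3) : dotp (z *m M) (gv gD a b) =
  v * (z 0 1 - a * z 0 0) + u * (z 0 2%:R - b * z 0 0).
Proof.
rewrite dotp_mulmx3 -!ev2_comb comb_gD0 comb_gD1 comb_gD2 !ev2E fab -/u -/v; ring.
Qed.

Lemma dotp_delta_gD (z : 'rV[K]_3) : dotp (z *m M) (gv (fun j => δ (gD j)) a b) =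
  v1 * (z 0 1 - a * z 0 0) + u1 * (z 0 2%:R - b * z 0 0).
Proof.
rewrite dotp_mulmx3 -!ev2_comb -!delta_comb comb_gD0 comb_gD1 comb_gD2.
rewrite (_ : d%:R = cc d%:R); last by rewrite /cc !rmorph_nat.
by rewrite !deltaE delta_id !ev2E -/u -/v -/u1 -/v1; ring.
Qed.

(* The point (1 : a : b) is the only one incident to the tangent line and to its derivative. *)
Lemma incident_point z : u * v1 - v * u1 != 0 -> dotp z (gv gD a b) = 0 ->
  dotp z (gv (fun j => δ (gD j)) a b) = 0 -> z = (z *m invmx M) 0 0 *: gv (gX M) a b.
Proof.
move=> o0; rewrite -{1 2}[z](mulmxKV uM); set z' := z *m invmx M.
rewrite dotp_gD dotp_delta_gD; set s := _ - a * _; set t := _ - b * _ => e1 e2.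
have /eqP : (u * v1 - v * u1) * s = 0.
  transitivity (u * (v1 * s + u1 * t) - u1 * (v * s + u * t)); first by ring.
  by rewrite e1 e2; ring.
have /eqP : (u * v1 - v * u1) * t = 0.
  transitivity (v1 * (v * s + u * t) - v * (v1 * s + u1 * t)); first by ring.
  by rewrite e1 e2; ring.
rewrite !mulf_eq0 (negPf o0) /= !subr_eq0 => /eqP t0 /eqP s0.
rewrite gv_gX scalemxAl vec3Z mulr1 [z' 0 0 * a]mulrC [z' 0 0 * b]mulrC -s0 -t0 -vec3E.
by rewrite mulmxKV.
Qed.

End AtPoint.

(** The function is - f_y^3 times the second derivative of y in x, and [flex] is a combination of it
    and its derivative. *)
Lemma nvan_wronskian : (1 < d)%N -> ~ van f (dy f * δ (dx f) - dx f * δ (dy f)).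
Proof.
move=> d1 vo; apply: (nvan_flex hf d1) => a b fab.
set w := dy f * δ (dx f) - dx f * δ (dy f) in vo.
have -> : flex f = 3%:R * δ (dy f) * w - dy f * δ w.
  by rewrite /w !(deltaB, deltaM) /flex; ring.
by rewrite ev2B !ev2M vo // (van_delta hf vo) // !mulr0 subr0.
Qed.

End DualFamily.

(** * Inverting the Gauss map *)

Section Biduality.
Variable K : numClosedFieldType.
Local Notation BB := {poly {poly K}}.
Variables (M : 'M[K]_3) (F : {mpoly K[3]}) (f : BB) (d : nat).
Hypotheses (uM : M \in unitmx) (hf : plane_curve f d) (hF : F \is d.-homog) (fE : f = sub2 (gX M) F).
Local Notation "'δ' A" := (delta f A) (at level 10, A at level 9).
Local Notation G := (gD M F).

Lemma dual_form_min : exists e (R : {mpoly K[3]}), [/\ R \is e.-homog, van f (sub2 G R),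
  exists v, mev R v != 0 & forall k (H : {mpoly K[3]}), (k < e)%N -> H \is k.-homog ->
    van f (sub2 G H) -> forall v, mev H v = 0].
Proof.
pose P m := `[< exists R : {mpoly K[3]}, [/\ R \is m.-homog, van f (sub2 G R) & exists v, mev R v != 0] >].
have exP : exists m, P m.
  have [R R0 hR] := alg_dep hf (G 0) (G 1) (G 2%:R); have [N tN] := tdeg_ex R.
  have hX i : ('X_i : {mpoly K[3]}) \is 1.-homog by apply: homogeneousX.
  (* The algebraic relation holds where the first coordinate is nonzero; the factor ['X_0] takes
     care of the other points. *)
  exists (1 + 1 * N)%N; apply/asboolP; exists ('X_0 * hom 'X_0 'X_1 'X_2%:R N R); split.
  - by apply: dhomogM => //; apply: hom_homog.
  - move=> a b fab; rewrite ev2_sub2_mev /mev mevalM mevalXU mxE.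
    have [->|n0] := eqVneq (ev2 (G 0) a b) 0; first by rewrite mul0r.
    by rewrite meval_hom ?mevalXU ?mxE // hR // !mulr0.
  have [a [b Rab]] : exists a b, ev2 R a b != 0.
    apply: contrapT => h; case/eqP: R0; apply: ev2_inj => a b; rewrite ev2_0.
    by apply/eqP; apply: contraT => n0; case: h; exists a, b.
  exists (vec3 1 a b); rewrite /mev mevalM mevalXU meval_hom ?mevalXU ?vec3_0 ?oner_neq0 //.
  by rewrite vec3_1 vec3_2 !divr1 expr1n !mul1r.
case: (ex_minnP exP) => e /asboolP [R [hR vR nR]] emin; exists e, R; split=> //.
move=> k H ke hH vH v; apply/eqP; apply: contraT => Hv.
have : P k by apply/asboolP; exists H; split=> //; exists v.
by move/emin; rewrite leqNgt ke.
Qed.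

(* The gradient of an equation R of minimal degree of the dual curve does not vanish identically,
   and it is proportional to (1 : a : b): it inverts the Gauss map. *)
Variables (e : nat) (R : {mpoly K[3]}).
Hypotheses (hR : R \is e.-homog) (vR : van f (sub2 G R)) (nR : exists v, mev R v != 0).
Hypothesis Rmin : forall k (H : {mpoly K[3]}), (k < e)%N -> H \is k.-homog ->
    van f (sub2 G H) -> forall v, mev H v = 0.
Local Notation gR := (fun j => mderiv j R).

(** Otherwise minimality makes every partial derivative zero, and Euler's relation makes R zero in
    characteristic 0. *)
Lemma dual_form_grad : exists i, ~ van f (sub2 G (gR i)).
Proof.
apply: contrapT => /forallNP h; have [v Rv] := nR.
have e0 : (0 < e)%N.
  rewrite lt0n; apply/eqP => e0; move: hR; rewrite e0 => hR0.
  have c w : mev R w = mev R 0 by have := mevZ 0 w hR0; rewrite expr0 mul1r scale0r.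
  have [b fab] := pc_point hf 0; have := vR fab.
  by rewrite ev2_sub2_mev c -(c v) => /eqP; rewrite (negPf Rv).
have := euler v hR; rewrite big1 => [/esym/eqP|i _].
  by rewrite mulf_eq0 (negPf Rv) orbF Num.Theory.pnatr_eq0 => /eqP z; move: e0; rewrite z.
rewrite (@Rmin e.-1 _ _ (mderiv_homog i hR)) ?mul0r //; first by rewrite prednK.
by apply: contrapT; apply: h.
Qed.

Let hgR j : gR j \is e.-1.-homog. Proof. exact: mderiv_homog. Qed.

(** Euler's relation and the derivative of R along the curve make the gradient of R incident to the
    tangent line and to its derivative. *)
Lemma dual_form_point a b (z := fv gR (gv G a b)) : ev2 f a b = 0 ->
  ev2 (dy f * δ (dx f) - dx f * δ (dy f)) a b != 0 ->
  z = (z *m invmx M) 0 0 *: gv (gX M) a b.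
Proof.
move=> fab; rewrite !ev2E => o0; apply: (incident_point uM hF fE fab o0).
  have := euler (gv G a b) hR; rewrite -ev2_sub2_mev vR // mulr0 => <-.
  by apply: eq_bigr => j _; rewrite mxE.
have := van_delta hf vR fab; rewrite (chain_rule _ (@deltaD _ f) (@deltaM _ f) (@delta_c _ f)) ev2_sum => <-.
by apply: eq_bigr => j _; rewrite ev2M ev2_sub2_mev !mxE.
Qed.

Variables (q : {poly K}) (i0 : 'I_3).
Hypothesis q0 : q != 0.
Hypothesis qy : forall a b, ev2 f a b = 0 -> q.[a] != 0 -> ev2 (dy f) a b != 0.
Hypothesis qw : forall a b, ev2 f a b = 0 -> q.[a] != 0 ->
  ev2 (dy f * δ (dx f) - dx f * δ (dy f)) a b != 0.
Hypothesis qR : forall a b, ev2 f a b = 0 -> q.[a] != 0 -> ev2 (sub2 G (gR i0)) a b != 0.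

Lemma gD_neq0 a b : ev2 f a b = 0 -> q.[a] != 0 -> gv G a b != 0.
Proof.
move=> fab qa; apply: contraNneq (qy fab qa) => z; rewrite -(comb_gD2 fE) ev2_comb z.
by rewrite /dotp big1 // => i _; rewrite [X in _ * X]mxE mulr0.
Qed.

Lemma dual_form_neq0 a b (z := fv gR (gv G a b)) : ev2 f a b = 0 -> q.[a] != 0 ->
  (z *m invmx M) 0 0 != 0.
Proof.
move=> fab qa; have := dual_form_point fab (qw fab qa); rewrite -/z => ze.
apply: contraNneq (qR fab qa) => k0; rewrite ev2_sub2_mev.
have -> : mev (gR i0) (gv G a b) = z 0 i0 by rewrite mxE.
by rewrite ze k0 scale0r mxE.
Qed.

Lemma gD_inj a b a' b' : ev2 f a b = 0 -> q.[a] != 0 -> ev2 f a' b' = 0 -> q.[a'] != 0 ->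
  pt (gv G a b) = pt (gv G a' b') -> a = a' /\ b = b'.
Proof.
move=> fab qa fab' qa' /(pt_eqP (gD_neq0 fab qa) (gD_neq0 fab' qa')) [c c0 E].
have := dual_form_point fab (qw fab qa); have := dual_form_neq0 fab qa.
rewrite E (fvZ _ _ hgR) (dual_form_point fab' (qw fab' qa')).
have := dual_form_neq0 fab' qa'; move: ((fv gR (gv G a' b') *m _) 0 0) => k' k'0.
set z := _ *: (_ *: _); move: ((z *m _) 0 0) => k k0; rewrite /z => zE.
apply: (gX_inj uM); rewrite -[LHS](ptZ _ k0) -zE !ptZ //.
by rewrite expf_neq0.
Qed.

(** The point (a, b) is read off from the gradient of R at u. That it lies on f = 0 and has u as
    tangent line are vanishing conditions on forms in u, true on the image and so on its closure. *)
Lemma dual_reconstruct u (z := fv gR (coords u)) (w := z *m invmx M) : zclosure (im f G q) u ->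
  w 0 0 != 0 -> q.[w 0 1 / w 0 0] != 0 -> im f G q u.
Proof.
move=> uA w0 qa; set a := w 0 1 / w 0 0 in qa; pose b := w 0 2%:R / w 0 0.
have zE : z = w 0 0 *: gv (gX M) a b.
  rewrite gv_gX scalemxAl vec3Z mulr1 ![w 0 0 * _]mulrC !divfK // -vec3E.
  by rewrite /w mulmxKV.
have fab : ev2 f a b = 0.
  have [H hH HE] := form_sub hgR hF; have hH' : homogeneous H by exists (e.-1 * d)%N.
  have : mev H (coords u) = 0.
    apply: (im_form gD_neq0 hH' _ uA) => a' b' f' q'.
    by rewrite HE (dual_form_point f' (qw f' q')) (mevZ _ _ hF) -ev2_sub2_mev -fE f' mulr0.
  rewrite HE -/z zE (mevZ _ _ hF) -ev2_sub2_mev -fE => /eqP.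
  by rewrite mulf_eq0 expf_eq0 (negPf w0) andbF => /eqP.
exists a, b; split=> //; rewrite -[LHS]pt_coords; apply: pt_cross (coords_neq0 u) (gD_neq0 fab qa) _ => i j.
have comp k : {H : {mpoly K[3]} | H \is (e.-1 * d.-1).-homog &
   forall w, mev H w = mev (mderiv k F) (fv gR w)}.
  by apply: cid2; apply: form_sub hgR (mderiv_homog k hF).
case: (comp i) => Hi hHi HiE; case: (comp j) => Hj hHj HjE.
have hZ : homogeneous (Hi * 'X_j - Hj * 'X_i).
  by exists (e.-1 * d.-1 + 1)%N; apply: rpredB; apply: dhomogM => //; apply: homogeneousX.
have ZE v : mev (Hi * 'X_j - Hj * 'X_i) v =
    mev (mderiv i F) (fv gR v) * v 0 j - mev (mderiv j F) (fv gR v) * v 0 i.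
  by rewrite -HiE -HjE /mev mevalB !mevalM !mevalXU.
have gE k a' b' c : mev (mderiv k F) (c *: gv (gX M) a' b') = c ^+ d.-1 * gv G a' b' 0 k.
  by rewrite (mevZ _ _ (mderiv_homog k hF)) gv_gD mxE.
have : mev (Hi * 'X_j - Hj * 'X_i) (coords u) = 0.
  apply: (im_form gD_neq0 hZ _ uA) => a' b' f' q'.
  by rewrite ZE (dual_form_point f' (qw f' q')) !gE; ring.
rewrite ZE -/z zE !gE -!mulrA -mulrBr => /eqP.
rewrite mulf_eq0 expf_eq0 (negPf w0) andbF /= subr_eq0 => /eqP h.
by rewrite mulrC [RHS]mulrC h.
Qed.

(** With C1 / C0 the abscissa of the reconstructed point, a missed point satisfies C0 = 0 or C1 = a
    C0 for a root a of q; neither equation holds on the whole image. *)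
Lemma dual_closure_finite : finite_set (zclosure (im f G q) `\` im f G q).
Proof.
have comp k : {H : {mpoly K[3]} | H \is (e.-1 * 1).-homog &
   forall w, mev H w = mev (cform M k) (fv gR w)}.
  by apply: cid2; apply: form_sub hgR _; apply: linform_homog.
case: (comp 0) => C0 hC0 C0E; case: (comp 1) => C1 hC1 C1E.
have hC a : homogeneous (C1 - a *: C0).
  by exists (e.-1 * 1)%N; apply: rpredB => //; apply: rpredZ.
have CE a w : mev (C1 - a *: C0) w = mev C1 w - a * mev C0 w.
  by rewrite /mev mevalB mevalZ.
have [a1 qa1] := poly_nonroot q0; have [b1 f1] := pc_point hf a1.
have k1 := dual_form_neq0 f1 qa1.
apply: (@sub_finite_set _ _ ([set u | zclosure (im f G q) u /\ value C0 u = 0] `|`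
  \bigcup_(a in [set a | q.[a] = 0])
    [set u | zclosure (im f G q) u /\ value (C1 - a *: C0) u = 0])).
  move=> u [uA nu]; have [w0|w0] := eqVneq (value C0 u) 0; first by left.
  right; move: w0; rewrite value_coords C0E mev_cform => w0.
  set w := fv gR (coords u) *m invmx M in w0.
  exists (w 0 1 / w 0 0).
    by apply/eqP; apply: contraT => qa; case: nu; apply: dual_reconstruct.
  by split=> //; rewrite value_coords CE C0E C1E !mev_cform -/w divfK // subrr.
have hC0' : homogeneous C0 by exists (e.-1 * 1)%N.
rewrite finite_setU; split.
  apply: (closure_form hf q0 gD_neq0 hC0') => // v; have := v a1 b1 f1.
  by rewrite ev2_sub2_mev C0E mev_cform => /eqP; rewrite (negPf k1).
apply: bigcup_finite; first exact: root_finite.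
move=> a /= qa; apply: (closure_form hf q0 gD_neq0 (hC a)) => // v; have := v a1 b1 f1.
rewrite ev2_sub2_mev CE C0E C1E !mev_cform.
have -> : (fv gR (gv G a1 b1) *m invmx M) 0 1 = a1 * (fv gR (gv G a1 b1) *m invmx M) 0 0.
  rewrite {1}(dual_form_point f1 (qw f1 qa1)) gv_gX -scalemxAl mulmxK // mxE vec3_1.
  exact: mulrC.
rewrite -mulrBl => /eqP; rewrite mulf_eq0 (negPf k1) orbF subr_eq0 => /eqP ea.
by move: qa1; rewrite ea qa eqxx.
Qed.

End Biduality.

Lemma hyperplane_vspace (K : numClosedFieldType) (L : 'rV[K]_3) : L != 0 ->
  exists W : {vspace 'rV[K]_3}, \dim W = 2%N /\ hyperplane (pt L) = [set y | (val y <= W)%VS].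
Proof.
move=> L0; pose phi : 'Hom('rV[K]_3, 'rV[K]_1) := linfun (mulmxr L^T).
have phiE v : phi v = (dotp L v)%:M.
  rewrite lfunE /= /mulmxr; apply/rowP => i; rewrite ord1 !mxE eqxx mulr1n.
  by apply: eq_bigr => j _; rewrite !mxE mulrC.
exists (lker phi); split; last first.
  apply/seteqP; split=> y /=; rewrite val_coords -memvE memv_ker phiE.
    rewrite /hyperplane /= => /eqP; rewrite -{1}[y]pt_coords pairing_pt ?coords_neq0 // => /eqP ->.
    by rewrite raddf0.
  move=> /eqP e; rewrite /hyperplane /=; apply/eqP; rewrite -[y]pt_coords pairing_pt ?coords_neq0 //.
  by have /rowP /(_ 0) := e; rewrite !mxE eqxx mulr1n => ->.
have /rv_neq0P [i Li] := L0.
have phid : phi (delta_mx 0 i) != 0.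
  rewrite phiE dotpC dotp_delta; apply: contraNneq Li => e.
  by have /rowP /(_ 0) := e; rewrite !mxE eqxx mulr1n => ->.
have l1 : \dim (limg phi) = 1%N.
  apply/eqP; rewrite eqn_leq; apply/andP; split.
    by rewrite (leq_trans (dimvS (subvf _))) // dimvf /dim /=.
  rewrite lt0n dimv_eq0; apply: contra phid => /eqP e.
  by rewrite -memv0 -e memv_img // memvf.
have := limg_ker_dim phi fullv; rewrite capfv l1 dimvf /dim /= => e.
by apply/eqP; rewrite -(eqn_add2r 1) e.
Qed.

Section DualCurve.
Variable K : numClosedFieldType.
Local Notation BB := {poly {poly K}}.
Variables (X : set (projspace K 2)) (M : 'M[K]_3) (f : BB) (d : nat) (cs : seq K).
Hypothesis hX : irreducible_curve X.
Hypothesis hM : plane_model X M f d cs.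
Let hf := pm_curve hM.
Let uM := pm_unit hM.
Variable F : {mpoly K[3]}.
Hypotheses (hF : F \is d.-homog) (FX : forall u, X u -> value F u = 0) (fE : f = sub2 (gX M) F).
Local Notation "'δ' A" := (delta f A) (at level 10, A at level 9).
Local Notation G := (gD M F).

Section TangentLine.
Variables a b : K.
Hypotheses (fab : ev2 f a b = 0) (u0 : ev2 (dy f) a b != 0).

(** The tangent line is spanned by the point w and its derivative w' along the curve. The gradient
    of H kills w by Euler's relation and w' because H vanishes along the curve. *)
Lemma tangent_form (H : {mpoly K[3]}) (y : 'rV[K]_3) : homogeneous H ->
  (forall u, X u -> value H u = 0) -> dotp (gv G a b) y = 0 ->
  dotp (fv (fun j => mderiv j H) (gv (gX M) a b)) y = 0.
Proof.
move=> hH HX; have [e he] := hH.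
have vH : van f (sub2 (gX M) H).
  move=> a' b' f'; apply/eqP; rewrite ev2_sub2_mev -value_pt_eq0 ?gX_neq0 //.
  by apply/eqP; apply: HX; apply: (pm_point hM).
set z := fv _ _; set w := gv (gX M) a b; set w' := gv (fun j => δ (gX M j)) a b.
have zw : dotp z w = 0.
  have := euler w he; rewrite -ev2_sub2_mev vH // mulr0 => <-.
  by apply: eq_bigr => j _; rewrite [X in X * _]mxE.
have zw' : dotp z w' = 0.
  have := van_delta hf vH fab; rewrite (chain_rule _ (@deltaD _ f) (@deltaM _ f) (@delta_c _ f)) ev2_sum => <-.
  by apply: eq_bigr => j _; rewrite ev2M ev2_sub2_mev !mxE.
rewrite dotpC -[y](mulmxKV uM); set y' := y *m invmx M; rewrite (dotp_gD hF fE fab).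
set u := ev2 (dy f) a b; set v := ev2 (dx f) a b; move: y' => {}y' e1.
have w'E : w' = vec3 0 u (- v) *m M.
  apply/rowP => j; rewrite vec3_mul mxE /gX !deltaE !ev2E -/u -/v; ring.
have yE : u *: (y' *m M) = (u * y' 0 0) *: w + (y' 0 1 - a * y' 0 0) *: w'.
  rewrite /w gv_gX w'E !scalemxAl -mulmxDl; congr (_ *m M).
  have e2 : u * y' 0 2%:R = u * b * y' 0 0 - v * (y' 0 1 - a * y' 0 0).
    by apply/eqP; rewrite -subr_eq0 -[X in _ == X]e1; apply/eqP; ring.
  have uy i : (u *: y') 0 i = u * y' 0 i by rewrite mxE.
  rewrite [LHS]vec3E !uy e2 !vec3Z.
  by apply/rowP => -[[|[|[|//]]] hi]; rewrite !mxE /=; ring.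
apply: (mulfI u0); rewrite mulr0 -dotpZr yE dotpC dotpDl !dotpZl ![dotp _ z]dotpC zw zw'.
by rewrite !mulr0 addr0.
Qed.

Let fyG : gv G a b != 0.
Proof.
apply: contraNneq u0 => z; rewrite -(comb_gD2 fE) ev2_comb z.
by rewrite /dotp big1 // => i _; rewrite [X in _ * X]mxE mulr0.
Qed.

Lemma tangent_line : tangent_space X (pt (gv (gX M) a b)) = hyperplane (pt (gv G a b)).
Proof.
have w0 := gX_neq0 uM a b; have [c c0 ce] := coords_pt w0.
have sumE (H : {mpoly K[3]}) e (y : projspace K 2) : H \is e.-homog ->
   \sum_i value (mderiv i H) (pt (gv (gX M) a b)) * coords y 0 i =
   c ^+ e.-1 * dotp (fv (fun j => mderiv j H) (gv (gX M) a b)) (coords y).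
  move=> hH; rewrite -dotpZl; apply: eq_bigr => i _; rewrite value_coords ce mxE mxE.
  by rewrite (mevZ _ _ (mderiv_homog i hH)).
have hypE y : hyperplane (pt (gv G a b)) y <-> dotp (gv G a b) (coords y) = 0.
  rewrite /hyperplane /=; split=> [/eqP|e]; last apply/eqP;
    by rewrite -{1}[y]pt_coords pairing_pt ?coords_neq0 // ?e // => /eqP.
apply/seteqP; split=> y.
  move=> ty; apply/hypE; have := ty F (ex_intro _ d hF) FX; rewrite (sumE _ _ _ hF) -gv_gD => /eqP.
  by rewrite mulf_eq0 expf_eq0 (negPf c0) andbF => /eqP.
move=> /hypE e H hH HX; have [k hk] := hH; rewrite (sumE _ _ _ hk) tangent_form ?mulr0 //.
Qed.

Lemma tangent_smooth : smooth_point X (pt (gv (gX M) a b)).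
Proof.
split; first exact: (pm_point hM).
by have [W [dW WE]] := hyperplane_vspace fyG; exists W; rewrite tangent_line.
Qed.

End TangentLine.

Variable q : {poly K}.
Hypothesis q0 : q != 0.
Hypothesis qy : forall a b, ev2 f a b = 0 -> q.[a] != 0 -> ev2 (dy f) a b != 0.

Lemma im_dual_curve : im f G q `<=` dual_curve X.
Proof.
move=> _ [a [b [fab qa ->]]]; apply: sub_zclosure.
exists (pt (gv (gX M) a b)); first exact: (tangent_smooth fab (qy fab qa)).
exact: (tangent_line fab (qy fab qa)).
Qed.

(** The finitely many points of X outside the parametrization contribute at most one tangent line
    each. *)
Lemma dual_curve_cofinite : finite_set (zclosure (im f G q) `\` im f G q) ->
  finite_set (dual_curve X `\` im f G q).
Proof.
move=> fin; pose E := [set l | exists2 x, (X `\` im f (gX M) q) x & tangent_space X x = hyperplane l].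
have finE : finite_set E.
  (* [base_point] is the value at points whose tangent space is not a line. *)
  pose l x : projspace K 2 := xget (base_point K 2) [set l | tangent_space X x = hyperplane l].
  apply: (sub_finite_set _ (finite_image l (model_cofinite hM q0))).
  move=> h [x Xx th]; exists x => //; rewrite /l.
  by apply: hyperplane_inj; case: xgetP => [k _ /= <- //|/(_ h)].
have sub : dual_curve X `<=` zclosure (im f G q) `|` E.
  apply: subset_trans (zclosureU_finite finE); apply: zclosureS => h [x [Xx _] th].
  have [imx|nx] := pselect (im f (gX M) q x); last by right; exists x.
  left; case: imx th => a [b [fab qa ->]] th; exists a, b; split=> //.
  by apply: hyperplane_inj; rewrite -th (tangent_line fab (qy fab qa)).
apply: (@sub_finite_set _ _ ((zclosure (im f G q) `\` im f G q) `|` E)).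
  by move=> h [/sub [hz|hE] nh]; [left|right].
by rewrite finite_setU.
Qed.

End DualCurve.

(** * Degrees *)

Section DegreeFromContent.
Variable K : numClosedFieldType.
Local Notation BB := {poly {poly K}}.
Variables (f : BB) (d : nat) (cs : seq K).
Hypothesis hf : plane_curve f d.
Hypothesis hcs : fiber_roots (revp d f) 0 cs.

Lemma Nm_van A B : van f (A - B) -> Nm f A = Nm f B.
Proof.
move=> h; apply: (@poly_fun_inj _ _ _ 1); rewrite ?oner_neq0 // => a _.
have [bs _ hbs] := fiber_ex a (pc_monic hf) (pc_size hf).
rewrite !(Nm_fiber _ (pc_monic hf) (pc_size1 hf) hbs); apply: eq_big_seq => b.
rewrite (fiber_rootsP _ hbs) => /eqP fab.
by apply/eqP; rewrite -subr_eq0 -ev2B h.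
Qed.

(** At infinity f_y becomes the derivative of the fibre of the reversed curve, whose roots [cs] are
    simple. *)
Lemma topev_dy_neq0 e : d = e.+1 -> uniq cs -> {in cs, forall c, topev e (dy f) c != 0}.
Proof.
move=> de ucs c ccs; have tf : tdeg e.+1 f by rewrite -de; apply: (pc_tdeg hf).
rewrite (revp_dy tf) -de hcs; set p := \prod_(_ <- _) _.
have : separable_poly p by rewrite separable_prod_XsubC.
by rewrite unlock => /coprimep_root; apply; rewrite root_prod_XsubC.
Qed.

Variables (n : nat) (g : 'I_n.+1 -> BB) (e : nat) (D : {poly K}).
Hypotheses (tg : forall i, tdeg e (g i)) (D0 : D != 0) (hD : forall h, D %| Nm f (comb g h)).
Hypothesis noroot : forall a, exists h, (Nm f (comb g h) %/ D).[a] != 0.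
Hypothesis topc : exists h, {in cs, forall c, topev e (comb g h) c != 0}.

(** A combination without zeros at infinity has a norm of degree exactly d e; dividing by [D] lowers
    it by deg D, written [(size D).-1]. *)
Lemma degree_from_content (r : {poly K}) (V : set (projspace K n)) : r != 0 ->
  (forall a b, ev2 f a b = 0 -> r.[a] != 0 -> gv g a b != 0) ->
  (forall a b a' b', ev2 f a b = 0 -> r.[a] != 0 -> ev2 f a' b' = 0 -> r.[a'] != 0 ->
     pt (gv g a b) = pt (gv g a' b') -> a = a' /\ b = b') ->
  im f g r `<=` V -> finite_set (V `\` im f g r) ->
  ((size D).-1 <= d * e)%N /\ degree V = (d * e - (size D).-1)%N.
Proof.
move=> r0 gv0 gv_inj imV finV; have [h0 top0] := topc.
have tc h : tdeg e (comb g h) by apply: tdeg_comb.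
have N0 : (Nm f (comb g h0))`_(d * e) != 0.
  have [_ ->] := Nm_infinity hf hcs (tc h0); rewrite big_seq prodf_seq_neq0.
  by apply/allP => c ccs; rewrite ccs top0.
have s0 : size (Nm f (comb g h0)) = (d * e).+1.
  apply/eqP; rewrite eqn_leq; have [-> _] := Nm_infinity hf hcs (tc h0).
  by rewrite ltnNge; apply/negP => /(nth_default 0) z; rewrite z eqxx in N0.
have sD : ((size D).-1 <= d * e)%N.
  have Nm0 : Nm f (comb g h0) != 0 by rewrite -size_poly_eq0 s0.
  have := dvdp_leq Nm0 (hD h0); rewrite s0.
  by rewrite -subn1 leq_subLR add1n.
split=> //; apply: (@degree_family K f d hf n g D (d * e - (size D).-1) D0 hD noroot _ _ r) => //.
- move=> h; rewrite /redN size_divp //; have [sh _] := Nm_infinity hf hcs (tc h).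
  by rewrite (leq_trans (leq_sub2r _ sh)) // subSn.
- exists h0; have sr : size (redN f g D h0) = (d * e - (size D).-1).+1.
    by rewrite /redN size_divp // s0 subSn.
  have -> : (redN f g D h0)`_(d * e - (size D).-1) = lead_coef (redN f g D h0).
    by rewrite lead_coefE sr.
  by rewrite lead_coef_eq0 -size_poly_eq0 sr.
by move=> a b fab ra; apply: imV; exists a, b.
Qed.

End DegreeFromContent.

Section Degrees.
Variable K : numClosedFieldType.
Local Notation BB := {poly {poly K}}.
Variables (X : set (projspace K 2)) (M : 'M[K]_3) (f : BB) (d : nat) (cs : seq K).
Hypothesis hM : plane_model X M f d cs.
Let hf := pm_curve hM.
Let uM := pm_unit hM.
Variable F : {mpoly K[3]}.
Hypotheses (hF : F \is d.-homog) (fE : f = sub2 (gX M) F).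
Local Notation G := (gD M F).
Local Notation W := (contact f).

(* Modulo f the two families span the same K[x]-module, generated by f_x, f_y and y f_y. *)
Lemma dual_in_contact h : exists s : 'I_4 -> {poly K}, van f (comb G h - \sum_i (s i)%:P * W i).
Proof.
pose z := h *m invmx M.
(* In f_x (z1 - x z0) + f_y (z2 - y z0) the term in y f_y forces the coefficient - z0 / 2 on the
   last coordinate of W; its part in x f_x is then corrected in the third one. *)
exists (fun i => [:: (z 0 2%:R)%:P; 0; - (z 0 1)%:P + (z 0 0 / 2%:R)%:P * 'X; (- (z 0 0 / 2%:R))%:P]`_i).
move=> a b fab; rewrite ev2B ev2_comb -{1}[h](mulmxKV uM) -/z (dotp_gD hF fE fab).
rewrite !big_ord_recl big_ord0 !ev2E !ev2C /contact /= ?ev2E ?ev2_nat !hornerE /=.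
by field.
Qed.

Lemma contact_in_dual h : exists s : 'I_3 -> {poly K}, van f (comb W h - \sum_i (s i)%:P * G i).
Proof.
(* The term 2 h3 y f_y requires z0 = - 2 h3; the coefficients of f_x and f_y then give z1 and z2. *)
pose z (a : K) : 'rV[K]_3 := vec3 (- 2%:R * h 0 3%:R) (- h 0 2%:R - h 0 3%:R * a) (h 0 0 + h 0 1 * a).
exists (fun j => (- 2%:R * h 0 3%:R * M 0 j)%:P + (- (h 0 2%:R)%:P - (h 0 3%:R)%:P * 'X) * (M 1 j)%:P +
   ((h 0 0)%:P + (h 0 1)%:P * 'X) * (M 2%:R j)%:P).
move=> a b fab; rewrite ev2B ev2_comb ev2_sum.
have -> : \sum_i ev2 (((- 2%:R * h 0 3%:R * M 0 i)%:P + (- (h 0 2%:R)%:P - (h 0 3%:R)%:P * 'X) * (M 1 i)%:P +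
   ((h 0 0)%:P + (h 0 1)%:P * 'X) * (M 2%:R i)%:P)%:P * G i) a b = dotp (z a *m M) (gv G a b).
  by apply: eq_bigr => j _; rewrite ev2M ev2C !hornerE vec3_mul [in RHS]mxE.
rewrite (dotp_gD hF fE fab) /z vec3_0 vec3_1 vec3_2 dotp4.
by have [-> -> -> ->] := gvW f a b; ring.
Qed.

(** [D] is chosen for the norms of W and then shown to be the common factor for G as well, by
    carrying divisibility through the spans both ways. *)
Lemma degrees_sum (q : {poly K}) (V : set (projspace K 3)) (Y : set (projspace K 2)) : q != 0 ->
  (forall a b, ev2 f a b = 0 -> q.[a] != 0 -> gv W a b != 0) ->
  (forall a b a' b', ev2 f a b = 0 -> q.[a] != 0 -> ev2 f a' b' = 0 -> q.[a'] != 0 ->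
     pt (gv W a b) = pt (gv W a' b') -> a = a' /\ b = b') ->
  im f W q `<=` V -> finite_set (V `\` im f W q) ->
  (forall a b, ev2 f a b = 0 -> q.[a] != 0 -> gv G a b != 0) ->
  (forall a b a' b', ev2 f a b = 0 -> q.[a] != 0 -> ev2 f a' b' = 0 -> q.[a'] != 0 ->
     pt (gv G a b) = pt (gv G a' b') -> a = a' /\ b = b') ->
  im f G q `<=` Y -> finite_set (Y `\` im f G q) ->
  degree V = (d + degree Y)%N.
Proof.
move=> q0 W0 Winj imV finV G0 Ginj imY finY; have [hcs ucs] := pm_infinity hM.
have [e de] : exists e, d = e.+1 by exists d.-1; rewrite prednK // (pc_gt0 hf).
have fy c : c \in cs -> topev e (dy f) c != 0 by apply: (topev_dy_neq0 hf hcs de ucs).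
have te : tdeg e (dy f) by have := tdeg_dy (pc_tdeg hf); rewrite de.
have [|D [D0 hD noroot]] := @Nm_content K f d hf 3 W.
  by exists (delta_mx 0 0); rewrite comb_delta; apply: (nvan_dy hf).
have transfer n (g : 'I_n.+1 -> BB) (D' : {poly K}) A : D' != 0 -> (forall h, D' %| Nm f (comb g h)) ->
    (exists s : 'I_n.+1 -> {poly K}, van f (A - \sum_i (s i)%:P * g i)) -> D' %| Nm f A.
  by move=> D'0 hD' [s /(Nm_van hf) ->]; apply: Nm_span.
have [sV dV] : ((size D).-1 <= d * d)%N /\ degree V = (d * d - (size D).-1)%N.
  apply: (degree_from_content hf hcs _ D0 hD noroot _ q0) => //; first by move=> i; apply: tdeg_contact hM _.
  exists (delta_mx 0 1) => c ccs; rewrite comb_delta /contact /= {1}de.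
  by rewrite -[e.+1]add1n (topevM _ (@tdeg_x K) te) topev_x mul1r fy.
have [sY dY] : ((size D).-1 <= d * e)%N /\ degree Y = (d * e - (size D).-1)%N.
  apply: (degree_from_content hf hcs (g := G) _ D0 _ _ _ q0) => //.
  - by move=> i; have tG : tdeg d.-1 (gD M F i) := @tdeg_gD K M F d hF i; move: tG; rewrite de.
  - by move=> h; exact: (transfer _ _ _ _ D0 hD (dual_in_contact h)).
  (* A common root a of the quotients for G would put (X - a) D into every norm of W, against the
     choice of [D]. *)
  - move=> a; apply: contrapT => /forallNP na; have [h0 /eqP] := noroot a; apply.
    pose D' := ('X - a%:P) * D; have D'0 : D' != 0 by rewrite mulf_neq0 // polyXsubC_eq0.
    have : D' %| Nm f (comb W h0).
      apply: (transfer _ _ _ _ D'0 _ (contact_in_dual h0)) => h.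
      have dh : D %| Nm f (comb G h) by exact: (transfer _ _ _ _ D0 hD (dual_in_contact h)).
      rewrite -(divpK dh) dvdp_mul // dvdp_XsubCl /root.
      by apply/negPn/negP; apply: na.
    by move=> /dvdpP [s ->]; rewrite mulrA mulpK // hornerM hornerXsubC subrr mulr0.
  by exists (row 2%:R M) => c ccs; rewrite (comb_gD2 fE) fy.
rewrite dV dY addnBA //; congr (_ - _)%N.
by rewrite {2}de mulnS.
Qed.

End Degrees.

Section Main.
Variable K : numClosedFieldType.
Local Notation BB := {poly {poly K}}.

(** All open conditions are gathered into one polynomial q in x, so that the contact curve and the
    dual curve are parametrized by the same points. *)
Lemma nvan_common (f : BB) d (As : seq BB) : plane_curve f d -> {in As, forall A, ~ van f A} ->
  exists2 q : {poly K}, q != 0 & forall A, A \in As -> forall a b, ev2 f a b = 0 -> q.[a] != 0 -> ev2 A a b != 0.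
Proof.
move=> hf; elim: As => [|A As IH] nv; first by exists 1; rewrite ?oner_neq0.
have [|q q0 hq] := IH; first by move=> B BAs; apply: nv; rewrite inE BAs orbT.
have [r r0 hr] := pc_cof hf (nv A (mem_head _ _)).
exists (r * q) => [|B]; first by rewrite mulf_neq0.
rewrite inE => /orP[/eqP ->|BAs] a b fab; rewrite hornerM mulf_eq0 negb_or => /andP[ra qa].
  by apply: contraNneq ra => z; rewrite (hr a b fab z).
exact: (hq B BAs a b fab qa).
Qed.

Lemma contact_curve_ex (X : set (projspace K 2)) : irreducible_curve X -> (1 < degree X)%N ->
  exists C : set (projspace K 3), [/\ osculating_self_dual C, birational C X &
    degree C = (degree X + degree (dual_curve X))%N].
Proof.
move=> hX; have [M [f [d [cs hM]]]] := plane_model_ex hX; rewrite (plane_degree hM) => d1.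
have hf := pm_curve hM; have uM := pm_unit hM; have [F [hF FX fE]] := pm_form hM.
have [e [R [hR vR nR Rmin]]] := dual_form_min M F hf.
have [i0 nvi] := dual_form_grad hf hR vR nR Rmin.
(* f_y makes x a local parameter, [flex] makes the osculating plane unique, and the last two
   functions invert the Gauss map. *)
pose As := [:: dy f; flex f; dy f * delta f (dx f) - dx f * delta f (dy f); sub2 (gD M F) (mderiv i0 R)].
have [|q q0 hq] := @nvan_common f d As hf.
  move=> A; rewrite !inE => /or4P[] /eqP -> //; first exact: (nvan_dy hf).
    exact: (nvan_flex hf d1).
  exact: (nvan_wronskian hf d1).
have mem A i : (i < 4)%N -> A = nth 0 As i -> A \in As by move=> i4 ->; rewrite mem_nth.
have qy := hq _ (mem (dy f) 0%N isT erefl).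
have qf := hq _ (mem (flex f) 1%N isT erefl).
have qw := hq _ (mem _ 2%N isT erefl).
have qR := hq _ (mem _ 3%N isT erefl).
exists (zclosure (im f (contact f) q)); split.
- exact: (contact_self_dual hf q0 qy qf).
- exact: (contact_birational hX hM q0 qy).
apply: (degrees_sum hM hF fE q0).
- exact: (contact_neq0 qy).
- exact: (contact_inj qy).
- exact: sub_zclosure.
- exact: (contact_finite hf q0 qy).
- exact: (gD_neq0 fE qy).
- exact: (gD_inj uM hf hF fE hR vR qy qw qR).
- exact: (im_dual_curve hM hF FX fE qy).
apply: (dual_curve_cofinite hM hF FX fE q0 qy).
exact: (dual_closure_finite uM hf hF fE hR vR q0 qy qw qR).
Qed.

End Main.

Theorem proposition4p5 (R : realType) (X : set (projspace R[i]%C 2))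
  (hX : irreducible_curve X) (hdeg : (1 < degree X)%N) :
  exists C : set (projspace R[i]%C 3),
    [/\ osculating_self_dual C, birational C X &
        degree C = (degree X + degree (dual_curve X))%N].
Proof. exact: contact_curve_ex. Qed.
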